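(* Let $0<\tau<1$, let $X^\tau$ be either the fractional Brownian motion of Hurst index $\tau$ or the Riemann-Liouville process of index $\tau$, and let $L^\tau(x,t)$ be the jointly continuous version of its local time. Let $f$ be a Lebesgue integrable Borel function on $\mathbb{R}$ such that $\overline{f}:=\int_{\mathbb{R}} f(x)\,dx\neq 0$ and $$\int_{\mathbb{R}}|x|^k|f(x)|\,dx<+\infty$$ for some $k>0$. Then, for all sufficiently small $\varepsilon>0$, as $t\to+\infty$, $$\int_0^t f(X^\tau(s))\,ds=\overline{f}\,L^\tau(0,t)+o\left(t^{1-\tau-\varepsilon}\right)\quad\text{a.s.}$$
   Context: The fractional Brownian motion of Hurst index $\tau\in(0,1)$ is the a.s. continuous centered Gaussian process $(X^\tau(t))_{t\ge0}$ with covariance $\frac12(t^{2\tau}+s^{2\tau}-|t-s|^{2\tau})$. The Riemann-Liouville process of index $\tau$ is (a continuous version of) $X^\tau(t)=\int_0^t(t-s)^{\tau-1/2}\,dW(s)$, $t\ge0$, where $W$ is a standard Brownian motion. For $0<\tau<1$ each of these processes has a local time $L^\tau(x,t)$, $x\in\mathbb{R}$, $t\ge0$, i.e. the density with respect to Lebesgue measure of the occupation measure $A\mapsto\int_0^t\mathbb{I}_A(X^\tau(s))\,ds$, so that $\int_0^t g(X^\tau(s))\,ds=\int_{\mathbb{R}}g(x)L^\tau(x,t)\,dx$ for Borel $g\ge0$; the version that is a.s. jointly continuous in $(x,t)$ is used. A statement $A(t)=o(h(t))$ a.s. as $t\to+\infty$ means that $A(t)/h(t)\to0$ almost surely as $t\to+\infty$.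 *)

(* Defs.v *)
From HB Require Import structures.
From mathcomp Require Import all_boot all_order all_algebra.
From mathcomp Require Import all_classical all_reals all_analysis.

Set Implicit Arguments.
Unset Strict Implicit.
Unset Printing Implicit Defensive.

Import Order.TTheory GRing.Theory Num.Theory.
Import numFieldNormedType.Exports.

Local Open Scope classical_set_scope.
Local Open Scope ring_scope.

(* Throughout, a process indexed by t >= 0 is a family [X : R -> {RV P >-> R}]
   of which only the members [X t] with [0 <= t] are ever constrained or used. *)

Section processes.
Context d (T : measurableType d) (R : realType) (P : probability T R).
Implicit Types X W : R -> {RV P >-> R}.

Local Notation mu := (@lebesgue_measure R).

(* The degenerate case is split off because [normal_prob m 0] is not [dirac m]
   in the library (it is the uniform law on [0, 1]). *)
Definition gaussian_rv (Y : T -> R) : Prop :=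
  exists m s : R, forall A : set R, measurable A ->
    pushforward P Y A = (if s == 0 then dirac m A else normal_prob m s A).

Definition gaussian_process X : Prop :=
  forall (n : nat) (t c : 'I_n -> R), (forall i, 0 <= t i) ->
    gaussian_rv (fun w => \sum_(i < n) c i * X (t i) w).

Definition centered X : Prop := forall t : R, 0 <= t -> ('E_P[X t] = 0)%E.

Definition has_covariance X (K : R -> R -> R) : Prop :=
  forall s t : R, 0 <= s -> 0 <= t -> covariance P (X s) (X t) = (K s t)%:E.

Definition as_continuous X : Prop :=
  {ae P, forall w, {within `[0, +oo[, continuous (fun t => X t w)}}.

Definition fractional_brownian_motion (tau : R) X : Prop :=
  [/\ gaussian_process X, centered X,
      has_covariance X (fun s t =>
        (t `^ (2 * tau) + s `^ (2 * tau) - `|t - s| `^ (2 * tau)) / 2) &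
      as_continuous X].

Definition brownian_motion W : Prop :=
  [/\ gaussian_process W, centered W,
      has_covariance W (fun s t => Num.min s t) & as_continuous W].

(* A finite list of triples [(c, a, b)] encodes the step function
   [\sum c * \1_`]a, b]]. *)
Definition step_in (t : R) (s : seq (R * R * R)) : Prop :=
  forall c a b, (c, a, b) \in s -> [/\ 0 <= a, a <= b & b <= t].

Definition step_fun (s : seq (R * R * R)) (u : R) : R :=
  \sum_(p <- s) (let: (c, a, b) := p in c * \1_`]a, b] u).

Definition step_integral W (s : seq (R * R * R)) (w : T) : R :=
  \sum_(p <- s) (let: (c, a, b) := p in c * (W b w - W a w)).

(* [Y] is (a version of) the Wiener integral of [f] over [0, t] with respect
   to [W]: the L^2(P)-limit of the integrals of step functions that converge
   to [f] in L^2([0, t]).  By the Ito isometry it does not depend, up to a.s.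
   equality, on the approximating sequence. *)
Definition is_wiener_integral W (t : R) (f : R -> R) (Y : T -> R) : Prop :=
  measurable_fun `[0, t] f /\
  exists s : nat -> seq (R * R * R),
    [/\ forall n, step_in t (s n),
        (\int[mu]_(u in `[0%R, t]) ((f u - step_fun (s n) u) ^+ 2)%:E)%E
          @[n --> \oo] --> 0%E &
        ('E_P[(fun w => (Y w - step_integral W (s n) w) ^+ 2)%R])%E
          @[n --> \oo] --> 0%E].

Definition riemann_liouville_process (tau : R) X : Prop :=
  (exists W : R -> {RV P >-> R}, brownian_motion W /\
     forall t : R, 0 <= t ->
       is_wiener_integral W t (fun s => (t - s) `^ (tau - 2^-1)) (X t)) /\
  as_continuous X.

Definition is_local_time X (L : R -> R -> {RV P >-> R}) : Prop :=
  {ae P, forall w, forall t : R, 0 <= t ->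
    (forall x, 0 <= L x t w) /\
    forall A : set R, measurable A ->
      (\int[mu]_(s in `[0%R, t]) (\1_A (X s w))%:E =
       \int[mu]_(x in A) (L x t w)%:E)%E}.

Definition as_jointly_continuous (L : R -> R -> {RV P >-> R}) : Prop :=
  {ae P, forall w, {within [set p : R * R | 0 <= p.2],
                      continuous (fun p : R * R => L p.1 p.2 w)}}.

End processes.

(* Main.v *)
Require Import Defs.
From HB Require Import structures.
From mathcomp Require Import all_boot all_order all_algebra.
From mathcomp Require Import all_classical all_reals all_analysis.
From mathcomp Require Import measurable_realfun.
From mathcomp Require Import ring lra zify.

Set Implicit Arguments.
Unset Strict Implicit.
Unset Printing Implicit Defensive.

Import Order.TTheory GRing.Theory Num.Theory.
Import numFieldNormedType.Exports.

Local Open Scope classical_set_scope.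
Local Open Scope ring_scope.

(** Write [Z t] for the integral of [f (X s)] over [0, t] minus [F * L 0 t],
    where [F] is the integral of [f].  The occupation formula turns [Z t] into
    the integral over [x] of [f x * (L x t - L 0 t)], so everything rests on how
    regular the local time is in space, uniformly over large times.  As the
    claim is linear in [f], its positive and negative parts can be treated
    separately, and [f] is nonnegative in most of what follows.

    The only property of the process that enters is local nondeterminism
    ([locally_nondeterministic]): given [X s], the variable [X u] keeps a
    variance of order [(u - s) `^ (2 * tau)], which is expressed as a Gaussian
    bound on the characteristic function of [(X s, X u)].  For fractional
    Brownian motion it follows from a bound away from 1 on the correlation of
    [X s] and [X u - X s]; for the Riemann-Liouville process it holds because
    the Wiener integral over [s, u] is independent of the past of [s].

    A normal density of small width [r] centred at [x] is a superposition of
    cosines, and its difference with the same density centred at 0 has a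
    spectral weight of size at most [2 * `|x| `^ g * `|xi| `^ g], for every [g]
    in [0, 1].  Inserting the bound on the characteristic function
    ([cos_transform_kernel]) and integrating over pairs of times shows that the
    time integral up to [t] of that difference, evaluated along the process, has
    a second moment of order [`|x| `^ g * t `^ (2 - 2 * tau - tau * g)], as soon
    as [tau * (1 + g) < 1] and uniformly in [r] ([mollified_difference_moment]).
    A similar computation bounds what the density at 0 collects between two
    times ([mollified_increment_moment]).  Time integrals are replaced by
    Riemann sums here: these involve finitely many of the variables [X s], so
    that their moments are expressed by the laws of pairs [(X s, X u)].  When the
    mesh and then [r] tend to 0, the sums converge to increments of the
    local time on almost every path, and Fatou's lemma transfers the bounds to
    the local time ([difference_energy], [increment_energy]).

    Compared with the target scale [t `^ (1 - tau)], the spatial estimate gains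
    a power [t `^ (- tau * g)] in mean square.  Along the times [t_n = n ^ p]
    with [p] large the normalized second moments are therefore summable, even
    after multiplication by [t_n `^ (2 * eps)], and almost surely
    [Z t_n = o(t_n `^ (1 - tau - eps))].  The increments of [L 0] over
    [t_n, t_(n+1)] are negligible on the same scale, and since both the integral
    of [f (X s)] and [L 0 t] are nondecreasing in [t], this controls [Z] between
    the times [t_n] as well ([path_functional_asymptotics]). *)

(** * Integrable real-valued functions *)

Section real_integrable.
Context d (T : measurableType d) (R : realType) (mu : {measure set T -> \bar R}).
Variables (D : set T) (mD : measurable D).
Implicit Types f g : T -> R.
Local Notation integ f := (mu.-integrable D (EFin \o f)).

Lemma integrable_fun_cst0 : integ (fun=> 0).
Proof. exact: (integrable0 mu D). Qed.

Lemma integrable_funD f g : integ f -> integ g -> integ (fun x => f x + g x).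
Proof.
move=> fi gi; have := integrableD mD fi gi.
by apply: eq_integrable => // x _ /=; rewrite EFinD.
Qed.

Lemma integrable_funB f g : integ f -> integ g -> integ (fun x => f x - g x).
Proof.
move=> fi gi; have := integrableB mD fi gi.
by apply: eq_integrable => // x _ /=; rewrite EFinB.
Qed.

Lemma integrable_funZ (k : R) f : integ f -> integ (fun x => k * f x).
Proof.
move=> fi; have := integrableZl mD k fi.
by apply: eq_integrable => // x _ /=; rewrite EFinM.
Qed.

Lemma integrable_fun_le f g : measurable_fun D f -> integ g ->
  (forall x, D x -> `|f x| <= g x) -> integ f.
Proof.
move=> mf gi fg; apply: (le_integrable mD _ _ gi); first exact/measurable_EFinP.
by move=> x Dx /=; rewrite lee_fin (le_trans (fg _ Dx))// ler_norm.
Qed.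

Lemma integrable_funM_bounded f g (M : R) : measurable_fun D f ->
  (forall x, D x -> `|f x| <= M) -> integ g -> integ (fun x => f x * g x).
Proof.
move=> mf fM gi.
have mg : measurable_fun D g by case/integrableP : gi => /measurable_EFinP.
have gai : integ (fun x => M * `|g x|).
  by apply: integrable_funZ; exact: (integrable_abse gi).
apply: (integrable_fun_le _ gai); first exact: measurable_funM.
by move=> x Dx; rewrite normrM ler_wpM2r// fM.
Qed.

Lemma integrable_fun_abs f : integ f -> integ (fun x => `|f x|).
Proof. exact: integrable_abse. Qed.

Lemma integrable_fun_sum (I : Type) (s : seq I) (F : I -> T -> R) :
  (forall i, integ (F i)) -> integ (fun x => \sum_(i <- s) F i x).
Proof.
move=> iF; elim: s => [|i s IH].
  under eq_fun do rewrite big_nil; exact: integrable_fun_cst0.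
under eq_fun do rewrite big_cons; exact: integrable_funD.
Qed.

Lemma Rintegral_fun_sum (I : Type) (s : seq I) (F : I -> T -> R) :
  (forall i, integ (F i)) ->
  \int[mu]_(x in D) (\sum_(i <- s) F i x) = \sum_(i <- s) \int[mu]_(x in D) F i x.
Proof.
move=> iF; elim: s => [|i s IH].
  under eq_Rintegral do rewrite big_nil.
  by rewrite big_nil /Rintegral integral0.
rewrite big_cons -IH -RintegralD//; last exact: integrable_fun_sum.
by apply: eq_Rintegral => x _; rewrite big_cons.
Qed.

Lemma EFin_Rintegral f : integ f ->
  (\int[mu]_(x in D) f x)%:E = (\int[mu]_(x in D) (f x)%:E)%E.
Proof. by move=> fi; rewrite /Rintegral fineK// integrable_fin_num. Qed.

End real_integrable.

(** * Laws with a density and normal moments *)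

Section density_transfer.
Local Open Scope ereal_scope.
Context d (T : measurableType d) d' (T' : measurableType d') (R : realType).
Variables (mu : {measure set T -> \bar R}) (nu : {measure set T' -> \bar R}).
Variables (D : set T) (mD : measurable D).
Variables (Y : T -> T') (mY : measurable_fun D Y).
Variables (rho : T' -> R) (mrho : measurable_fun [set: T'] rho).
Hypothesis rho0 : forall x, (0 <= rho x)%R.
Hypothesis lawY : forall A : set T', measurable A ->
  \int[mu]_(s in D) (\1_A (Y s))%:E = \int[nu]_(x in A) (rho x)%:E.

Import HBNNSimple.

Lemma measurable_preim_in (A : set T') : measurable A ->
  measurable_fun D (fun s => (\1_A (Y s) : R)%R).
Proof.
move=> mA; apply: (measurable_comp (F := setT)) => //=.
Qed.

Let transfer_nnsfun (h : {nnsfun T' >-> R}) :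
  \int[mu]_(s in D) (h (Y s))%:E = \int[nu]_x (h x * rho x)%:E.
Proof.
have mH r : measurable_fun [set: T'] (\1_(h @^-1` [set r]) : T' -> R) by [].
transitivity (\sum_(r \in range h)
    \int[mu]_(s in D) (r * \1_(h @^-1` [set r]) (Y s))%:E).
  under eq_integral do rewrite fimfunE -fsumEFin//.
  rewrite ge0_integral_fsum//.
  - move=> r; apply/measurable_EFinP; apply: measurable_funM => //.
    exact: measurable_preim_in.
  - by move=> r x _; rewrite EFinM nnfun_muleindic_ge0.
transitivity (\sum_(r \in range h)
    \int[nu]_x (r * \1_(h @^-1` [set r]) x * rho x)%:E); last first.
  rewrite -ge0_integral_fsum//.
  - apply: eq_integral => x _; by rewrite fsumEFin// -mulr_fsuml -fimfunE.
  - move=> r; apply/measurable_EFinP; apply: measurable_funM => //.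
    exact: measurable_funM.
  - by move=> r x _; rewrite EFinM mule_ge0 ?lee_fin// -lee_fin EFinM nnfun_muleindic_ge0.
apply: eq_fsbigr => r /[!inE] -[x _ <-{r}].
have hx0 : (0 <= h x)%R by [].
under eq_integral do rewrite EFinM.
rewrite ge0_integralZl//; last first.
  by apply/measurable_EFinP; exact: measurable_preim_in.
under [RHS]eq_integral do rewrite -mulrA EFinM.
rewrite ge0_integralZl//; last 2 first.
- by apply/measurable_EFinP; exact: measurable_funM.
- by move=> z _; rewrite lee_fin mulr_ge0.
rewrite lawY//; congr (_ * _).
rewrite [LHS]integral_mkcond; apply: eq_integral => z _.
rewrite patchE indicE; case: ifPn => zA; rewrite ?mul1r ?mul0r//.
Qed.

(** [lawY] extends from indicators to simple functions by linearity, and then by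
    monotone convergence.  It applies both to the law of a random variable and
    to the occupation measure of a path, where [Y] is only measurable on [D]. *)
Lemma ge0_integral_density (g : T' -> R) : measurable_fun [set: T'] g ->
  (forall x, (0 <= g x)%R) ->
  \int[mu]_(s in D) (g (Y s))%:E = \int[nu]_x (g x * rho x)%:E.
Proof.
move=> mg g0.
have mg' : measurable_fun [set: T'] (EFin \o g) by exact/measurable_EFinP.
pose g_ := nnsfun_approx measurableT mg'.
transitivity (limn (fun n => \int[mu]_(s in D) (g_ n (Y s))%:E)).
  rewrite -monotone_convergence//.
  - apply: eq_integral => y /[!inE] yD; apply/esym/cvg_lim => //.
    by apply: (cvg_nnsfun_approx measurableT mg') => // x _ /=; rewrite lee_fin.
  - move=> n; apply/measurable_EFinP.
    exact: (measurable_comp (F := setT)).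
  - by move=> n y _; rewrite lee_fin.
  - by move=> y _ m n mn; rewrite lee_fin; exact/lefP/nd_nnsfun_approx.
transitivity (limn (fun n => \int[nu]_x (g_ n x * rho x)%:E)); last first.
  rewrite -monotone_convergence//.
  - apply: eq_integral => y _; apply/cvg_lim => //.
    under eq_fun do rewrite EFinM.
    rewrite EFinM; apply: cvgeZr => //.
    by apply: (cvg_nnsfun_approx measurableT mg') => // x _ /=; rewrite lee_fin.
  - by move=> n; apply/measurable_EFinP/measurable_funM.
  - by move=> n y _; rewrite lee_fin mulr_ge0.
  - move=> y _ m n mn; rewrite lee_fin ler_wpM2r//.
    exact/lefP/nd_nnsfun_approx.
by congr (limn _); apply/funext => n; exact: transfer_nnsfun.
Qed.

Lemma Rintegral_density (g : T' -> R) : measurable_fun [set: T'] g ->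
  nu.-integrable [set: T'] (EFin \o (fun x => g x * rho x)%R) ->
  mu.-integrable D (EFin \o (g \o Y)) /\
  (\int[mu]_(s in D) g (Y s) = \int[nu]_x (g x * rho x))%R.
Proof.
move=> mg ig.
have mgY (h : T' -> R) : measurable_fun [set: T'] h -> measurable_fun D (h \o Y).
  by move=> mh; exact: (measurable_comp (F := setT)).
have main (h : T' -> R) : measurable_fun [set: T'] h -> (forall x, 0 <= h x)%R ->
    nu.-integrable [set: T'] (EFin \o (fun x => h x * rho x)%R) ->
    mu.-integrable D (EFin \o (h \o Y)) /\
    (\int[mu]_(s in D) h (Y s) = \int[nu]_x (h x * rho x))%R.
  move=> mh h0 ih; split; last by rewrite /Rintegral ge0_integral_density.
  apply/integrableP; split; first by apply/measurable_EFinP; exact: mgY.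
  under eq_integral do rewrite /= ger0_norm//.
  rewrite ge0_integral_density//.
  have /integrableP[_] := ih; apply: le_lt_trans.
  rewrite le_eqVlt; apply/orP; left; apply/eqP; apply: eq_integral => x _ /=.
  by rewrite ger0_norm// mulr_ge0.
pose g1 x := `|g x|%R; pose g2 x := (`|g x| - g x)%R.
have mg1 : measurable_fun [set: T'] g1 by exact: measurableT_comp.
have mg2 : measurable_fun [set: T'] g2 by exact: measurable_funB.
have i1 : nu.-integrable [set: T'] (EFin \o (fun x => g1 x * rho x)%R).
  have := integrable_fun_abs ig; apply: eq_integrable => // x _ /=.
  by rewrite normrM (ger0_norm (rho0 x)).
have i2 : nu.-integrable [set: T'] (EFin \o (fun x => g2 x * rho x)%R).
  have := integrable_funB measurableT i1 ig; apply: eq_integrable => // x _ /=.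
  by rewrite mulrBl.
have [j1 e1] := main _ mg1 (fun x => normr_ge0 _) i1.
have g20 x : (0 <= g2 x)%R by rewrite subr_ge0 ler_norm.
have [j2 e2] := main _ mg2 g20 i2.
have gE x : (g x = g1 x - g2 x)%R by rewrite /g1 /g2; ring.
split.
  have := integrable_funB mD j1 j2; apply: eq_integrable => // x _ /=.
  by rewrite -gE.
transitivity (\int[mu]_(s in D) (g1 (Y s) - g2 (Y s)))%R.
  by apply: eq_Rintegral => x _; rewrite -gE.
rewrite RintegralB// e1 e2 -RintegralB//.
by apply: eq_Rintegral => x _; rewrite -mulrBl -gE.
Qed.

End density_transfer.

Section integral_of_derivative.
Context (R : realType).
Local Notation mu := (@lebesgue_measure R).

(** Integration by parts on the line: the boundary terms at [n] and [- n] vanish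
    in the limit, and integrability of [g] identifies the limit of the integrals
    over [[- n, n]]. *)
Lemma Rintegral_derive_eq0 (G g : R -> R) :
  (forall x : R, is_derive x (1 : R) G (g x)) -> continuous g ->
  mu.-integrable [set: R] (EFin \o g) ->
  G n%:R @[n --> \oo] --> 0 -> G (- n%:R) @[n --> \oo] --> 0 ->
  \int[mu]_x g x = 0.
Proof.
move=> dG cg ig Gp Gn.
have mg : measurable_fun [set: R] g by exact: continuous_measurable_fun.
pose I (n : nat) : set R := `[- n%:R, n%:R]%classic.
have mI n : measurable (I n) by exact: measurable_itv.
have E (n : nat) : (\int[mu]_x (g x * \1_(I n.+1) x)%:E =
    (G n.+1%:R - G (- n.+1%:R))%:E)%E.
  rewrite EFinB -(@continuous_FTC2 _ g).
  - rewrite [RHS]integral_mkcond; apply: eq_integral => x _.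
    by rewrite patchE indicE; case: ifPn; rewrite ?mulr1 ?mulr0.
  - by rewrite ltrNl (@le_lt_trans _ _ 0)// oppr_le0.
  - by apply: continuous_subspaceT => x; exact: cg.
  - have cG x : {for x, continuous G}.
      by apply/differentiable_continuous/derivable1_diffP; case: (dG x).
    split.
    + by move=> x _; case: (dG x).
    + by apply: cvg_at_right_filter; exact: cG.
    + by apply: cvg_at_left_filter; exact: cG.
  - by move=> x _; rewrite derive1E; case: (dG x).
have L1 : (\int[mu]_x (g x * \1_(I n.+1) x)%:E)%E @[n --> \oo] -->
    (\int[mu]_x (g x)%:E)%E.
  apply: (@dominated_cvg _ _ _ mu setT measurableT
     (fun n x => (g x * \1_(I n.+1) x)%:E) (EFin \o g) (fun x => `|g x|%:E)).
  - by move=> n; apply/measurable_EFinP; apply: measurable_funM => //; apply: measurable_indic; exact: mI.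
  - move=> x _; apply: cvg_EFin; first by near=> n.
    apply: cvg_near_cst; near=> n; rewrite /= indicE mem_set ?mulr1//=.
    rewrite /I/= in_itv/= -ler_norml (@le_trans _ _ n%:R)//; last first.
      by rewrite ler_nat.
    by near: n; exact: nbhs_infty_ger.
  - by [].
  - exact: (integrable_abse ig).
  - move=> n x _; rewrite /= lee_fin normrM ler_piMr// indicE.
    by case: (_ \in _); rewrite ?normr1 ?normr0.
have L2 : (\int[mu]_x (g x * \1_(I n.+1) x)%:E)%E @[n --> \oo] --> (0 : \bar R)%E.
  under eq_fun do rewrite E.
  apply: cvg_EFin; first by near=> n.
  rewrite -[X in _ --> X](@subr0 R 0); apply: (@cvgB R R^o).
    by move: Gp; rewrite -cvg_shiftS.
  by move: Gn; rewrite -cvg_shiftS.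
by rewrite /Rintegral (cvg_unique _ L1 L2).
Unshelve. all: end_near. Qed.

End integral_of_derivative.

Section normal_moments.
Context (R : realType) (m sigma : R).
Hypothesis sigma0 : sigma != 0.
Local Notation mu := (@lebesgue_measure R).
Local Notation e := (normal_pdf m sigma).

Lemma is_derive_normal_pdf (x : R) :
  is_derive x (1 : R) e (- ((x - m) / sigma ^+ 2 * e x)).
Proof.
rewrite normal_pdfE//.
have D : is_derive x (1 : R) (fun x : R => - (x - m) ^+ 2 / (sigma ^+ 2 *+ 2))
    (- ((x - m) / sigma ^+ 2)).
  apply: is_derive_eq.
  rewrite /GRing.scale/= mulr0 add0r subr0 mulr1 -mulr_natr.
  by field.
have De : is_derive x (1 : R) (normal_fun m sigma)
    (normal_fun m sigma x * (- ((x - m) / sigma ^+ 2))).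
  exact: (@is_derive1_comp _ expR).
apply: (is_derive_eq (is_deriveZ (normal_peak sigma) De)).
by rewrite /GRing.scale/=; ring.
Qed.

Lemma normal_pdf_gt0 (x : R) : 0 < e x.
Proof. by rewrite normal_pdfE// mulr_gt0 ?normal_peak_gt0 ?expR_gt0. Qed.

(** Doubling the standard deviation absorbs a quadratic factor.  The integrability
    of all the moments below is thus reduced to that of a normal density. *)
Lemma normal_pdf_moment_bound : exists2 C : R, 0 < C &
  forall x, (1 + (x - m) ^+ 2) * e x <= C * normal_pdf m (2 * sigma) x.
Proof.
have s20 : 2 * sigma != 0 by rewrite mulf_neq0.
have p20 := normal_peak_gt0 s20; have p0 := normal_peak_gt0 sigma0.
have s2 : 0 < sigma ^+ 2 by rewrite exprn_even_gt0.
exists ((1 + 4 * sigma ^+ 2) * normal_peak sigma / normal_peak (2 * sigma)).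
  by rewrite divr_gt0// mulr_gt0// addr_gt0// mulr_gt0.
move=> x; rewrite !normal_pdfE// [leRHS]mulrA divfK ?gt_eqF//.
rewrite mulrCA [leRHS]mulrAC [leRHS]mulrC ler_pM2l//.
pose z := (x - m) ^+ 2 / (4 * sigma ^+ 2).
have z0 : 0 <= z by rewrite divr_ge0 ?sqr_ge0// mulr_ge0// ltW.
have -> : normal_fun m sigma x = expR (- z) * expR (- z).
  rewrite -expRD /normal_fun; congr expR; rewrite /z -mulr_natr.
  by field.
have -> : normal_fun m (2 * sigma) x = expR (- z / 2).
  rewrite /normal_fun; congr expR; rewrite /z -mulr_natr.
  by field.
have -> : (x - m) ^+ 2 = 4 * sigma ^+ 2 * z.
  by rewrite /z; field.
have A : 1 + 4 * sigma ^+ 2 * z <= (1 + 4 * sigma ^+ 2) * expR z.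
  apply: (@le_trans _ _ ((1 + 4 * sigma ^+ 2) * (1 + z))).
    by nra.
  by rewrite ler_wpM2l ?expR_ge1Dx// addr_ge0// mulr_ge0// ltW.
rewrite mulrA; apply: (@le_trans _ _ ((1 + 4 * sigma ^+ 2) * expR (- z))).
  rewrite ler_wpM2r ?expR_ge0//.
  by rewrite expRN ler_pdivrMr ?expR_gt0.
rewrite ler_wpM2l//; first by rewrite addr_ge0// mulr_ge0// ltW.
by rewrite ler_expR; lra.
Qed.

Lemma integrable_normal_moment (h : R -> R) (K : R) :
  measurable_fun [set: R] h -> (forall x, `|h x| <= K * (1 + (x - m) ^+ 2)) ->
  mu.-integrable [set: R] (EFin \o (fun x => h x * e x)).
Proof.
move=> mh hK; have [C C0 CE] := normal_pdf_moment_bound.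
have ii := integrable_normal_pdf m (2 * sigma).
have K0 : 0 <= K.
  have := le_trans (normr_ge0 _) (hK m).
  by rewrite subrr expr0n/= addr0 mulr1.
apply: (@le_integrable _ _ _ mu _ measurableT _
  (fun x => ((K * C)%:E * (normal_pdf m (2 * sigma) x)%:E)%E)).
- apply/measurable_EFinP/measurable_funM => //; exact: measurable_normal_pdf.
- move=> x _; rewrite -EFinM /= lee_fin normrM.
  rewrite (ger0_norm (normal_pdf_ge0 _ _ _)).
  rewrite [leRHS]ger0_norm; last by rewrite mulr_ge0 ?normal_pdf_ge0// mulr_ge0// ltW.
  rewrite -mulrA (le_trans _ (ler_wpM2l K0 (CE x)))// mulrA.
  by rewrite ler_wpM2r ?normal_pdf_ge0.
- exact: integrableZl.
Qed.

(** The bound [`|x| * `|G x| <= B] is enough; it comes from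
    [normal_pdf_moment_bound] and from the boundedness of normal densities. *)
Lemma normal_pdf_decay (G : R -> R) (K : R) :
  (forall x, `|G x| <= K * (1 + `|x - m|) * e x) ->
  G n%:R @[n --> \oo] --> 0 /\ G (- n%:R) @[n --> \oo] --> 0.
Proof.
move=> GK; have [C C0 CE] := normal_pdf_moment_bound.
have K0 : 0 <= K.
  have := le_trans (normr_ge0 _) (GK m).
  by rewrite subrr normr0 addr0 mulr1 pmulr_lge0 // normal_pdf_gt0.
have s20 : 2 * sigma != 0 by rewrite mulf_neq0.
pose B := K * 2 * (1 + `|m|) * C * normal_peak (2 * sigma).
have xG x : `|x| * `|G x| <= B.
  have p : 0 <= e x := normal_pdf_ge0 _ _ _.
  apply: (@le_trans _ _ (K * 2 * (1 + `|m|) * ((1 + (x - m) ^+ 2) * e x))).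
    apply: (@le_trans _ _ (`|x| * (K * (1 + `|x - m|) * e x))).
      by rewrite ler_wpM2l.
    rewrite !mulrA ler_wpM2r// (mulrC _ K) -!mulrA ler_wpM2l//.
    have xm : `|x| <= `|m| + `|x - m| by rewrite -{1}(subrK m x) addrC ler_normD.
    rewrite -(real_normK (num_real (x - m))).
    have := normr_ge0 m; have := normr_ge0 (x - m); have := normr_ge0 x.
    move: `|x| `|m| `|x - m| xm => a b c abc a0 c0 b0.
    apply: (@le_trans _ _ ((1 + b) * (1 + c) ^+ 2)); first by nra.
    rewrite [leRHS]mulrCA ler_wpM2l ?addr_ge0//.
    by have := sqr_ge0 (1 - c); nra.
  have K1 : 0 <= K * 2 * (1 + `|m|) by rewrite !mulr_ge0// addr_ge0.
  apply: (le_trans (ler_wpM2l K1 (CE x))).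
  rewrite /B -!mulrA; do 3 (rewrite ler_wpM2l//).
  by rewrite ler_wpM2l ?normal_pdf_ub// ltW.
have main (s : R) : `|s| = 1 -> G (s * n%:R) @[n --> \oo] --> 0.
  move=> s1; rewrite -cvg_shiftS.
  apply: (@squeeze_cvgr _ _ _ _ (fun n => - (B * harmonic n)) (fun n => B * harmonic n)).
  - near=> n; rewrite -ler_norml /harmonic/= ler_pdivlMr//.
    by rewrite mulrC -[X in X * _](@ger0_norm R)// -[X in X * _]mul1r -s1 -normrM.
  - rewrite -oppr0; apply: (@cvgN _ R^o); rewrite -(mulr0 B).
    by apply: cvgMr => //; exact: cvg_harmonic.
  - by rewrite -(mulr0 B); apply: cvgMr => //; exact: cvg_harmonic.
split.
  by under eq_fun do rewrite -(mul1r _%:R); apply: main; rewrite normr1.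
by under eq_fun do rewrite -(mulN1r _%:R); apply: main; rewrite normrN1.
Unshelve. all: end_near. Qed.

Lemma Rintegral_normal_pdf : \int[mu]_x e x = 1.
Proof. by rewrite /Rintegral integral_normal_pdf. Qed.

Lemma Rintegral_normal_deviation : \int[mu]_x ((x - m) * e x) = 0.
Proof.
have bnd x : `|x - m| <= 1 * (1 + (x - m) ^+ 2).
  rewrite mul1r -(real_normK (num_real (x - m))).
  by have := sqr_ge0 (`|x - m| - 1); have := normr_ge0 (x - m); nra.
have mh : measurable_fun [set: R] (fun x : R => x - m).
  by apply: measurable_funB => //; exact: measurable_id.
have [x|Gp Gn] := @normal_pdf_decay (fun x => - sigma ^+ 2 * e x) (sigma ^+ 2).
  rewrite normrM normrN (ger0_norm (sqr_ge0 _)) (ger0_norm (normal_pdf_ge0 _ _ _)).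
  rewrite ler_wpM2r ?normal_pdf_ge0// ler_peMr ?sqr_ge0//.
  by rewrite lerDl.
apply: (@Rintegral_derive_eq0 _ (fun x => - sigma ^+ 2 * e x)
  (fun x => (x - m) * e x)); last 2 first.
- exact: Gp.
- exact: Gn.
- move=> x; have D := is_derive_normal_pdf x.
  apply: (is_derive_eq (is_deriveZ (- sigma ^+ 2) D)).
  by rewrite /GRing.scale/=; field.
- move=> x; apply: cvgM; last exact: continuous_normal_pdf.
  by apply: (@cvgB _ R^o) => //; exact: cvg_cst.
- exact: integrable_normal_moment mh bnd.
Qed.

Lemma Rintegral_normal_square_deviation :
  \int[mu]_x ((x - m) ^+ 2 * e x) = sigma ^+ 2.
Proof.
have s2 : 0 < sigma ^+ 2 by rewrite exprn_even_gt0.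
have [x|Gp Gn] := @normal_pdf_decay (fun x => (x - m) * e x) 1.
  rewrite normrM (ger0_norm (normal_pdf_ge0 _ _ _)) mul1r.
  by rewrite ler_wpM2r ?normal_pdf_ge0// lerDr.
have bnd x : `|(x - m) ^+ 2| <= 1 * (1 + (x - m) ^+ 2).
  by rewrite mul1r ger0_norm ?sqr_ge0// lerDr.
have mh : measurable_fun [set: R] (fun x : R => (x - m) ^+ 2).
  by apply: measurable_funX; apply: measurable_funB => //; exact: measurable_id.
have ih := integrable_normal_moment mh bnd.
have ie := integrable_normal_pdf m sigma.
have cid : continuous (fun x : R => x - m).
  by move=> x; apply: (@cvgB _ R^o) => //; exact: cvg_cst.
have H : \int[mu]_x (e x - (sigma ^+ 2)^-1 * ((x - m) ^+ 2 * e x)) = 0.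
  apply: (@Rintegral_derive_eq0 _ (fun x => (x - m) * e x)
    (fun x => e x - (sigma ^+ 2)^-1 * ((x - m) ^+ 2 * e x))); last 2 first.
  - exact: Gp.
  - exact: Gn.
  - move=> x; have D := is_derive_normal_pdf x.
    have D1 : is_derive x (1 : R) (fun x : R => x - m) 1.
      by apply: is_derive_eq; rewrite subr0.
    apply: (is_derive_eq (is_deriveM D1 D)).
    by rewrite /GRing.scale/=; field.
  - move=> x; apply: (@cvgB _ R^o); first exact: continuous_normal_pdf.
    apply: cvgM; first exact: cvg_cst.
    apply: cvgM; last exact: continuous_normal_pdf.
    by apply: (cvg_comp (fun x => x - m) (fun x => x ^+ 2) (cid x)); exact: sqr_continuous.
  - by apply: integrable_funB => //; exact: integrable_funZ.
rewrite RintegralB// in H; last exact: integrable_funZ.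
rewrite Rintegral_normal_pdf RintegralZl// in H.
by move/eqP: H; rewrite subr_eq0 => /eqP/esym; rewrite mulrC => /divr1_eq ->.
Qed.

(** The left-hand side solves F' = - sigma^2 xi F, by differentiation under the
    integral sign and integration by parts. *)
Lemma Rintegral_normal_cos_centered (xi th : R) :
  \int[mu]_x (cos (xi * (x - m) + th) * e x) =
    cos th * expR (- (sigma ^+ 2 * xi ^+ 2 / 2)).
Proof.
pose F xi := \int[mu]_x (cos (xi * (x - m) + th) * e x).
have s2 : 0 < sigma ^+ 2 by rewrite exprn_even_gt0.
have maff (a : R) : measurable_fun [set: R] (fun x : R => a * (x - m) + th).
  apply: measurable_funD => //; apply: measurable_funM => //.
  by apply: measurable_funB => //; exact: measurable_id.
have caff (a : R) : continuous (fun x : R => a * (x - m) + th).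
  move=> x; apply: (@cvgD _ R^o); last exact: cvg_cst.
  apply: cvgM; first exact: cvg_cst.
  by apply: (@cvgB _ R^o) => //; exact: cvg_cst.
have mcos (a : R) : measurable_fun [set: R] (fun x : R => cos (a * (x - m) + th)).
  by apply: continuous_measurable_fun => x; apply: continuous_comp;
    [exact: caff|exact: continuous_cos].
have msin (a : R) : measurable_fun [set: R] (fun x : R => sin (a * (x - m) + th)).
  by apply: continuous_measurable_fun => x; apply: continuous_comp;
    [exact: caff|exact: continuous_sin].
have icos (a : R) : mu.-integrable setT (EFin \o (fun x => cos (a * (x - m) + th) * e x)).
  apply: (@integrable_normal_moment _ 1) => // x; rewrite mul1r.
  by rewrite (le_trans (cos_max _))// lerDl sqr_ge0.
have bnd x : `|x - m| <= 1 * (1 + (x - m) ^+ 2).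
  rewrite mul1r -(real_normK (num_real (x - m))).
  by have := sqr_ge0 (`|x - m| - 1); have := normr_ge0 (x - m); nra.
have isin (a : R) : mu.-integrable setT
    (EFin \o (fun x => (x - m) * sin (a * (x - m) + th) * e x)).
  apply: (@integrable_normal_moment _ 1) => [|x].
    apply: measurable_funM => //.
    by apply: measurable_funB => //; exact: measurable_id.
  by rewrite normrM -[leRHS]mulr1 ler_pM// sin_max.
have parts (a : R) : a * F a =
    (sigma ^+ 2)^-1 * \int[mu]_x ((x - m) * sin (a * (x - m) + th) * e x).
  have [x|Gp Gn] := @normal_pdf_decay (fun x => sin (a * (x - m) + th) * e x) 1.
    rewrite normrM (ger0_norm (normal_pdf_ge0 _ _ _)) mul1r.
    rewrite ler_wpM2r ?normal_pdf_ge0// (le_trans (sin_max _))// lerDl.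
    exact: normr_ge0.
  have H : \int[mu]_x (a * (cos (a * (x - m) + th) * e x) -
      (sigma ^+ 2)^-1 * ((x - m) * sin (a * (x - m) + th) * e x)) = 0.
    apply: (@Rintegral_derive_eq0 _ (fun x => sin (a * (x - m) + th) * e x)
      (fun x => a * (cos (a * (x - m) + th) * e x) -
        (sigma ^+ 2)^-1 * ((x - m) * sin (a * (x - m) + th) * e x))); last 2 first.
    - exact: Gp.
    - exact: Gn.
    - move=> x; have D := is_derive_normal_pdf x.
      have D1 : is_derive x (1 : R) (fun x : R => a * (x - m) + th) a.
        by apply: is_derive_eq; rewrite /GRing.scale/=; ring.
      have D2 : is_derive x (1 : R) (fun x : R => sin (a * (x - m) + th))
          (cos (a * (x - m) + th) * a) by exact: (@is_derive1_comp _ sin).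
      apply: (is_derive_eq (is_deriveM D2 D)).
      by rewrite /GRing.scale/=; field.
    - move=> x.
      have c1 : {for x, continuous (fun x : R => cos (a * (x - m) + th))}.
        by apply: continuous_comp; [exact: caff|exact: continuous_cos].
      have c2 : {for x, continuous (fun x : R => sin (a * (x - m) + th))}.
        by apply: continuous_comp; [exact: caff|exact: continuous_sin].
      apply: (@cvgB _ R^o); apply: cvgM; try exact: cvg_cst.
        by apply: cvgM => //; exact: continuous_normal_pdf.
      apply: cvgM; last exact: continuous_normal_pdf.
      by apply: cvgM => //; apply: (@cvgB _ R^o) => //; exact: cvg_cst.
    - by apply: integrable_funB => //; exact: integrable_funZ.
  rewrite RintegralB// in H; [|exact: integrable_funZ..].
  rewrite !RintegralZl// in H.
  by move/eqP: H; rewrite subr_eq0 => /eqP.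
have dF (a : R) : is_derive a (1 : R) F (- (sigma ^+ 2 * a * F a)).
  pose f (a x : R) := cos (a * (x - m) + th) * e x.
  have df (b x : R) : is_derive b (1 : R) (f ^~ x)
      (- ((x - m) * sin (b * (x - m) + th) * e x)).
    have D1 : is_derive b (1 : R) (fun b : R => b * (x - m) + th) (x - m).
      by apply: is_derive_eq; rewrite /GRing.scale/=; ring.
    have D2 : is_derive b (1 : R) (fun b : R => cos (b * (x - m) + th))
        (- sin (b * (x - m) + th) * (x - m)) by exact: (@is_derive1_comp _ cos).
    apply: (is_derive_eq (is_deriveM D2 (is_derive_cst (e x) b 1))).
    by rewrite /GRing.scale/=; ring.
  have d1f b x : partial1of2 f b x = - ((x - m) * sin (b * (x - m) + th) * e x).
    by rewrite partial1of2E; case: (df b x).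
  pose G (x : R) := `|x - m| * e x.
  have iG : mu.-integrable setT (EFin \o G).
    apply: (@integrable_normal_moment _ 1) => [|x].
      apply: measurableT_comp => //.
      by apply: measurable_funB => //; exact: measurable_id.
    by rewrite normr_id.
  have aI : `]a - 1, a + 1[%classic a by rewrite /= in_itv/= gtrDl ltrDl ltrN10 ltr01.
  have intf x : `]a - 1, a + 1[%classic x -> mu.-integrable setT (EFin \o f x).
    by move=> _; exact: icos.
  have derf x y : `]a - 1, a + 1[%classic x -> setT y -> derivable (f ^~ y) x 1.
    by move=> _ _; case: (df x y).
  have G0 y : 0 <= G y by rewrite mulr_ge0// normal_pdf_ge0.
  have Gub x y : `]a - 1, a + 1[%classic x -> setT y -> `|partial1of2 f x y| <= G y.
    move=> _ _; rewrite d1f normrN !normrM (ger0_norm (normal_pdf_ge0 _ _ _)).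
    by rewrite /G ler_wpM2r ?normal_pdf_ge0// ler_piMr// sin_max.
  have D := derivable_under_integral measurableT aI intf derf G0 iG Gub.
  have DE := differentiation_under_integral measurableT aI intf derf G0 iG Gub.
  apply: DeriveDef; first exact: D.
  rewrite -derive1E [LHS]DE.
  under eq_Rintegral do rewrite d1f -mulN1r.
  rewrite RintegralZl// mulN1r; congr (- _).
  by rewrite -mulrA parts mulrA divff ?gt_eqF// mul1r.
have dH (a : R) : is_derive a (1 : R)
    (fun a => F a * expR (sigma ^+ 2 * a ^+ 2 / 2)) 0.
  have D1 : is_derive a (1 : R) (fun a : R => sigma ^+ 2 * a ^+ 2 / 2)
      (sigma ^+ 2 * a).
    by apply: is_derive_eq; rewrite /GRing.scale/=; field.
  have D2 : is_derive a (1 : R) (fun a : R => expR (sigma ^+ 2 * a ^+ 2 / 2))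
     (expR (sigma ^+ 2 * a ^+ 2 / 2) * (sigma ^+ 2 * a)).
    exact: (@is_derive1_comp _ expR).
  apply: (is_derive_eq (is_deriveM (dF a) D2)).
  by rewrite /GRing.scale/=; ring.
have := is_derive_0_is_cst xi 0 dH.
rewrite /= expr0n/= mulr0 mul0r expR0 mulr1.
have -> : F 0 = cos th.
  rewrite /F; under eq_Rintegral do rewrite mul0r add0r.
  rewrite RintegralZl//; last exact: integrable_normal_pdf.
  by rewrite Rintegral_normal_pdf mulr1.
by move=> <-; rewrite -[RHS]mulrA -expRD subrr expR0 mulr1.
Qed.

Lemma Rintegral_normal_cos (xi th : R) :
  \int[mu]_x (cos (xi * x + th) * e x) =
    cos (xi * m + th) * expR (- (sigma ^+ 2 * xi ^+ 2 / 2)).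
Proof.
rewrite -Rintegral_normal_cos_centered; apply: eq_Rintegral => x _.
by congr (cos _ * _); ring.
Qed.

End normal_moments.

Section gaussian_rv.
Context d (T : measurableType d) (R : realType) (P : probability T R).
Local Notation mu := (@lebesgue_measure R).

(** The phase [th] is free, so this is the characteristic function of [Y] without
    complex numbers: [th = 0] and [th = - pi / 2] give its real and imaginary
    parts at frequency 1. *)
Lemma gaussian_rv_cos (Y : T -> R) : measurable_fun [set: T] Y ->
  gaussian_rv P Y -> \int[P]_w Y w = 0 ->
  P.-integrable setT (EFin \o (fun w => Y w ^+ 2)) /\
  forall th, \int[P]_w cos (Y w + th) =
    cos th * expR (- (\int[P]_w Y w ^+ 2 / 2)).
Proof.
move=> mY [m [s HY]] EY0.
have msqr : measurable_fun [set: R] (fun x : R => x ^+ 2).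
  by apply: measurable_funX; exact: measurable_id.
have mcos th : measurable_fun [set: R] (fun x : R => cos (x + th)).
  apply: measurableT_comp; last exact: measurable_funD.
  by apply: continuous_measurable_fun; exact: continuous_cos.
have indE A : measurable A ->
    (\int[P]_w (\1_A (Y w))%:E = pushforward P Y A)%E.
  move=> mA; rewrite -[LHS]/(\int[P]_w (\1_(Y @^-1` A) w)%:E)%E.
  rewrite integral_indic ?setIT//.
  by rewrite -[X in measurable X]setTI; exact: mY.
case: (eqVneq s 0) HY => [_ HY|s0 HY].
  have law A : measurable A ->
      (\int[P]_w (\1_A (Y w))%:E = \int[dirac (m : measurableTypeR R)]_(x in A) (1 : R)%:E)%E.
    by move=> mA; rewrite indE// HY// integral_cst// mul1e.
  have D (g : R -> R) : measurable_fun setT g ->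
      P.-integrable setT (EFin \o (g \o Y)) /\ \int[P]_w g (Y w) = g m.
    move=> mg.
    have ig : (dirac (m : measurableTypeR R)).-integrable setT (EFin \o (fun x : R => g x * 1)).
      apply/integrableP; split.
        by apply/measurable_EFinP; exact: measurable_funM.
      rewrite integral_dirac//; first by rewrite diracT mul1e ltry.
      by apply: measurableT_comp => //; apply/measurable_EFinP; exact: measurable_funM.
    have [i e] := @Rintegral_density _ _ _ _ _ P (dirac (m : measurableTypeR R)) setT measurableT Y mY
      (fun=> 1) (measurable_cst _) (fun=> ler01) law g mg ig.
    split => //; rewrite e /Rintegral integral_dirac//.
      by rewrite diracT mul1e/= mulr1.
    by apply/measurable_EFinP; exact: measurable_funM.
  have [_ E1] := D id (@measurable_id _ _ _).
  have [i2 E2] := D _ msqr.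
  split => // th; have [_ ->] := D _ (mcos th).
  rewrite E2; move: E1; rewrite EY0 /= => <-.
  by rewrite add0r expr0n/= mul0r oppr0 expR0 mulr1.
have law A : measurable A ->
    (\int[P]_w (\1_A (Y w))%:E = \int[mu]_(x in A) (normal_pdf m s x)%:E)%E.
  by move=> mA; rewrite indE// HY.
have D (g : R -> R) : measurable_fun setT g ->
    mu.-integrable setT (EFin \o (fun x : R => g x * normal_pdf m s x)) ->
    P.-integrable setT (EFin \o (g \o Y)) /\
    \int[P]_w g (Y w) = \int[mu]_x (g x * normal_pdf m s x).
  move=> mg ig.
  have [i e] := @Rintegral_density _ _ _ _ _ P mu setT measurableT Y mY
      _ (measurable_normal_pdf m s) (normal_pdf_ge0 m s) law g mg ig.
  split; first exact: i.
  exact: e.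
have idev : mu.-integrable setT (EFin \o (fun x : R => (x - m) * normal_pdf m s x)).
  apply: (@integrable_normal_moment _ _ _ s0 _ 1) => [|x].
    by apply: measurable_funB => //; exact: measurable_id.
  rewrite mul1r -(real_normK (num_real (x - m))).
  by have := sqr_ge0 (`|x - m| - 1); have := normr_ge0 (x - m); nra.
have ipdf := integrable_normal_pdf m s.
have m0 : m = 0.
  have iid : mu.-integrable setT (EFin \o (fun x : R => x * normal_pdf m s x)).
    have := integrable_funD measurableT idev (integrable_funZ measurableT m ipdf).
    by apply: eq_integrable => // x _ /=; congr EFin; ring.
  have [_] := D id (@measurable_id _ _ _) iid; rewrite [LHS]EY0 => E1.
  have := Rintegral_normal_deviation m s0.
  under eq_Rintegral do rewrite mulrBl.
  rewrite RintegralB//; last exact: integrable_funZ.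
  rewrite -E1 RintegralZl// Rintegral_normal_pdf// sub0r mulr1.
  by move/eqP; rewrite oppr_eq0 => /eqP.
have isqr : mu.-integrable setT (EFin \o (fun x : R => x ^+ 2 * normal_pdf m s x)).
  apply: (@integrable_normal_moment _ _ _ s0 _ 1) => // x.
  by rewrite m0 subr0 mul1r ger0_norm ?sqr_ge0// lerDr.
have [i2 E2] := D _ msqr isqr.
split => // th.
have icos : mu.-integrable setT
    (EFin \o (fun x : R => cos (x + th) * normal_pdf m s x)).
  apply: (@integrable_normal_moment _ _ _ s0 _ 1) => // x.
  by rewrite mul1r (le_trans (cos_max _))// lerDl sqr_ge0.
have [_ ->] := D _ (mcos th) icos.
under eq_Rintegral do rewrite -[X in cos (X + _)]mul1r.
rewrite Rintegral_normal_cos// m0 mulr0 add0r expr1n mulr1 E2.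
have := Rintegral_normal_square_deviation m s0.
by rewrite m0; under eq_Rintegral do rewrite subr0; move=> ->.
Qed.

End gaussian_rv.

(** * Local nondeterminism of Gaussian processes *)

Section second_moments.
Context d (T : measurableType d) (R : realType) (P : probability T R).
Implicit Types Y Z : T -> R.
Local Notation sqint Y := (P.-integrable setT (EFin \o (fun w => Y w ^+ 2))).

Lemma integrable_cst_prob (c : R) : P.-integrable setT (EFin \o (fun _ : T => c)).
Proof. exact: finite_measure_integrable_cst. Qed.

Lemma sqint_mul Y Z : measurable_fun setT Y -> measurable_fun setT Z ->
  sqint Y -> sqint Z -> P.-integrable setT (EFin \o (fun w => Y w * Z w)).
Proof.
move=> mY mZ iY iZ.
apply: (@integrable_fun_le _ _ _ _ _ measurableT _ (fun w => Y w ^+ 2 + Z w ^+ 2)).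
- exact: measurable_funM.
- exact: integrable_funD.
- move=> w _; rewrite normrM -(real_normK (num_real (Y w))) -(real_normK (num_real (Z w))).
  have := normr_ge0 (Y w); have := normr_ge0 (Z w).
  by have := sqr_ge0 (`|Y w| - `|Z w|); nra.
Qed.

Lemma sqint_integrable Y : measurable_fun setT Y -> sqint Y ->
  P.-integrable setT (EFin \o Y).
Proof.
move=> mY iY.
have i1 : sqint (fun _ : T => 1 : R) by exact: integrable_cst_prob.
have := sqint_mul mY (measurable_cst _) iY i1.
by apply: eq_integrable => // w _ /=; rewrite mulr1.
Qed.

Lemma sqint_comb (a b : R) Y Z : measurable_fun setT Y -> measurable_fun setT Z ->
  sqint Y -> sqint Z -> sqint (fun w => a * Y w + b * Z w).
Proof.
move=> mY mZ iY iZ; have iYZ := sqint_mul mY mZ iY iZ.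
have := integrable_funD measurableT (integrable_funZ measurableT (a ^+ 2) iY)
  (integrable_funD measurableT (integrable_funZ measurableT (2 * a * b) iYZ)
    (integrable_funZ measurableT (b ^+ 2) iZ)).
by apply: eq_integrable => // w _ /=; congr EFin; ring.
Qed.

Lemma Rintegral_sqr_comb (a b : R) Y Z :
  measurable_fun setT Y -> measurable_fun setT Z -> sqint Y -> sqint Z ->
  \int[P]_w (a * Y w + b * Z w) ^+ 2 = a ^+ 2 * (\int[P]_w Y w ^+ 2) +
    2 * a * b * (\int[P]_w (Y w * Z w)) + b ^+ 2 * (\int[P]_w Z w ^+ 2).
Proof.
move=> mY mZ iY iZ; have iYZ := sqint_mul mY mZ iY iZ.
have i1 := integrable_funZ measurableT (a ^+ 2) iY.
have i2 := integrable_funZ measurableT (2 * a * b) iYZ.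
have i3 := integrable_funZ measurableT (b ^+ 2) iZ.
rewrite -!RintegralZl// -RintegralD// -RintegralD//; last exact: integrable_funD.
by apply: eq_Rintegral => w _; ring.
Qed.

End second_moments.

Section nondeterminism.
Context d (T : measurableType d) (R : realType) (P : probability T R).

(** The exponent stands for the variance of [xi * X s + eta * X u], split into the
    part explained by [X s], where [c] acts as a regression coefficient, and the
    conditional variance given [X s], of order [(u - s) `^ (2 * tau)].  Since [th]
    is arbitrary, the inequality bounds the modulus of the characteristic function
    of [(X s, X u)]. *)
Definition locally_nondeterministic (tau : R) (X : R -> {RV P >-> R}) : Prop :=
  exists2 kappa : R, 0 < kappa & forall s u, 0 < s -> s < u ->
    exists c, forall xi eta th : R,
      `|\int[P]_w cos (xi * X s w + eta * X u w + th)| <=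
      expR (- (kappa * ((xi + c * eta) ^+ 2 * s `^ (2 * tau) +
                        eta ^+ 2 * (u - s) `^ (2 * tau)))).

(** The hypothesis on [X u + c * X s] says that no linear prediction of [X u] from
    [X s] has a mean square error below [kappa * (u - s) `^ (2 * tau)].  The factor
    4 in place of the Gaussian value 2 leaves room for processes that are only
    known as limits of Gaussian ones. *)
Lemma locally_nondeterministic_of_variance (tau kappa : R) (X : R -> {RV P >-> R}) :
  0 < kappa ->
  (forall t, 0 <= t -> P.-integrable setT (EFin \o (fun w => X t w ^+ 2))) ->
  (forall s u c, 0 <= s -> s < u ->
    kappa * (u - s) `^ (2 * tau) <= \int[P]_w (X u w + c * X s w) ^+ 2) ->
  (forall s u xi eta th, 0 <= s -> 0 <= u ->
    `|\int[P]_w cos (xi * X s w + eta * X u w + th)| <=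
    expR (- ((\int[P]_w (xi * X s w + eta * X u w) ^+ 2) / 4))) ->
  locally_nondeterministic tau X.
Proof.
move=> k0 iX V C; exists (kappa / 4); first by rewrite divr_gt0.
move=> s u s0 su.
have u0 : 0 <= u by rewrite ltW// (lt_trans s0).
have mX t : measurable_fun setT (X t) by [].
have is_ := iX s (ltW s0); have iu := iX u u0.
pose A := \int[P]_w X s w ^+ 2.
pose B := \int[P]_w (X s w * X u w).
pose D := \int[P]_w X u w ^+ 2.
(* Predicting [X s] from [X 0] with coefficient 0 bounds its variance below. *)
have hA : kappa * s `^ (2 * tau) <= A.
  have := V 0 s 0 (lexx _) s0; rewrite subr0.
  by under eq_Rintegral do rewrite mul0r addr0.
have A0 : 0 < A by rewrite (lt_le_trans _ hA)// mulr_gt0// powR_gt0.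
(* The regression coefficient completes the square in the variance of
   [xi * X s + eta * X u]. *)
exists (B / A) => xi eta th.
have hc : kappa * (u - s) `^ (2 * tau) <= D - B ^+ 2 / A.
  have := V s u (- (B / A)) (ltW s0) su.
  under eq_Rintegral do rewrite -[X u _]mul1r addrC.
  rewrite Rintegral_sqr_comb// -/A -/B -/D => /le_trans; apply.
  rewrite le_eqVlt; apply/orP; left; apply/eqP.
  by field; rewrite gt_eqF.
apply: (le_trans (C s u xi eta th (ltW s0) u0)).
rewrite ler_expR lerN2 Rintegral_sqr_comb// -/A -/B -/D.
rewrite [leLHS]mulrAC ler_pM2r ?invr_gt0//.
have -> : xi ^+ 2 * A + 2 * xi * eta * B + eta ^+ 2 * D =
    (xi + B / A * eta) ^+ 2 * A + eta ^+ 2 * (D - B ^+ 2 / A).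
  by field; rewrite gt_eqF.
rewrite mulrDr; apply: lerD.
  by rewrite mulrCA ler_wpM2l ?sqr_ge0.
by rewrite mulrCA ler_wpM2l ?sqr_ge0.
Qed.

End nondeterminism.

Section gaussian_combinations.
Context d (T : measurableType d) (R : realType) (P : probability T R).
Variables (X : R -> {RV P >-> R}) (K : R -> R -> R).
Hypotheses (gX : gaussian_process X) (cX : centered X) (covX : has_covariance X K).

Lemma covariance_moment (s t : R) : 0 <= s -> 0 <= t ->
  (\int[P]_w (X s w * X t w)%:E = (K s t)%:E)%E.
Proof.
move=> s0 t0; rewrite -covX// covariance.unlock !cX// expectation.unlock.
by apply: eq_integral => w _; congr EFin; rewrite [RHS]/GRing.mul/= !subr0.
Qed.

Lemma sqint_process (t : R) : 0 <= t ->
  P.-integrable setT (EFin \o (fun w => X t w ^+ 2)).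
Proof.
move=> t0; apply/integrableP; split.
  by apply/measurable_EFinP; apply: measurable_funX.
under eq_integral do rewrite /= ger0_norm ?sqr_ge0// expr2.
by rewrite covariance_moment// ltry.
Qed.

Lemma Rintegral_process (t : R) : 0 <= t -> \int[P]_w X t w = 0.
Proof. by move=> t0; rewrite /Rintegral -[X in fine X]/(_) -expectation_def cX. Qed.

Section combination.
Variables (n : nat) (t c : 'I_n -> R).
Hypothesis t0 : forall i, 0 <= t i.
Let Y w := \sum_(i < n) c i * X (t i) w.

Lemma measurable_combination : measurable_fun setT Y.
Proof. by apply: measurable_sum => i; exact: measurable_funM. Qed.

Lemma Rintegral_sqr_combination :
  \int[P]_w Y w ^+ 2 = \sum_(i < n) \sum_(j < n) c i * c j * K (t i) (t j).
Proof.
have iXX i j : P.-integrable setT (EFin \o (fun w => X (t i) w * X (t j) w)).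
  by apply: sqint_mul => //; exact: sqint_process.
have iZ i j := integrable_funZ measurableT (c i * c j) (iXX i j).
transitivity (\int[P]_w (\sum_(i < n) \sum_(j < n)
    c i * c j * (X (t i) w * X (t j) w))).
  apply: eq_Rintegral => w _; rewrite expr2 big_distrlr/=.
  by apply: eq_bigr => i _; apply: eq_bigr => j _; ring.
rewrite Rintegral_fun_sum//; last first.
  by move=> i; exact: integrable_fun_sum.
apply: eq_bigr => i _; rewrite Rintegral_fun_sum//.
apply: eq_bigr => j _; rewrite RintegralZl//; congr (_ * _).
by rewrite /Rintegral covariance_moment.
Qed.

Lemma gaussian_combination_cos :
  P.-integrable setT (EFin \o (fun w => Y w ^+ 2)) /\
  forall th, \int[P]_w cos (Y w + th) =
    cos th * expR (- (\int[P]_w Y w ^+ 2 / 2)).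
Proof.
apply: gaussian_rv_cos; [exact: measurable_combination|exact: gX|].
have iX i : P.-integrable setT (EFin \o X (t i)).
  by apply: sqint_integrable => //; exact: sqint_process.
rewrite Rintegral_fun_sum//; last by move=> i; exact: integrable_funZ.
by apply: big1 => i _; rewrite RintegralZl// Rintegral_process// mulr0.
Qed.

End combination.
End gaussian_combinations.

(** * Fractional Brownian motion *)

Section powR_lemmas.
Context (R : realType).
Implicit Types x y a : R.

Lemma powR_subadd x y a : 0 <= x -> 0 <= y -> 0 <= a -> a <= 1 ->
  (x + y) `^ a <= x `^ a + y `^ a.
Proof.
move=> x0 y0 a0 a1.
have [->|xy] := eqVneq (x + y) 0.
  have [->|an0] := eqVneq a 0; first by rewrite !powRr0 lerDl.
  by rewrite powR0// addr_ge0 ?powR_ge0.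
have xy0 : 0 < x + y by rewrite lt_neqAle eq_sym xy addr_ge0.
have aux z : 0 <= z -> z <= x + y -> z / (x + y) * (x + y) `^ a <= z `^ a.
  move=> z0 zxy; have [->|zn0] := eqVneq z 0.
    by rewrite mul0r mul0r powR_ge0.
  have zp : 0 < z by rewrite lt_neqAle eq_sym zn0.
  rewrite -[in leRHS](divfK xy z) powRM ?divr_ge0 ?(ltW xy0)//.
  rewrite ler_wpM2r ?powR_ge0// ger1_powR// divr_gt0//=.
  by rewrite ler_pdivrMr// mul1r.
apply: le_trans (lerD (aux x x0 _) (aux y y0 _)); rewrite ?lerDl ?lerDr//.
by rewrite -mulrDl -mulrDl divff// mul1r.
Qed.

Lemma powR_twice x a : 0 <= x -> x `^ (2 * a) = (x `^ a) ^+ 2.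
Proof. by move=> x0; rewrite mulrC powRrM powR_mulrn// powR_ge0. Qed.

(** Expanding [(s + v) ^+ 2] before applying the subadditivity of [x `^ tau]
    produces the constant [2 `^ tau < 2], which is what keeps the correlation
    of disjoint increments away from 1. *)
Lemma powR_correlation (tau s v : R) : 0 <= tau -> tau <= 1 -> 0 <= s -> 0 <= v ->
  `|(s + v) `^ (2 * tau) - s `^ (2 * tau) - v `^ (2 * tau)| <=
    2 `^ tau * (s `^ tau * v `^ tau).
Proof.
move=> t0 t1 s0 v0; have u0 : 0 <= s + v by rewrite addr_ge0.
rewrite ler_norml; apply/andP; split.
  have su : s `^ (2 * tau) <= (s + v) `^ (2 * tau).
    by rewrite ge0_ler_powR ?nnegrE ?mulr_ge0// lerDl.
  have vu : v `^ (2 * tau) <= (s + v) `^ (2 * tau).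
    by rewrite ge0_ler_powR ?nnegrE ?mulr_ge0// lerDr.
  rewrite (powR_twice _ s0) (powR_twice _ v0) in su vu *.
  have p1 : 1 <= 2 `^ tau :> R by rewrite -[leLHS](powRr0 2) ler_powR// ler1n.
  have := powR_ge0 s tau; have := powR_ge0 v tau.
  move: (s `^ tau) (v `^ tau) (2 `^ tau) ((s + v) `^ (2 * tau)) su vu p1.
  move=> a b c u au bu c1 b0 a0.
  have ab0 : 0 <= a * b by rewrite mulr_ge0.
  have : a * b <= c * (a * b) by rewrite ler_peMl.
  by have [ab|ba] := leP a b; nra.
have E : (s + v) ^+ 2 = (s ^+ 2 + v ^+ 2) + 2 * (s * v) by ring.
rewrite powRrM powR_mulrn// E.
have h1 := @powR_subadd (s ^+ 2 + v ^+ 2) (2 * (s * v)) tau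
   (addr_ge0 (sqr_ge0 _) (sqr_ge0 _)) (mulr_ge0 (ler0n _ _) (mulr_ge0 s0 v0)) t0 t1.
have h2 := @powR_subadd (s ^+ 2) (v ^+ 2) tau (sqr_ge0 _) (sqr_ge0 _) t0 t1.
rewrite -!powR_mulrn// -!powRrM in h1 h2.
have h3 : (2 * (s * v)) `^ tau = 2 `^ tau * (s `^ tau * v `^ tau).
  by rewrite !powRM// mulr_ge0.
rewrite h3 in h1; rewrite -!powR_mulrn//.
by move: h1 h2; move: ((_ + _) `^ tau) => z; lra.
Qed.

End powR_lemmas.

Section fractional_brownian.
Context d (T : measurableType d) (R : realType) (P : probability T R).

Lemma gaussian_pair_cos (X : R -> {RV P >-> R}) K (s u xi eta th : R) :
  gaussian_process X -> centered X -> has_covariance X K ->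
  0 <= s -> 0 <= u ->
  `|\int[P]_w cos (xi * X s w + eta * X u w + th)| <=
    expR (- ((\int[P]_w (xi * X s w + eta * X u w) ^+ 2) / 4)).
Proof.
move=> gX cX covX s0 u0.
pose t (i : 'I_2) := if i == ord0 then s else u.
pose c (i : 'I_2) := if i == ord0 then xi else eta.
have t0 i : 0 <= t i by rewrite /t; case: ifP.
have YE w : \sum_(i < 2) c i * X (t i) w = xi * X s w + eta * X u w.
  by rewrite !big_ord_recl big_ord0 addr0.
have [_ /(_ th)] := gaussian_combination_cos gX cX covX c t0.
under eq_Rintegral do rewrite YE.
under [X in _ = _ * expR (- (X / _))]eq_Rintegral do rewrite YE.
move=> ->.
rewrite normrM (ger0_norm (expR_ge0 _)) -[leRHS]mul1r ler_pM// ?expR_ge0 ?cos_max//.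
rewrite ler_expR lerN2 ler_wpM2l//; last by rewrite lef_pV2 ?posrE// ler_nat.
by apply: Rintegral_ge0 => w _; exact: sqr_ge0.
Qed.

(** By [powR_correlation] the correlation of [X s] and [X u - X s] is at most
    [rho = 2 `^ tau / 2 < 1] in absolute value, hence any prediction of [X u]
    from [X s] misses at least a proportion [1 - rho ^+ 2] of the variance of
    [X u - X s]. *)
Lemma fractional_brownian_motion_nondeterministic (tau : R) (X : R -> {RV P >-> R}) :
  0 < tau -> tau < 1 -> fractional_brownian_motion tau X ->
  locally_nondeterministic tau X.
Proof.
move=> t0 t1 [gX cX covX _].
pose rho : R := 2 `^ tau / 2.
have rho0 : 0 < rho by rewrite divr_gt0// powR_gt0.
have rho1 : rho < 1.
  rewrite ltr_pdivrMr// mul1r -[ltRHS](@powRr1 R)//.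
  by rewrite /powR pnatr_eq0/= ltr_expR ltr_pM2r ?ln_gt0 ?ltr1n.
apply: (@locally_nondeterministic_of_variance _ _ _ _ _ (1 - rho ^+ 2)).
- by nra.
- exact: sqint_process covX.
- move=> s u c s0 su; have u0 : 0 <= u by rewrite (le_trans s0)// ltW.
  under eq_Rintegral do rewrite -[X u _]mul1r.
  have iX := sqint_process cX covX.
  rewrite Rintegral_sqr_comb//; [|exact: iX..].
  have E x y : 0 <= x -> 0 <= y -> \int[P]_w (X x w * X y w) =
      (y `^ (2 * tau) + x `^ (2 * tau) - `|y - x| `^ (2 * tau)) / 2.
    by move=> x0 y0; rewrite /Rintegral (covariance_moment cX covX).
  have sqE x : 0 <= x -> \int[P]_w X x w ^+ 2 = x `^ (2 * tau).
    move=> x0; rewrite -[RHS](mulfK (_ : 2 != 0))//.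
    under eq_Rintegral do rewrite expr2.
    rewrite E// subrr normr0 powR0; last by rewrite mulf_neq0// gt_eqF.
    by rewrite subr0 mulr_natr mulr2n.
  rewrite !sqE// E// distrC (ger0_norm (_ : 0 <= u - s)); last by rewrite subr_ge0 ltW.
  have v0 : 0 <= u - s by rewrite subr_ge0 ltW.
  have := powR_correlation (ltW t0) (ltW t1) s0 v0.
  rewrite subrKC !powR_twice//.
  have := powR_ge0 s tau; have := powR_ge0 (u - s) tau.
  have -> : 2 `^ tau = 2 * rho by rewrite /rho; field.
  move: (s `^ tau) ((u - s) `^ tau) (u `^ tau) => a b z b0 a0.
  rewrite ler_norml => /andP[h1 h2].
  pose g := (z ^+ 2 - a ^+ 2 - b ^+ 2) / 2.
  have zE : z ^+ 2 = a ^+ 2 + b ^+ 2 + 2 * g by rewrite /g; field.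
  rewrite zE in h1 h2 *.
  have g1 : - (rho * (a * b)) <= g by lra.
  have g2 : g <= rho * (a * b) by lra.
  pose y := 1 + c.
  suff : (1 - rho ^+ 2) * b ^+ 2 <= y ^+ 2 * a ^+ 2 + 2 * y * g + b ^+ 2.
    by rewrite /y => /le_trans; apply; rewrite le_eqVlt; apply/orP; left; apply/eqP; field.
  (* [y ^+ 2 * a ^+ 2 - 2 * rho * `|y| * a * b + rho ^+ 2 * b ^+ 2] is a square. *)
  have [y0|y0] := leP 0 y.
    have := ler_wpM2l y0 g1; have := sqr_ge0 (y * a - rho * b).
    by clear; nra.
  have := ler_wnM2l (ltW y0) g2; have := sqr_ge0 (y * a + rho * b).
  by clear; nra.
- move=> s u xi eta th s0 u0; exact: gaussian_pair_cos gX cX covX s0 u0.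
Qed.

End fractional_brownian.

(** * Limits of Gaussian variables *)

Section almost_gaussian.
Context d (T : measurableType d) (R : realType) (P : probability T R).
Implicit Types Y Z : T -> R.
Local Notation sqint Y := (P.-integrable setT (EFin \o (fun w => Y w ^+ 2))).

Lemma cos_lipschitz (x y : R) : `|cos x - cos y| <= `|x - y|.
Proof.
wlog xy : x y / x <= y.
  move=> H; have [/H//|/ltW/H] := leP x y.
  by rewrite distrC (distrC y).
have dc (z : R) : z \in `]x, y[ -> is_derive z (1 : R) (@cos R) (- sin z).
  by move=> _; exact: is_derive_cos.
have [//|c _] := MVT_segment xy dc.
  apply: continuous_subspaceT => z; exact: continuous_cos.
rewrite distrC => ->; rewrite normrM normrN [leRHS]distrC ler_piMl//.
exact: sin_max.
Qed.

Lemma integrable_cos Y (th : R) : measurable_fun setT Y ->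
  P.-integrable setT (EFin \o (fun w => cos (Y w + th))).
Proof.
move=> mY; apply: (integrable_fun_le _ _ (integrable_cst_prob P 1)) => //.
  apply: measurableT_comp; last exact: measurable_funD.
  by apply: continuous_measurable_fun; exact: continuous_cos.
by move=> w _; exact: cos_max.
Qed.

Lemma Rintegral_prob_cst (c : R) : \int[P]_w c = c.
Proof.
by rewrite /Rintegral integral_cst//= probability_setT mule1.
Qed.

(** A mean square limit of Gaussian variables satisfies the Gaussian bound with 4
    instead of 2: the cosine is Lipschitz, so its expectation passes to the limit,
    and [Z ^+ 2 <= 2 * Y ^+ 2 + 2 * (Z - Y) ^+ 2] compares the variances.  This
    avoids proving that Gaussian laws are closed under limits. *)
Lemma approx_gaussian_cos Z : measurable_fun setT Z ->
  (forall e : R, 0 < e -> exists Y, [/\ measurable_fun setT Y, sqint Y,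
     sqint (fun w => Z w - Y w), \int[P]_w (Z w - Y w) ^+ 2 <= e &
     forall th, `|\int[P]_w cos (Y w + th)| <= expR (- (\int[P]_w Y w ^+ 2 / 2))]) ->
  sqint Z /\ forall th,
    `|\int[P]_w cos (Z w + th)| <= expR (- (\int[P]_w Z w ^+ 2 / 4)).
Proof.
move=> mZ approx.
have sZ : sqint Z.
  have [Y [mY iY iZY _ _]] := approx 1 ltr01.
  have mZY : measurable_fun setT (fun w => Z w - Y w) by exact: measurable_funB.
  have := sqint_comb 1 1 mZY mY iZY iY; apply: eq_integrable => // w _ /=.
  by congr EFin; ring.
split=> // th; apply/ler_addgt0Pr => e e0.
wlog e1 : e e0 / e <= 1.
  move=> H; have [e1|e1] := leP e 1; first exact: H.
  by rewrite (le_trans (H 1 ltr01 (lexx _)))// lerD2l ltW.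
(* The two halves of [e] pay for the Lipschitz error and for the factor
   [expR (D ^+ 2 / 2) <= 1 + D] coming from the variances. *)
pose D := e / 2; have D0 : 0 < D by rewrite divr_gt0.
have [Y [mY iY iZY hD hY]] := approx (D ^+ 2) (exprn_gt0 _ D0).
have mZY : measurable_fun setT (fun w => Z w - Y w) by exact: measurable_funB.
have i1 : P.-integrable setT (EFin \o (fun w => Z w - Y w)).
  exact: sqint_integrable.
have h1 : \int[P]_w `|Z w - Y w| <= D.
  apply: (@le_trans _ _ (\int[P]_w ((2 * D)^-1 * (Z w - Y w) ^+ 2 + D / 2))).
    apply: le_Rintegral => //.
    - exact: integrable_fun_abs.
    - apply: integrable_funD => //; [exact: integrable_funZ|exact: integrable_cst_prob].
    move=> w _; rewrite -(real_normK (num_real (Z w - Y w))).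
    move: (`|_|) => x; rewrite -subr_ge0.
    have -> : (2 * D)^-1 * x ^+ 2 + D / 2 - x = (2 * D)^-1 * (x - D) ^+ 2.
      by field; rewrite gt_eqF.
    by rewrite mulr_ge0 ?sqr_ge0// invr_ge0 mulr_ge0// ltW.
  rewrite RintegralD//; [|exact: integrable_funZ|exact: integrable_cst_prob].
  rewrite Rintegral_prob_cst RintegralZl//.
  rewrite [leRHS](splitr D) lerD2r invfM mulrAC ler_pdivrMr//.
  by rewrite mulrAC -expr2 mulrC ler_wpM2r.
have h2 : `|\int[P]_w cos (Z w + th)| <= `|\int[P]_w cos (Y w + th)| + D.
  rewrite -lerBlDl; apply: le_trans (lerB_dist _ _) _.
  rewrite -RintegralB//; [|exact: integrable_cos..].
  apply: le_trans (le_normr_Rintegral _ _) _ => //.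
    apply: integrable_funB => //; exact: integrable_cos.
  apply: le_trans h1; apply: le_Rintegral => //.
  - apply: integrable_fun_abs; apply: integrable_funB => //; exact: integrable_cos.
  - exact: integrable_fun_abs.
  by move=> w _; rewrite (le_trans (cos_lipschitz _ _))// opprD addrACA subrr addr0.
have h3 : \int[P]_w Z w ^+ 2 <= 2 * \int[P]_w Y w ^+ 2 + 2 * D ^+ 2.
  apply: (@le_trans _ _ (2 * \int[P]_w Y w ^+ 2 + 2 * \int[P]_w (Z w - Y w) ^+ 2)).
    rewrite -!RintegralZl// -RintegralD//; [|exact: integrable_funZ..].
    apply: le_Rintegral => //.
      by apply: integrable_funD => //; exact: integrable_funZ.
    by move=> w _; have := sqr_ge0 (Z w - 2 * Y w); nra.
  by rewrite lerD2l ler_wpM2l.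
apply: (le_trans h2); rewrite [leRHS](_ : _ =
   (expR (- (\int[P]_w Z w ^+ 2 / 4)) + D) + D); last by rewrite /D; field.
rewrite lerD2r; apply: (le_trans (hY th)).
have Z0 : 0 <= \int[P]_w Z w ^+ 2 by apply: Rintegral_ge0 => w _; exact: sqr_ge0.
move: (\int[P]_w Z w ^+ 2) (\int[P]_w Y w ^+ 2) h3 Z0 => z y h3 z0.
apply: (@le_trans _ _ (expR (- (z / 4)) * expR (D ^+ 2 / 2))).
  by rewrite -expRD ler_expR; lra.
have h4 : expR (D ^+ 2 / 2) <= 1 + D.
  have D12 : D <= 2^-1 by rewrite /D; lra.
  have h := expR_ge1Dx (- (D ^+ 2 / 2)).
  have p := expR_gt0 (D ^+ 2 / 2).
  rewrite expRN in h; rewrite -(invrK (expR _)) -[leRHS]invrK lef_pV2 ?posrE.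
  - apply: le_trans h; rewrite -[leLHS]mul1r ler_pdivrMr; last by lra.
    by nra.
  - by rewrite invr_gt0.
  - by rewrite invr_gt0; lra.
have e1' : expR (- (z / 4)) <= 1.
  by rewrite -[leRHS]expR0 ler_expR oppr_le0 divr_ge0.
have e0' := expR_ge0 (- (z / 4)).
apply: le_trans (ler_wpM2l e0' h4) _.
by rewrite mulrDr mulr1 lerD2l ler_piMl// ltW.
Qed.

End almost_gaussian.

(** * Wiener integrals of step functions *)

Section wiener_step.
Context d (T : measurableType d) (R : realType) (P : probability T R).
Local Notation mu := (@lebesgue_measure R).
Implicit Types l : seq (R * R).

(** A step function, coded by the list of the pairs [(c, b)] for which it is the
    sum of the [c * \1_`]0, b]]; this turns every property of Wiener integrals
    of steps into one about [Num.min b b']. *)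
Definition ramp_fun l (u : R) : R := \sum_(q <- l) q.1 * \1_`]0, q.2] u.
Definition ramp_integral (W : R -> {RV P >-> R}) l (w : T) : R :=
  \sum_(q <- l) q.1 * W q.2 w.
Definition ramp_in (t : R) l := forall q, q \in l -> 0 <= q.2 <= t.
Definition ramps (s : seq (R * R * R)) : seq (R * R) :=
  flatten [seq [:: (p.1.1, p.2); (- p.1.1, p.1.2)] | p <- s].
Definition ramp_scale (k : R) l := [seq (k * q.1, q.2) | q <- l].

Lemma ramp_in_ramps t s : step_in t s -> ramp_in t (ramps s).
Proof.
move=> st q /flatten_mapP[[[c a] b] /st[a0 ab bt]] /=.
rewrite !inE => /orP[|] /eqP -> /=; rewrite ?a0 ?(le_trans a0)//=.
by rewrite (le_trans ab).
Qed.

Lemma ramp_integralE W s w : ramp_integral W (ramps s) w = step_integral W s w.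
Proof.
rewrite /ramp_integral /ramps big_flatten big_map /step_integral.
apply: eq_bigr => -[[c a] b] _ /=; rewrite !big_cons big_nil /=; ring.
Qed.

Lemma ramp_funE t s u : step_in t s -> ramp_fun (ramps s) u = step_fun s u.
Proof.
move=> st; rewrite /ramp_fun /ramps big_flatten big_map /step_fun.
rewrite big_seq [RHS]big_seq; apply: eq_bigr => -[[c a] b] /st[a0 ab _] /=.
rewrite !big_cons big_nil /= addr0 mulNr -mulrBr; congr (_ * _).
rewrite !indicE !mem_setE !in_itv/=.
by case: (ltP a u) => au; case: (ltP 0 u) => u0; case: (leP u b) => ub;
  case: (leP u a) => ua //=; rewrite ?subr0 ?subrr//; lra.
Qed.

Lemma ramp_fun_cat l l' u : ramp_fun (l ++ l') u = ramp_fun l u + ramp_fun l' u.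
Proof. exact: big_cat. Qed.

Lemma ramp_integral_cat W l l' w :
  ramp_integral W (l ++ l') w = ramp_integral W l w + ramp_integral W l' w.
Proof. exact: big_cat. Qed.

Lemma ramp_fun_scale k l u : ramp_fun (ramp_scale k l) u = k * ramp_fun l u.
Proof.
by rewrite /ramp_fun big_map mulr_sumr; apply: eq_bigr => q _; rewrite mulrA.
Qed.

Lemma ramp_integral_scale W k l w :
  ramp_integral W (ramp_scale k l) w = k * ramp_integral W l w.
Proof.
by rewrite /ramp_integral big_map mulr_sumr; apply: eq_bigr => q _; rewrite mulrA.
Qed.

Lemma ramp_in_cat t l l' : ramp_in t l -> ramp_in t l' -> ramp_in t (l ++ l').
Proof. by move=> h h' q; rewrite mem_cat => /orP[/h|/h']. Qed.

Lemma ramp_in_scale t k l : ramp_in t l -> ramp_in t (ramp_scale k l).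
Proof. by move=> h q /mapP[q' /h ? ->]. Qed.

Lemma ramp_inW t t' l : t <= t' -> ramp_in t l -> ramp_in t' l.
Proof. by move=> tt' h q /h /andP[-> /le_trans->]. Qed.

Lemma ramp_fun_out t l u : ramp_in t l -> t < u -> ramp_fun l u = 0.
Proof.
move=> h tu; rewrite /ramp_fun big_seq big1// => q /h/andP[_ qt].
rewrite indicE mem_setE in_itv/=.
by rewrite leNgt (le_lt_trans qt tu) andbF mulr0.
Qed.

Lemma measurable_ramp_fun l : measurable_fun setT (ramp_fun l).
Proof.
by apply: measurable_sum => q; apply: measurable_funM.
Qed.

Lemma measurable_ramp_integral W l : measurable_fun setT (ramp_integral W l).
Proof. by apply: measurable_sum => q; apply: measurable_funM. Qed.

Lemma integral_min (x y t : R) : 0 <= x <= t -> 0 <= y <= t ->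
  mu.-integrable `[0, t] (EFin \o (fun u => \1_`]0, x] u * \1_`]0, y] u : R)) /\
  \int[mu]_(u in `[0, t]) (\1_`]0, x] u * \1_`]0, y] u) = Num.min x y.
Proof.
move=> /andP[x0 xt] /andP[y0 yt].
have E u : (\1_`]0, x] u * \1_`]0, y] u : R) = \1_`]0, Num.min x y] u.
  rewrite !indicE !mem_setE !in_itv/= le_min.
  by case: (0 < u) => //=; case: (u <= x); case: (u <= y); rewrite ?mulr0 ?mul0r ?mulr1.
have I : (\int[mu]_(u in `[0%R, t]) (\1_`]0, Num.min x y] u)%:E = (Num.min x y)%:E)%E.
  rewrite integral_indic//.
  rewrite setIidl; last first.
    move=> u /=; rewrite !in_itv/= le_min => /and3P[u0 ux _].
    by rewrite ltW// (le_trans ux).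
  rewrite [LHS]lebesgue_measure_itv/= lte_fin oppr0 adde0.
  case: ifPn => //; rewrite -leNgt => h; congr EFin; apply/eqP.
  by rewrite eq_le h le_min x0 y0.
under [X in _ /\ X = _]eq_Rintegral do rewrite E.
split; last by rewrite /Rintegral I.
have : mu.-integrable `[0, t] (EFin \o (\1_`]0, Num.min x y] : R -> R)).
  apply/integrableP; split.
    by apply/measurable_EFinP; apply: measurable_indic; exact: measurable_itv.
  under eq_integral do rewrite /= ger0_norm//.
  by rewrite I ltry.
by apply: eq_integrable => // u _ /=; rewrite E.
Qed.

Variables (W : R -> {RV P >-> R}) (bW : brownian_motion W).

(** The isometry holds because the covariance [Num.min x y] of Brownian motion is
    the scalar product of the indicators of [`]0, x]] and [`]0, y]]. *)
Lemma ramp_integral_law t l : ramp_in t l ->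
  [/\ P.-integrable setT (EFin \o (fun w => ramp_integral W l w ^+ 2)),
   mu.-integrable `[0, t] (EFin \o (fun u => ramp_fun l u ^+ 2)),
   \int[P]_w ramp_integral W l w ^+ 2 = \int[mu]_(u in `[0, t]) ramp_fun l u ^+ 2 &
   forall th, `|\int[P]_w cos (ramp_integral W l w + th)| <=
     expR (- (\int[P]_w ramp_integral W l w ^+ 2 / 2))].
Proof.
move=> lt; have [gW cW covW _] := bW.
pose c (i : 'I_(size l)) := (nth (0, 0) l i).1.
pose tt (i : 'I_(size l)) := (nth (0, 0) l i).2.
have ttt i : 0 <= tt i <= t by apply: lt; exact: mem_nth.
have tt0 i : 0 <= tt i by case/andP: (ttt i).
have YE w : ramp_integral W l w = \sum_(i < size l) c i * W (tt i) w.
  by rewrite /ramp_integral (big_nth (0, 0)) big_mkord.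
have JE u : ramp_fun l u = \sum_(i < size l) c i * \1_`]0, tt i] u.
  by rewrite /ramp_fun (big_nth (0, 0)) big_mkord.
have [iY cY] := gaussian_combination_cos gW cW covW c tt0.
have EY := Rintegral_sqr_combination cW covW c tt0.
have JE2 u : ramp_fun l u ^+ 2 = \sum_(i < size l) \sum_(j < size l)
    c i * c j * (\1_`]0, tt i] u * \1_`]0, tt j] u).
  rewrite JE expr2 big_distrlr/=.
  by apply: eq_bigr => i _; apply: eq_bigr => j _; ring.
have iZ i j : mu.-integrable `[0, t]
    (EFin \o (fun u => c i * c j * (\1_`]0, tt i] u * \1_`]0, tt j] u))).
  by apply: integrable_funZ => //; case: (integral_min (ttt i) (ttt j)).
split.
- by move: iY; apply: eq_integrable => // w _ /=; rewrite YE.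
- have : mu.-integrable `[0, t] (EFin \o (fun u => \sum_(i < size l) \sum_(j < size l)
    c i * c j * (\1_`]0, tt i] u * \1_`]0, tt j] u))).
    by apply: integrable_fun_sum => // i; exact: integrable_fun_sum.
  by apply: eq_integrable => // u _ /=; rewrite JE2.
- under eq_Rintegral do rewrite YE.
  rewrite EY; under [RHS]eq_Rintegral do rewrite JE2.
  rewrite Rintegral_fun_sum//; last by move=> i; exact: integrable_fun_sum.
  apply: eq_bigr => i _; rewrite Rintegral_fun_sum//; apply: eq_bigr => j _.
  have [i1 e1] := integral_min (ttt i) (ttt j).
  by rewrite RintegralZl// e1.
- move=> th; under eq_Rintegral do rewrite YE.
  rewrite cY normrM (ger0_norm (expR_ge0 _)) -[leRHS]mul1r.
  under [X in _ <= 1 * expR (- (X / _))]eq_Rintegral do rewrite YE.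
  by rewrite ler_wpM2r ?expR_ge0 ?cos_max.
Qed.

End wiener_step.

(** * The Riemann-Liouville process *)

Section riemann_liouville.
Context d (T : measurableType d) (R : realType) (P : probability T R).
Local Notation mu := (@lebesgue_measure R).
Local Notation sqint Y := (P.-integrable setT (EFin \o (fun w => Y w ^+ 2))).

Lemma sqint_le (Y : T -> R) (e : R) : measurable_fun setT Y ->
  ('E_P[(fun w => Y w ^+ 2)%R] <= e%:E)%E ->
  sqint Y /\ \int[P]_w Y w ^+ 2 <= e.
Proof.
move=> mY; rewrite expectation.unlock => le.
have iY : sqint Y.
  apply/integrableP; split.
    by apply/measurable_EFinP; exact: measurable_funX.
  under eq_integral do rewrite /= ger0_norm ?sqr_ge0//.
  by rewrite (le_lt_trans le)// ltry.
split => //; rewrite -lee_fin EFin_Rintegral//.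
Qed.

Variables (W : R -> {RV P >-> R}) (bW : brownian_motion W).

Lemma wiener_integral_approx (t e : R) (f : R -> R) (Y : {RV P >-> R}) : 0 < e ->
  is_wiener_integral W t f Y ->
  exists l, [/\ ramp_in t l,
    (\int[mu]_(u in `[0%R, t]) ((f u - ramp_fun l u) ^+ 2)%:E <= e%:E)%E,
    sqint (fun w => Y w - ramp_integral W l w) &
    \int[P]_w (Y w - ramp_integral W l w) ^+ 2 <= e].
Proof.
move=> e0 [mf [s [st sf sY]]].
have near0 (v : nat -> \bar R) : v n @[n --> \oo] --> 0%E ->
    \forall n \near \oo, (v n <= e%:E)%E.
  move=> v0; have h : (\forall x \near (0 : \bar R)%E, (x < e%:E)%E).
    by apply: open_ereal_lt'; rewrite lte_fin.
  have h' : \forall n \near \oo, (v n < e%:E)%E := v0 _ h.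
  by apply: filterS h' => n /ltW.
have [n []] := filter_ex (filterI (near0 _ sf) (near0 _ sY)).
move=> h1 h2; exists (ramps (s n)).
have r := ramp_in_ramps (st n).
have mD : measurable_fun setT (fun w => Y w - ramp_integral W (ramps (s n)) w).
  by apply: measurable_funB => //; exact: measurable_ramp_integral.
have [i1 i2] : sqint (fun w => Y w - ramp_integral W (ramps (s n)) w) /\
    \int[P]_w (Y w - ramp_integral W (ramps (s n)) w) ^+ 2 <= e.
  apply: sqint_le => //; move: h2; congr (_ <= _)%E; congr expectation.
  by apply/funext => w; rewrite ramp_integralE.
split => //; move: h1; congr (_ <= _)%E.
by apply: eq_integral => u _; rewrite (ramp_funE _ (st n)).
Qed.

(** On the first half [`]s, m]] of the interval, [u - r] lies between [v / 2] and
    [v = u - s], so the squared kernel is at least [v `^ (2 * tau - 1) / 2] whatever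
    the sign of the exponent.  The step function inherits this up to the error
    [e]. *)
Lemma riemann_liouville_kernel_lower (tau s u : R) (l : seq (R * R)) (e : R) :
  0 < tau -> tau < 1 -> 0 <= s -> s < u ->
  measurable_fun `[0, u] (fun r => (u - r) `^ (tau - 2^-1)) ->
  (\int[mu]_(r in `[0%R, u]) (((u - r) `^ (tau - 2^-1) - ramp_fun l r) ^+ 2)%:E
     <= e%:E)%E ->
  (((u - s) `^ (2 * tau) / 8 - e)%:E <=
    \int[mu]_(r in `]s, u]) (ramp_fun l r ^+ 2)%:E)%E.
Proof.
move=> t0 t1 s0 su mK hK.
pose v := u - s; have v0 : 0 < v by rewrite subr_gt0.
pose m := s + v / 2.
have sm : s < m by rewrite ltrDl divr_gt0.
have mu' : m < u by rewrite /m /v; lra.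
have ml := measurable_ramp_fun l.
have sub : `]s, m]%classic `<=` `[0, u]%classic.
  move=> r /=; rewrite !in_itv/= => /andP[sr rm].
  by rewrite (ltW (le_lt_trans s0 sr)) (le_trans rm (ltW mu')).
have mK' : measurable_fun `]s, m] (fun r => (u - r) `^ (tau - 2^-1)).
  exact: measurable_funS sub mK.
pose E r := ((u - r) `^ (tau - 2^-1) - ramp_fun l r) ^+ 2.
have mE : measurable_fun `[0, u] E.
  apply: measurable_funX; apply: measurable_funB => //; exact: measurable_funTS.
have pt r : r \in `]s, m] -> v `^ (2 * tau - 1) / 4 <= ramp_fun l r ^+ 2 + E r.
  rewrite in_itv/= => /andP[sr rm].
  have hy : 2^-1 <= (u - r) / v <= 1.
    by rewrite ler_pdivlMr// ler_pdivrMr// /m /v in rm *; apply/andP; split; lra.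
  have y0 : 0 < u - r by rewrite subr_gt0 (le_lt_trans rm).
  have hz : (u - r) / v <= ((u - r) / v) `^ (2 * tau - 1).
    have z01 : 0 < (u - r) / v <= 1 by case/andP: hy => _ ->; rewrite divr_gt0.
    have z1 : 2 * tau - 1 <= 1 by lra.
    have := ger_powR z01 z1; rewrite powRr1//.
    by case/andP: z01 => /ltW.
  have hk : v `^ (2 * tau - 1) / 2 <= (u - r) `^ (2 * tau - 1).
    rewrite -[in leRHS](divfK (_ : v != 0) (u - r)) ?gt_eqF//.
    have q0 : 0 <= (u - r) / v by rewrite divr_ge0// ltW.
    rewrite (powRM _ q0 (ltW v0)) mulrC ler_wpM2r ?powR_ge0//.
    by case/andP: hy => hy _; exact: le_trans hz.
  have kE : (u - r) `^ (2 * tau - 1) = ((u - r) `^ (tau - 2^-1)) ^+ 2.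
    by rewrite -powR_twice ?(ltW y0)//; congr (_ `^ _); field.
  rewrite kE in hk; rewrite /E; move: (_ `^ (tau - _)) (ramp_fun _ _) hk => k x hk.
  by have := sqr_ge0 (2 * x - k); nra.
have vE : v / 2 * (v `^ (2 * tau - 1) / 4) = v `^ (2 * tau) / 8.
  by rewrite -(@mulr_powRB1 _ v (2 * tau)) ?ltW ?mulr_gt0//; field.
apply: (@le_trans _ _ (\int[mu]_(r in `]s, m]) (ramp_fun l r ^+ 2)%:E)%E); last first.
  apply: ge0_subset_integral => //.
  - by apply/measurable_EFinP/measurable_funTS; apply: measurable_funX.
  - by move=> r _; rewrite lee_fin sqr_ge0.
  - move=> r /=; rewrite !in_itv/= => /andP[-> rm].
    by rewrite (le_trans rm (ltW mu')).
rewrite EFinB leeBlDr//.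
have hE : (\int[mu]_(r in `]s, m]) (E r)%:E <= e%:E)%E.
  apply: le_trans hK; apply: ge0_subset_integral => //.
  - exact/measurable_EFinP.
  - by move=> r _; rewrite lee_fin sqr_ge0.
apply: le_trans (leeD (lexx _) hE).
rewrite -ge0_integralD//=; last 4 first.
- by move=> r _; rewrite lee_fin sqr_ge0.
- by apply/measurable_EFinP/measurable_funTS; apply: measurable_funX.
- by move=> r _; rewrite lee_fin sqr_ge0.
- by apply/measurable_EFinP; exact: measurable_funS mE.
apply: (@le_trans _ _ (\int[mu]_(r in `]s, m]) (v `^ (2 * tau - 1) / 4)%:E)%E).
  rewrite integral_cst//= lebesgue_measure_itv/= lte_fin sm -EFinB -EFinM lee_fin.
  by rewrite -/v -vE mulrC /m [s + _]addrC addrK.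
apply: ge0_le_integral => //=.
- by move=> r _; rewrite lee_fin divr_ge0// powR_ge0.
- apply: emeasurable_funD; apply/measurable_EFinP.
    by apply: measurable_funTS; apply: measurable_funX.
  exact: measurable_funS mE.
Qed.

(** In the mean square error of predicting [X u] from [X s], keep only the
    contribution of the noise on [`]s, u]]: the step functions approximating the
    kernel of [X s] vanish there, so that the coefficient [c] drops out. *)
Lemma riemann_liouville_nondeterministic (tau : R) (X : R -> {RV P >-> R}) :
  0 < tau -> tau < 1 ->
  (forall t, 0 <= t -> is_wiener_integral W t (fun s => (t - s) `^ (tau - 2^-1)) (X t)) ->
  locally_nondeterministic tau X.
Proof.
move=> t0 t1 XW.
have mX t : measurable_fun setT (X t) by [].
have mW l : measurable_fun setT (ramp_integral W l) by exact: measurable_ramp_integral.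
have iW t l : ramp_in t l -> sqint (ramp_integral W l).
  by move=> lt; case: (ramp_integral_law bW lt).
have iX t : 0 <= t -> sqint (X t).
  move=> /XW/(wiener_integral_approx ltr01)[l [lt _ il _]].
  have mXl : measurable_fun setT (fun w => X t w - ramp_integral W l w).
    exact: measurable_funB.
  have := sqint_comb 1 1 mXl (mW l) il (iW _ _ lt).
  by apply: eq_integrable => // w _ /=; congr EFin; ring.
have pair s u (a b e : R) : 0 <= s -> 0 <= u -> 0 < e -> exists ls lu,
  [/\ [/\ ramp_in s ls, ramp_in u lu &
     (\int[mu]_(r in `[0%R, u]) (((u - r) `^ (tau - 2^-1) - ramp_fun lu r) ^+ 2)%:E <= e%:E)%E],
    sqint (fun w => (a * X s w + b * X u w) -
       ramp_integral W (ramp_scale a ls ++ ramp_scale b lu) w) &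
    \int[P]_w ((a * X s w + b * X u w) -
       ramp_integral W (ramp_scale a ls ++ ramp_scale b lu) w) ^+ 2 <=
       2 * (a ^+ 2 + b ^+ 2) * e].
  move=> s0 u0 e0.
  have [ls [h1 h2 h3 h4]] := wiener_integral_approx e0 (XW s s0).
  have [lu [k1 k2 k3 k4]] := wiener_integral_approx e0 (XW u u0).
  exists ls, lu.
  have E w : a * (X s w - ramp_integral W ls w) + b * (X u w - ramp_integral W lu w)
      = (a * X s w + b * X u w) -
        ramp_integral W (ramp_scale a ls ++ ramp_scale b lu) w.
    by rewrite ramp_integral_cat !ramp_integral_scale; ring.
  have m1 : measurable_fun setT (fun w => X s w - ramp_integral W ls w).
    exact: measurable_funB.
  have m2 : measurable_fun setT (fun w => X u w - ramp_integral W lu w).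
    exact: measurable_funB.
  have i := sqint_comb a b m1 m2 h3 k3.
  split => //; first by move: i; apply: eq_integrable => // w _ /=; rewrite E.
  under eq_Rintegral do rewrite -E.
  apply: (@le_trans _ _ (\int[P]_w (2 * a ^+ 2 * (X s w - ramp_integral W ls w) ^+ 2 +
      2 * b ^+ 2 * (X u w - ramp_integral W lu w) ^+ 2))).
    apply: le_Rintegral => //.
      by apply: integrable_funD => //; exact: integrable_funZ.
    move=> w _; move: (X s w - _) (X u w - _) => x y.
    by have := sqr_ge0 (a * x - b * y); nra.
  rewrite RintegralD//; [|exact: integrable_funZ..].
  rewrite !RintegralZl//.
  have := ler_wpM2l (mulr_ge0 (ler0n _ 2) (sqr_ge0 a)) h4.
  have := ler_wpM2l (mulr_ge0 (ler0n _ 2) (sqr_ge0 b)) k4.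
  lra.
apply: (@locally_nondeterministic_of_variance _ _ _ _ _ 16^-1) => //.
- move=> s u c s0 su; have u0 : 0 <= u by rewrite (le_trans s0)// ltW.
  under eq_Rintegral do rewrite addrC -[X u _]mul1r.
  apply/ler_addgt0Pr => e e0.
  pose K := 2 * (c ^+ 2 + 1) + 1.
  have K0 : 0 < K by have := sqr_ge0 c; rewrite /K; lra.
  have [ls [lu [[h1 h2 h5] h3 h4]]] := pair s u c 1 (e / K) s0 u0 (divr_gt0 e0 K0).
  have h : ramp_in u (ramp_scale c ls ++ ramp_scale 1 lu).
    apply: ramp_in_cat; apply: ramp_in_scale => //.
    exact: ramp_inW (ltW su) h1.
  have [j1 j2 j3 _] := ramp_integral_law bW h.
  have [mK _] := XW u u0.
  have low := riemann_liouville_kernel_lower t0 t1 s0 su mK h5.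
  have low2 : (u - s) `^ (2 * tau) / 8 - e / K <=
      \int[P]_w ramp_integral W (ramp_scale c ls ++ ramp_scale 1 lu) w ^+ 2.
    rewrite j3 -lee_fin EFin_Rintegral//; apply: (le_trans low).
    apply: (@le_trans _ _ (\int[mu]_(r in `]s, u])
       (ramp_fun (ramp_scale c ls ++ ramp_scale 1 lu) r ^+ 2)%:E)%E).
      rewrite le_eqVlt; apply/orP; left; apply/eqP; apply: eq_integral => r.
      rewrite inE/= in_itv/= => /andP[sr _].
      by rewrite ramp_fun_cat !ramp_fun_scale (ramp_fun_out h1 sr) mulr0 add0r mul1r.
    apply: ge0_subset_integral => //.
    - apply/measurable_EFinP/measurable_funTS; apply: measurable_funX.
      exact: measurable_ramp_fun.
    - by move=> r _; rewrite lee_fin sqr_ge0.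
    - move=> r /=; rewrite !in_itv/= => /andP[sr ->].
      by rewrite andbT ltW// (le_lt_trans s0).
  have mZ : measurable_fun setT (fun w => c * X s w + 1 * X u w).
    by apply: measurable_funD; exact: measurable_funM.
  have iZ := sqint_comb c 1 (mX s) (mX u) (iX s s0) (iX u u0).
  have up : \int[P]_w ramp_integral W (ramp_scale c ls ++ ramp_scale 1 lu) w ^+ 2 <=
     2 * \int[P]_w (c * X s w + 1 * X u w) ^+ 2 + 2 * (2 * (c ^+ 2 + 1 ^+ 2) * (e / K)).
    apply: le_trans (lerD (lexx _) (ler_wpM2l (ler0n _ 2) h4)).
    rewrite -!RintegralZl// -RintegralD//; [|exact: integrable_funZ..].
    apply: le_Rintegral => //.
      by apply: integrable_funD => //; exact: integrable_funZ.
    move=> w _; move: (c * _ + _) (ramp_integral _ _ _) => x y.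
    by have := sqr_ge0 (2 * x - y); nra.
  have := le_trans low2 up.
  have eE : e = K * (e / K) by rewrite mulrC divfK// gt_eqF.
  have q0 : 0 <= e / K by rewrite ltW// divr_gt0.
  rewrite [X in _ -> _ <= _ + X]eE; move: (e / K) q0 => q q0; rewrite /K expr1n.
  by move: (Rintegral _ _ _) (_ `^ _) (c ^+ 2) => z y x; lra.
- move=> s u xi eta th s0 u0.
  apply: (approx_gaussian_cos _ _).2 => [|e e0].
    by apply: measurable_funD; exact: measurable_funM.
  pose K := 2 * (xi ^+ 2 + eta ^+ 2) + 1.
  have K0 : 0 < K by rewrite ltr_wpDl// mulr_ge0// addr_ge0// sqr_ge0.
  have [ls [lu [[h1 h2 _] h3 h4]]] := pair s u xi eta (e / K) s0 u0 (divr_gt0 e0 K0).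
  have h : ramp_in (Num.max s u) (ramp_scale xi ls ++ ramp_scale eta lu).
    apply: ramp_in_cat; apply: ramp_in_scale.
      by apply: ramp_inW h1; rewrite le_max lexx.
    by apply: ramp_inW h2; rewrite le_max lexx orbT.
  have [j1 _ _ j2] := ramp_integral_law bW h.
  exists (ramp_integral W (ramp_scale xi ls ++ ramp_scale eta lu)); split => //.
  apply: (le_trans h4); rewrite mulrCA ler_piMr ?(ltW e0)//.
  by rewrite ler_pdivrMr// mul1r lerDl.
Qed.

End riemann_liouville.

(** * Cosine transforms evaluated at random variables *)

Section swap.
Context d (T : measurableType d) (R : realType) (P : probability T R).
Local Notation mu := (@lebesgue_measure R).

(** The right side may be evaluated with bounds on [\int[P]_w F w x] that exploit
    cancellations in [w], which the triangle inequality under both integrals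
    would lose. *)
Lemma le_abs_Rintegral_swap (F : T -> R -> R) (g : R -> R) :
  measurable_fun setT (fun z : T * measurableTypeR R => F z.1 z.2) ->
  mu.-integrable setT (EFin \o g) -> (forall w x, `|F w x| <= g x) ->
  (`|\int[P]_w \int[mu]_x F w x|%:E <= \int[mu]_x `|\int[P]_w F w x|%:E)%E.
Proof.
move=> mF ig Fg.
pose f (z : T * measurableTypeR R) : \bar R := (F z.1 z.2)%:E.
have mf : measurable_fun setT f by exact/measurable_EFinP.
have mg : measurable_fun setT g by case/integrableP : ig => /measurable_EFinP.
have g0 x : 0 <= g x by have w : T := point; exact: le_trans (Fg w x).
have mFw w : measurable_fun setT (F w).
  exact: (measurableT_comp mF (measurable_pair1 w)).
have mFx x : measurable_fun setT (F ^~ x).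
  exact: (measurableT_comp mF (measurable_pair2 x)).
have iFw w : mu.-integrable setT (EFin \o F w).
  apply: (integrable_fun_le _ _ ig) => //; exact: mFw.
have iFx x : P.-integrable setT (EFin \o F ^~ x).
  by apply: (integrable_fun_le _ _ (integrable_cst_prob P (g x))).
have intf : (P \x mu)%E.-integrable setT f.
  apply/integrable12ltyP => //.
  apply: (@le_lt_trans _ _ (\int[P]_w \int[mu]_x (g x)%:E)%E).
    apply: ge0_le_integral => //.
    - by move=> w _; apply: integral_ge0.
    - apply: (measurable_fun_fubini_tonelli_F (abse \o f)) => //=.
      exact: measurableT_comp.
    - move=> w _; apply: ge0_le_integral => //.
      + by apply: measurableT_comp => //; apply/measurable_EFinP; exact: mFw.
      + exact/measurable_EFinP.
      + by move=> x _; rewrite lee_fin.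
  rewrite integral_cst//= probability_setT mule1.
  by case/integrableP : ig => _; under eq_integral do rewrite /= ger0_norm//.
have swap : (\int[P]_w (\int[mu]_x F w x)%:E = \int[mu]_x (\int[P]_w F w x)%:E)%E.
  under eq_integral do rewrite EFin_Rintegral//.
  under [RHS]eq_integral do rewrite EFin_Rintegral//.
  exact: (Fubini intf).
have i1 : P.-integrable setT (fun w => (\int[mu]_x F w x)%:E).
  have := integrable_fubini_F intf; apply: eq_integrable => // w _.
  by rewrite EFin_Rintegral.
rewrite -[X in `|X|]/(fine (\int[P]_w (\int[mu]_x F w x)%:E)).
rewrite -fine_abse ?fineK ?abse_fin_num ?integrable_fin_num//.
rewrite swap; apply: le_abse_integral => //.
have := measurable_fubini_G intf; apply: eq_measurable_fun => x _.
by rewrite /fubini_G EFin_Rintegral.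
Qed.

Lemma measurable_Rintegral_param (F : T -> R -> R) :
  measurable_fun setT (fun z : T * measurableTypeR R => F z.1 z.2) ->
  (exists2 M, 0 <= M & forall w x, `|F w x| <= M) ->
  measurable_fun setT (fun x => \int[P]_w F w x).
Proof.
move=> mF [M M0 FM].
pose f (z : T * measurableTypeR R) : \bar R := (F z.1 z.2)%:E.
have mf : measurable_fun setT f by exact/measurable_EFinP.
(* The shift by [M] makes the integrand nonnegative, as Tonelli requires. *)
pose f1 z := (f z + M%:E)%E.
have mf1 : measurable_fun setT f1 by exact: emeasurable_funD.
have f10 z : (0 <= f1 z)%E.
  by rewrite /f1 /f -EFinD lee_fin -lerBlDr sub0r; have /ler_normlP[] := FM z.1 z.2; lra.
have mG := measurable_fun_fubini_tonelli_G (m1 := P) f1 mf1 f10.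
have mFx x : measurable_fun setT (F ^~ x).
  exact: (measurableT_comp mF (measurable_pair2 x)).
have iFx x : P.-integrable setT (EFin \o F ^~ x).
  by apply: (integrable_fun_le _ _ (integrable_cst_prob P M)).
have E x : \int[P]_w F w x = fine (fubini_G P f1 x) - M.
  rewrite /fubini_G /f1 /f /=.
  have -> : (\int[P]_w ((F w x)%:E + M%:E) = \int[P]_w (F w x + M)%:E)%E.
    by apply: eq_integral => w _.
  rewrite -EFin_Rintegral//; last first.
    by apply: integrable_funD => //; exact: integrable_cst_prob.
  rewrite /= RintegralD//; last exact: integrable_cst_prob.
  by rewrite Rintegral_prob_cst addrK.
under eq_fun do rewrite E.
by apply: measurable_funB => //; exact: measurableT_comp.
Qed.

End swap.

Section fourier_kernel.
Context d (T : measurableType d) (R : realType) (P : probability T R).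
Local Notation mu := (@lebesgue_measure R).

(** A real form of the Fourier transform, with amplitude [a] and phase [th]. *)
Definition cos_transform (a th : R -> R) (y : R) : R :=
  \int[mu]_x (a x * cos (x * y + th x)).

Lemma measurable_cos_phase (th : R -> R) d' (S : measurableType d')
    (g : S -> R) (h : S -> R) : measurable_fun setT g -> measurable_fun setT h ->
  measurable_fun setT th ->
  measurable_fun setT (fun z => cos (h z * g z + th (h z))).
Proof.
move=> mg mh mth; apply: measurableT_comp.
  by apply: continuous_measurable_fun; exact: continuous_cos.
by apply: measurable_funD; [exact: measurable_funM|exact: measurableT_comp].
Qed.

Variables (a th : R -> R).
Hypotheses (ia : mu.-integrable setT (EFin \o a)) (mth : measurable_fun setT th).

Let ma : measurable_fun setT a.
Proof. by case/integrableP : ia => /measurable_EFinP. Qed.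

Lemma integrable_cos_transform y :
  mu.-integrable setT (EFin \o (fun x => a x * cos (x * y + th x))).
Proof.
have h : mu.-integrable setT (EFin \o (fun x => cos (x * y + th x) * a x)).
  apply: (@integrable_funM_bounded _ _ _ _ _ _ _ _ 1) => //.
  - by apply: measurable_cos_phase => //; exact: measurable_id.
  - by move=> x _; exact: cos_max.
by move: h; apply: eq_integrable => // x _ /=; rewrite mulrC.
Qed.

Lemma cos_transform_bounded y : `|cos_transform a th y| <= \int[mu]_x `|a x|.
Proof.
apply: le_trans (le_normr_Rintegral _ _) _ => //; first exact: integrable_cos_transform.
apply: le_Rintegral => //.
- exact: (integrable_fun_abs (integrable_cos_transform y)).
- exact: integrable_fun_abs.
- by move=> x _; rewrite normrM ler_piMr// cos_max.
Qed.

Lemma measurable_cos_transform : measurable_fun setT (cos_transform a th).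
Proof.
pose f (z : measurableTypeR R * measurableTypeR R) : \bar R :=
  (a z.2 * cos (z.2 * z.1 + th z.2) + `|a z.2|)%:E.
have mf : measurable_fun setT f.
  apply/measurable_EFinP; apply: measurable_funD; last first.
    by do 2 apply: measurableT_comp => //.
  apply: measurable_funM; first exact: measurableT_comp.
  exact: measurable_cos_phase.
have f0 z : (0 <= f z)%E.
  rewrite lee_fin -lerBlDr sub0r.
  have : `|a z.2 * cos (z.2 * z.1 + th z.2)| <= `|a z.2|.
    by rewrite normrM ler_piMr// cos_max.
  by move=> /ler_normlP[]; lra.
have mF := measurable_fun_fubini_tonelli_F (m2 := mu) f mf f0.
have E y : cos_transform a th y = fine (fubini_F mu f y) - \int[mu]_x `|a x|.
  rewrite /fubini_F /f /= -EFin_Rintegral//; last first.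
    apply: integrable_funD => //; first exact: integrable_cos_transform.
    exact: integrable_fun_abs.
  rewrite /= RintegralD//; last exact: integrable_fun_abs.
    by rewrite addrK.
  exact: integrable_cos_transform.
rewrite (_ : cos_transform a th =
  fun y => fine (fubini_F mu f y) - \int[mu]_x `|a x|); last exact/funext.
by apply: measurable_funB => //; exact: measurableT_comp.
Qed.

(** The factor [Z] allows this to be applied twice, first to [X s] with [Z] a
    cosine of [X u], then to [X u] with [Z] a cosine transform of [X s]. *)
Lemma le_abs_Rintegral_cos_transform (Z Y : T -> R) (M : R) :
  measurable_fun setT Z -> measurable_fun setT Y -> (forall w, `|Z w| <= M) ->
  (`|\int[P]_w (Z w * cos_transform a th (Y w))|%:E <=
   \int[mu]_x (`|a x| * `|\int[P]_w (Z w * cos (x * Y w + th x))|)%:E)%E.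
Proof.
move=> mZ mY ZM.
pose F w x := Z w * (a x * cos (x * Y w + th x)).
have mF : measurable_fun setT (fun z : T * measurableTypeR R => F z.1 z.2).
  apply: measurable_funM; first exact: measurableT_comp.
  apply: measurable_funM; first exact: measurableT_comp.
  by apply: measurable_cos_phase => //; exact: measurableT_comp.
have ig : mu.-integrable setT (EFin \o (fun x => M * `|a x|)).
  by apply: integrable_funZ => //; exact: integrable_fun_abs.
have Fg w x : `|F w x| <= M * `|a x|.
  rewrite normrM ler_pM// normrM ler_piMr// cos_max //.
have := le_abs_Rintegral_swap P mF ig Fg.
have -> : \int[P]_w \int[mu]_x F w x = \int[P]_w (Z w * cos_transform a th (Y w)).
  apply: eq_Rintegral => w _; rewrite /F RintegralZl//.
  exact: integrable_cos_transform.
move=> /le_trans; apply; rewrite le_eqVlt; apply/orP; left; apply/eqP.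
apply: eq_integral => x _; congr EFin.
rewrite -normrM -RintegralZl//.
  by congr (`|_|); apply: eq_Rintegral => w _; rewrite /F mulrCA.
apply: (@integrable_fun_le _ _ _ _ _ _ _ (fun=> M)) => //.
- apply: measurable_funM => //.
  apply: measurableT_comp; last by apply: measurable_funD => //; exact: measurable_funM.
  by apply: continuous_measurable_fun; exact: continuous_cos.
- exact: integrable_cst_prob.
- move=> w _; rewrite normrM -[M]mulr1 ler_pM// cos_max//.
Qed.

End fourier_kernel.

(** * Correlations of cosine transforms along the process *)

Section kernel_estimate.
Context d (T : measurableType d) (R : realType) (P : probability T R).
Local Notation mu := (@lebesgue_measure R).

Lemma measurable_gauss_affine (rho m : R) :
  measurable_fun setT (fun x : R => expR (- (rho * (x - m)) ^+ 2)).
Proof.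
apply: measurableT_comp => //; apply: measurableT_comp => //.
apply: measurable_funX; apply: measurable_funM => //.
by apply: measurable_funB => //; exact: measurable_id.
Qed.

Lemma integral_gauss_affine (rho m : R) : 0 < rho ->
  (\int[mu]_x (expR (- (rho * (x - m)) ^+ 2))%:E = (Num.sqrt pi / rho)%:E)%E.
Proof.
move=> r0; pose sg := (Num.sqrt 2 * rho)^-1.
have s2 : Num.sqrt 2 != 0 :> R by rewrite gt_eqF// sqrtr_gt0.
have sg0 : sg != 0 by rewrite invr_eq0 mulf_neq0// gt_eqF.
have sg2 : sg ^+ 2 *+ 2 = (rho ^+ 2)^-1.
  by rewrite /sg -mulr_natr exprVn exprMn sqr_sqrtr//; field; rewrite gt_eqF.
have H := integral_normal_pdf m sg.
have E x : normal_pdf m sg x = normal_peak sg * expR (- (rho * (x - m)) ^+ 2).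
  rewrite normal_pdfE//; congr (_ * expR _); rewrite sg2 invrK exprMn; ring.
have pE : normal_peak sg = rho / Num.sqrt pi.
  rewrite /normal_peak -mulrnAl sg2 sqrtrM ?invr_ge0 ?sqr_ge0//.
  by rewrite -exprVn sqrtr_sqr ger0_norm ?invr_ge0 ?ltW// invfM invrK.
have spi : Num.sqrt pi != 0 :> R by rewrite gt_eqF// sqrtr_gt0 pi_gt0.
move: H; under eq_integral do rewrite E EFinM.
rewrite ge0_integralZl//=; last 2 first.
- by apply/measurable_EFinP; exact: measurable_gauss_affine.
- by rewrite lee_fin normal_peak_ge0.
rewrite pE => H; have := congr1 (fun z => ((Num.sqrt pi / rho)%:E * z)%E) H.
rewrite muleA mule1 -EFinM mulrA divfK ?gt_eqF// divff// mul1e//.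
Qed.

Lemma powR_gauss_bound (z g : R) : 0 <= g -> g <= 1 ->
  `|z| `^ g * expR (- z ^+ 2) <= 2 * expR (- (2^-1 * z ^+ 2)).
Proof.
move=> g0 g1.
have h : `|z| `^ g <= 2 * expR (2^-1 * z ^+ 2).
  apply: (@le_trans _ _ (2 * (1 + 2^-1 * z ^+ 2))); last first.
    by rewrite ler_wpM2l// expR_ge1Dx.
  have [z1|z1] := leP `|z| 1.
    apply: (@le_trans _ _ 1); last by have := sqr_ge0 z; lra.
    have : `|z| `^ g <= 1 `^ g by rewrite ge0_ler_powR// nnegrE.
    by rewrite powR1.
  apply: (@le_trans _ _ `|z|); first by rewrite ler1_powR// ltW.
  by rewrite -(real_normK (num_real z)); have := sqr_ge0 (`|z| - 1); nra.
apply: le_trans (ler_wpM2r (expR_ge0 _) h) _.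
by rewrite -mulrA -expRD ler_wpM2l// ler_expR; lra.
Qed.

Lemma measurable_norm_Rintegral_cos (a th : R -> R) (Z Y : T -> R) (M : R) :
  measurable_fun setT a -> measurable_fun setT th ->
  measurable_fun setT Z -> measurable_fun setT Y -> (forall w, `|Z w| <= M) ->
  measurable_fun setT
    (fun x => `|a x| * `|\int[P]_w (Z w * cos (x * Y w + th x))|).
Proof.
move=> ma mth mZ mY ZM; have M0 : 0 <= M := le_trans (normr_ge0 _) (ZM point).
apply: measurable_funM; first exact: measurableT_comp.
apply: measurableT_comp => //.
apply: (@measurable_Rintegral_param _ _ _ _ (fun w x => Z w * cos (x * Y w + th x))).
  apply: measurable_funM; first exact: measurableT_comp.
  by apply: measurable_cos_phase => //; exact: measurableT_comp.
exists M => // w x; rewrite normrM -[M]mulr1 ler_pM// cos_max//.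
Qed.

Variables (tau : R) (X : R -> {RV P >-> R}).

(** Expanding both transforms gives a double integral over frequencies [x], [y] of
    the characteristic function of [(X s, X u)], with weight [`|a x| * `|a y|].
    Local nondeterminism makes it Gaussian: integrating over [x] with
    [`|a x| <= 2] yields [s `^ (- tau)] wherever the Gaussian is centred, and
    then [`|a y| <= M * `|y| `^ g] yields [(u - s) `^ (- tau * (1 + g))].  The
    Hoelder-type bound is used for one of the two weights only, because the
    centre of the first Gaussian depends on [y]. *)
Lemma cos_transform_kernel (g : R) : locally_nondeterministic tau X ->
  0 <= g -> g <= 1 ->
  exists2 C : R, 0 < C & forall (M : R) (a th : R -> R), 0 <= M ->
    mu.-integrable setT (EFin \o a) -> measurable_fun setT th ->
    (forall x, `|a x| <= 2) -> (forall x, `|a x| <= M * `|x| `^ g) ->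
    forall s u, 0 < s -> s < u ->
    `|\int[P]_w (cos_transform a th (X s w) * cos_transform a th (X u w))| <=
      C * M * (s `^ (- tau) * (u - s) `^ (- (tau * (1 + g)))).
Proof.
move=> [kappa k0 lnd] g0 g1.
pose sk := Num.sqrt kappa.
have sk0 : 0 < sk by rewrite sqrtr_gt0.
have spi : 0 < Num.sqrt pi :> R by rewrite sqrtr_gt0 pi_gt0.
pose C := 4 * pi * Num.sqrt 2 * sk^-1 * (sk^-1 * sk `^ (- g)).
exists C.
  by rewrite !mulr_gt0 ?invr_gt0 ?pi_gt0 ?powR_gt0// sqrtr_gt0.
move=> M a th M0 ia mth a2 aM s u s0 su.
have [c lndc] := lnd s u s0 su.
have ma : measurable_fun setT a by case/integrableP : ia => /measurable_EFinP.
have mX t : measurable_fun setT (X t) by [].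
pose h := cos_transform a th.
have mh : measurable_fun setT h by exact: measurable_cos_transform.
have hM := cos_transform_bounded ia mth.
pose v := u - s; have v0 : 0 < v by rewrite subr_gt0.
pose rho := sk * s `^ tau; pose b := sk * v `^ tau.
have rho0 : 0 < rho by rewrite mulr_gt0 ?powR_gt0.
have b0 : 0 < b by rewrite mulr_gt0 ?powR_gt0.
(* [Q m y x] is the bound given by local nondeterminism, as a function of [x]
   centred at [m = - c * y]; the product of two cosines also produces the
   frequency [- y], that is the centre [c * y]. *)
pose Q (m y x : R) := expR (- (rho * (x - m)) ^+ 2) * expR (- (b * y) ^+ 2).
have cosb x y t : `|\int[P]_w cos (x * X s w + y * X u w + t)| <= Q (- (c * y)) y x.
  apply: le_trans (lndc x y t) _; rewrite /Q -expRD ler_expR opprK.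
  rewrite !exprMn !(sqr_sqrtr (ltW k0)) -(powR_twice _ (ltW s0)) -(powR_twice _ (ltW v0)).
  by rewrite le_eqVlt; apply/orP; left; apply/eqP; rewrite -/v; ring.
have coscos x y : `|\int[P]_w (cos (y * X u w + th y) * cos (x * X s w + th x))| <=
    (Q (- (c * y)) y x + Q (c * y) y x) / 2.
  have i1 := integrable_cos P (th x + th y) (Y := fun w => x * X s w + y * X u w).
  have i2 := integrable_cos P (th x - th y) (Y := fun w => x * X s w + - y * X u w).
  have m1 : measurable_fun setT (fun w => x * X s w + y * X u w).
    by apply: measurable_funD; exact: measurable_funM.
  have m2 : measurable_fun setT (fun w => x * X s w + - y * X u w).
    by apply: measurable_funD; exact: measurable_funM.
  have -> : \int[P]_w (cos (y * X u w + th y) * cos (x * X s w + th x)) =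
    (\int[P]_w cos (x * X s w + y * X u w + (th x + th y)) +
     \int[P]_w cos (x * X s w + - y * X u w + (th x - th y))) * 2^-1.
    rewrite -RintegralD//; [|exact: i1|exact: i2].
    rewrite -RintegralZr//; last by apply: integrable_funD => //; [exact: i1|exact: i2].
    apply: eq_Rintegral => w _.
    have -> : x * X s w + y * X u w + (th x + th y) =
      (x * X s w + th x) + (y * X u w + th y) by ring.
    have -> : x * X s w + - y * X u w + (th x - th y) =
      (x * X s w + th x) - (y * X u w + th y) by ring.
    by move: (x * X s w + th x) (y * X u w + th y) => p q; rewrite cosD cosB; field.
  rewrite normrM (ger0_norm (_ : 0 <= 2^-1))// ler_pM2r//.
  apply: le_trans (ler_normD _ _) _; apply: lerD; first exact: cosb.
  by apply: le_trans (cosb _ _ _) _; rewrite /Q !mulrN opprK sqrrN.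
have mQ m y : measurable_fun setT (Q m y).
  by apply: measurable_funM => //; exact: measurable_gauss_affine.
have Q0 m y x : 0 <= Q m y x by rewrite mulr_ge0 ?expR_ge0.
have intQ m y : (\int[mu]_x (Q m y x)%:E =
    (Num.sqrt pi / rho * expR (- (b * y) ^+ 2))%:E)%E.
  under eq_integral do rewrite EFinM.
  rewrite ge0_integralZr//; last first.
    by apply/measurable_EFinP; exact: measurable_gauss_affine.
  by rewrite integral_gauss_affine// -EFinM.
have inner y : (`|\int[P]_w (cos (y * X u w + th y) * h (X s w))|%:E <=
    (2 * (Num.sqrt pi / rho * expR (- (b * y) ^+ 2)))%:E)%E.
  pose Z w := cos (y * X u w + th y).
  have mZ : measurable_fun setT Z.
    apply: measurableT_comp; last by apply: measurable_funD => //; exact: measurable_funM.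
    by apply: continuous_measurable_fun; exact: continuous_cos.
  have ZM w : `|Z w| <= 1 by exact: cos_max.
  have B0 := le_abs_Rintegral_cos_transform P ia mth mZ (mX s) ZM.
  apply: (le_trans B0).
  apply: (@le_trans _ _ (\int[mu]_x (Q (- (c * y)) y x + Q (c * y) y x)%:E)%E).
    apply: ge0_le_integral => //.
    - by apply/measurable_EFinP; exact: measurable_norm_Rintegral_cos mth mZ (mX s) ZM.
    - by apply/measurable_EFinP; apply: measurable_funD; exact: mQ.
    - move=> x _; rewrite lee_fin.
      apply: le_trans (ler_pM _ _ (a2 x) (coscos x y)) _ => //.
      by rewrite mulrC divfK.
  under eq_integral do rewrite EFinD.
  rewrite ge0_integralD//; last 4 first.
  - by move=> x _; rewrite lee_fin.
  - apply/measurable_EFinP; exact: mQ.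
  - by move=> x _; rewrite lee_fin.
  - apply/measurable_EFinP; exact: mQ.
  by rewrite !intQ -EFinD mulr_natl mulr2n.
rewrite -lee_fin -/h.
under eq_Rintegral do rewrite -/h.
have mZ : measurable_fun setT (fun w => h (X s w)) by exact: measurableT_comp.
have hM' w : `|h (X s w)| <= \int[mu]_x `|a x| by exact: hM.
have B0 := le_abs_Rintegral_cos_transform P ia mth mZ (mX u) hM'.
apply: (le_trans B0).
pose K := 2 * (Num.sqrt pi / rho) * M * b `^ (- g) * 2.
have K0 : 0 <= K.
  by rewrite !mulr_ge0 ?powR_ge0// ?invr_ge0 ltW.
apply: (@le_trans _ _ (\int[mu]_y (K * expR (- (b / Num.sqrt 2 * (y - 0)) ^+ 2))%:E)%E).
  apply: ge0_le_integral => //.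
  - by apply/measurable_EFinP; exact: measurable_norm_Rintegral_cos mth mZ (mX u) hM'.
  - apply/measurable_EFinP; apply: measurable_funM => //.
    exact: measurable_gauss_affine.
  - move=> y _; rewrite lee_fin.
    have h1 : `|\int[P]_w (h (X s w) * cos (y * X u w + th y))| <=
        2 * (Num.sqrt pi / rho * expR (- (b * y) ^+ 2)).
      rewrite -lee_fin; have := inner y.
      by under eq_Rintegral do rewrite mulrC.
    apply: le_trans (ler_pM _ _ (aM y) h1) _ => //.
    have h2 := powR_gauss_bound (b * y) g0 g1.
    rewrite normrM powRM// (ger0_norm (ltW b0)) in h2.
    have -> : M * `|y| `^ g * (2 * (Num.sqrt pi / rho * expR (- (b * y) ^+ 2))) =
      2 * (Num.sqrt pi / rho) * M * b `^ (- g) *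
      (b `^ g * `|y| `^ g * expR (- (b * y) ^+ 2)).
      rewrite powRN; field; rewrite !gt_eqF//=.
      by rewrite powR_gt0.
    rewrite /K -[leRHS]mulrA ler_wpM2l//.
      by rewrite !mulr_ge0 ?powR_ge0// ?invr_ge0 ltW.
    apply: (le_trans h2); rewrite subr0.
    have -> : (b / Num.sqrt 2 * y) ^+ 2 = 2^-1 * (b * y) ^+ 2.
      by rewrite mulrAC expr_div_n sqr_sqrtr// mulrC.
    exact: lexx.
under eq_integral do rewrite EFinM.
rewrite ge0_integralZl//; last first.
  by apply/measurable_EFinP; exact: measurable_gauss_affine.
rewrite integral_gauss_affine; last by rewrite divr_gt0// sqrtr_gt0.
rewrite -EFinM lee_fin le_eqVlt; apply/orP; left; apply/eqP.
have bg : b `^ (- g) = sk `^ (- g) * v `^ (- (tau * g)).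
  by rewrite /b powRM ?powR_ge0 ?(ltW sk0)// -powRrM mulrN.
have vE : v `^ (- (tau * (1 + g))) = (v `^ tau)^-1 * v `^ (- (tau * g)).
  rewrite -powRN -powRD; last by rewrite [v == 0]gt_eqF// implybT.
  by congr (_ `^ _); ring.
rewrite /K /C bg -/v vE /rho /b (powRN s) (powRN sk).
have pE : pi = Num.sqrt pi ^+ 2 :> R by rewrite sqr_sqrtr// pi_ge0.
rewrite [in RHS]pE; field.
by rewrite !gt_eqF ?sqrtr_gt0// ?powR_gt0.
Qed.

End kernel_estimate.

(** * Second moments of Riemann sums *)

Section power_sums.
Context (R : realType).
Implicit Types a b q x : R.

Lemma powR_onem_le b x : 0 <= b -> b <= 1 -> 0 <= x -> x <= 1 ->
  (1 - x) `^ b <= 1 - b * x / 2.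
Proof.
move=> b0 b1 x0 x1.
have bx0 : 0 <= b * x by rewrite mulr_ge0.
have bx1 : b * x <= 1 by rewrite mulr_ile1.
have [xe|xe] := eqVneq x 1.
  have [->|bn0] := eqVneq b 0; first by rewrite powRr0 mul0r mul0r subr0.
  by rewrite xe subrr powR0//; lra.
have x1' : 0 < 1 - x by rewrite subr_gt0 lt_neqAle xe.
apply: (@le_trans _ _ (expR (- (b * x)))).
  rewrite /powR gt_eqF// ler_expR -mulrN ler_wpM2l//.
  rewrite -[leRHS]expRK ler_ln ?posrE ?expR_gt0//.
  exact: expR_ge1Dx.
rewrite expRN -[leLHS]mul1r ler_pdivrMr ?expR_gt0//.
apply: (@le_trans _ _ ((1 - b * x / 2) * (1 + b * x))); first by nra.
by rewrite ler_wpM2l ?expR_ge1Dx//; lra.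
Qed.

(** By induction, comparing each term with an increment of [n `^ (1 - a)]: the
    bound of [powR_onem_le] plays the part of the mean value theorem. *)
Lemma sum_powRN_le a n : 0 <= a -> a < 1 ->
  \sum_(i < n) (i.+1%:R : R) `^ (- a) <= 2 / (1 - a) * n%:R `^ (1 - a).
Proof.
move=> a0 a1; have b0 : 0 < 1 - a by rewrite subr_gt0.
elim: n => [|n IH]; first by rewrite big_ord0 mulr_ge0 ?powR_ge0// divr_ge0// ltW.
rewrite big_ord_recr/=.
have n0 : 0 < n.+1%:R :> R by rewrite ltr0n.
have key : (1 - a) / 2 * n.+1%:R `^ (- a) <=
    n.+1%:R `^ (1 - a) - n%:R `^ (1 - a).
  have nE : n%:R = n.+1%:R * (1 - n.+1%:R^-1) :> R.
    by rewrite -natr1; field; rewrite natr1 pnatr_eq0.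
  have i1 : n.+1%:R^-1 <= 1 :> R by rewrite invf_le1// ler1n.
  have i2 : 0 <= 1 - n.+1%:R^-1 :> R by rewrite subr_ge0.
  have -> : n.+1%:R `^ (1 - a) - n%:R `^ (1 - a) =
      n.+1%:R `^ (1 - a) * (1 - (1 - n.+1%:R^-1) `^ (1 - a)) :> R.
    by rewrite nE (powRM _ (ler0n _ n.+1) i2); ring.
  have -> : n.+1%:R `^ (- a) = n.+1%:R `^ (1 - a) * n.+1%:R^-1 :> R.
    rewrite -powR_inv1 ?ler0n// -powRD ?pnatr_eq0 ?implybT//.
    by congr (_ `^ _); ring.
  rewrite mulrCA ler_wpM2l ?powR_ge0//.
  have b1 : 1 - a <= 1 by lra.
  have i0 : 0 <= n.+1%:R^-1 :> R by rewrite invr_ge0.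
  have := powR_onem_le (ltW b0) b1 i0 i1.
  by move: n.+1%:R^-1 => x; move: (_ `^ _) => y; lra.
have key2 := ler_wpM2l (ltW (divr_gt0 (ltr0n _ 2) b0)) key.
have e : 2 / (1 - a) * ((1 - a) / 2 * n.+1%:R `^ (- a)) = n.+1%:R `^ (- a) :> R.
  by field; rewrite gt_eqF.
by rewrite e in key2; lra.
Qed.

(** The terms are dominated by increments of [- b^-1 * n `^ (- b)], [b = q - 1];
    the sum is bounded by 1 plus the telescoping total. *)
Lemma sum_powRN_bounded q n : 1 < q ->
  \sum_(i < n) (i.+1%:R : R) `^ (- q) <= 1 + (q - 1)^-1.
Proof.
move=> q1; pose b := q - 1; have b0 : 0 < b by rewrite subr_gt0.
suff H m : \sum_(i < m.+1) (i.+1%:R : R) `^ (- q) <= 1 + b^-1 * (1 - m.+1%:R `^ (- b)).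
  case: n => [|n]; first by rewrite big_ord0 addr_ge0// invr_ge0 ltW.
  apply: (le_trans (H n)); rewrite lerD2l -[leRHS]mulr1 ler_wpM2l ?invr_ge0 ?(ltW b0)//.
elim: m => [|m IH].
  by rewrite big_ord_recr big_ord0/= !powR1 subrr mulr0 add0r addr0.
rewrite big_ord_recr/=.
have m0 : 0 < m.+1%:R :> R by rewrite ltr0n.
have n0 : 0 < m.+2%:R :> R by rewrite ltr0n.
have key : b * m.+2%:R `^ (- q) <= m.+1%:R `^ (- b) - m.+2%:R `^ (- b).
  have nE : m.+1%:R = m.+2%:R * (1 - m.+2%:R^-1) :> R.
    by rewrite mulrBr mulr1 mulfV ?pnatr_eq0// -[m.+2%:R]natr1 addrK.
  have x1 : 0 < 1 - m.+2%:R^-1 :> R by rewrite subr_gt0 invf_lt1// ltr1n.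
  have -> : m.+1%:R `^ (- b) - m.+2%:R `^ (- b) =
      m.+2%:R `^ (- b) * ((1 - m.+2%:R^-1) `^ (- b) - 1) :> R.
    by rewrite nE (powRM _ (ler0n _ m.+2) (ltW x1)); ring.
  have -> : m.+2%:R `^ (- q) = m.+2%:R `^ (- b) * m.+2%:R^-1 :> R.
    rewrite -powR_inv1 ?ler0n// -powRD ?pnatr_eq0 ?implybT//.
    by congr (_ `^ _); rewrite /b; ring.
  rewrite mulrCA ler_wpM2l ?powR_ge0// lerBrDl.
  apply: le_trans (expR_ge1Dx _) _.
  rewrite /powR gt_eqF// ler_expR mulNr -mulrN ler_wpM2l ?(ltW b0)//.
  rewrite lerNr -[leRHS]expRK ler_ln ?posrE ?expR_gt0//.
  exact: expR_ge1Dx.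
have key2 := ler_wpM2l (ltW (_ : 0 < b^-1)) key.
rewrite mulKf ?gt_eqF// invr_gt0 in key2.
by have := key2 b0; lra.
Qed.

End power_sums.

Section riemann_sums.
Context (R : realType).

(** Right end points are used so that time 0, about which local nondeterminism
    says nothing and where [s `^ (- tau)] is singular, is never sampled. *)
Definition riemann_sum (g : R -> R) (a b : R) (n : nat) : R :=
  (b - a) / n%:R * \sum_(i < n) g (a + i.+1%:R * ((b - a) / n%:R)).

Lemma riemann_sum_powRN_from0 (tau t : R) n : 0 < tau -> tau < 1 -> 0 < t ->
  riemann_sum (fun s => s `^ (- tau)) 0 t n.+1 <= 2 / (1 - tau) * t `^ (1 - tau).
Proof.
move=> t0 t1 tp; rewrite /riemann_sum subr0.
have n0 : 0 < n.+1%:R :> R by rewrite ltr0n.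
pose D := t / n.+1%:R; have D0 : 0 < D by rewrite divr_gt0.
under eq_bigr do rewrite add0r powRM ?ler0n ?(ltW D0)//.
rewrite -mulr_suml -/D mulrCA -[X in _ * (X * _)](@powRr1 _ D) ?(ltW D0)//.
rewrite -powRD; last by rewrite [D == 0]gt_eqF ?implybT.
have -> : t `^ (1 - tau) = n.+1%:R `^ (1 - tau) * D `^ (1 - tau).
  by rewrite -powRM ?ler0n ?(ltW D0)// mulrC divfK// gt_eqF.
rewrite mulrA ler_wpM2r ?powR_ge0//.
exact: sum_powRN_le (ltW t0) t1.
Qed.

Lemma riemann_sum_powRN_away (tau a b : R) n : 0 < tau -> 0 < a -> a < b ->
  riemann_sum (fun s => s `^ (- tau)) a b n.+1 <= (b - a) * a `^ (- tau).
Proof.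
move=> t0 a0 ab; rewrite /riemann_sum.
have n0 : 0 < n.+1%:R :> R by rewrite ltr0n.
pose D := (b - a) / n.+1%:R; have D0 : 0 < D by rewrite divr_gt0// subr_gt0.
have -> : b - a = D * n.+1%:R by rewrite /D divfK// gt_eqF.
rewrite mulfK ?gt_eqF// -mulrA ler_pM2l// mulr_natl.
rewrite -[n.+1 in leRHS]card_ord -sumr_const; apply: ler_sum => i _.
rewrite !powRN lef_pV2 ?posrE ?powR_gt0//; last first.
  by rewrite addr_gt0// mulr_gt0// ltr0n.
rewrite ge0_ler_powR ?nnegrE ?(ltW t0) ?(ltW a0)//.
  by rewrite ltW// addr_gt0// mulr_gt0// ltr0n.
by rewrite lerDl mulr_ge0// ltW.
Qed.

Lemma sum_ord_gt_le (g : nat -> R) (n i : nat) : (forall m, 0 <= g m) ->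
  \sum_(j < n | (i < j)%N) g (j - i.+1)%N <= \sum_(m < n) g m.
Proof.
move=> g0.
rewrite -(big_mkord (fun j => (i < j)%N) (fun j => g (j - i.+1)%N)) -(big_mkord predT g)/=.
have [ni|ni] := leqP n i.+1.
  rewrite big_nat_cond big1 ?sumr_ge0// => j /andP[/andP[_ jn] ij].
  by move: (leq_trans jn ni); rewrite ltnS leqNgt ij.
rewrite (big_cat_nat (n := i.+1))//=; last exact: ltnW.
rewrite big_nat_cond big1 ?add0r; last first.
  by move=> j /andP[/andP[_ ji] ij]; move: ji; rewrite ltnS leqNgt ij.
rewrite -{1}(add0n i.+1) big_addn.
under eq_bigr do rewrite addnK.
rewrite big_mkcond/=.
apply: (@le_trans _ _ (\sum_(0 <= j < n - i.+1) g j)).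
  by apply: ler_sum => j _; case: ifP.
rewrite [leRHS](big_cat_nat (n := (n - i.+1)%N))//= ?leq_subr//.
by rewrite lerDl sumr_ge0.
Qed.

End riemann_sums.

Section second_moment.
Context d (T : measurableType d) (R : realType) (P : probability T R).
Variables (X : R -> {RV P >-> R}) (tau beta K B : R) (h : R -> R).
Hypotheses (beta0 : 0 < beta) (beta1 : beta < 1) (K0 : 0 <= K).
Hypotheses (mh : measurable_fun setT h) (hB : forall y, `|h y| <= B).
Hypothesis kernel : forall s u, 0 < s -> s < u ->
  `|\int[P]_w (h (X s w) * h (X u w))| <= K * (s `^ (- tau) * (u - s) `^ (- beta)).

(** Expand the square into pairs of sampling times.  The [n.+1] diagonal terms are
    only bounded by [B ^+ 2], but their total weight is of order [n.+1%:R^-1];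
    the other pairs are controlled by [kernel], whose singularity in [u - s] is
    summable since [beta < 1]. *)
Lemma riemann_sum_second_moment (a b : R) n : 0 <= a -> a < b ->
  \int[P]_w riemann_sum (fun s => h (X s w)) a b n.+1 ^+ 2 <=
  2 * (b - a) ^+ 2 * B ^+ 2 / n.+1%:R +
  4 / (1 - beta) * K * (b - a) `^ (1 - beta) *
    riemann_sum (fun s => s `^ (- tau)) a b n.+1.
Proof.
move=> a0 ab.
have n0 : 0 < n.+1%:R :> R by rewrite ltr0n.
pose D := (b - a) / n.+1%:R; have D0 : 0 < D by rewrite divr_gt0// subr_gt0.
pose s (i : nat) := a + i.+1%:R * D.
have s0 i : 0 < s i by rewrite ltr_wpDl// mulr_gt0// ltr0n.
have B0 : 0 <= B := le_trans (normr_ge0 _) (hB 0).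
have mhX t : measurable_fun setT (fun w => h (X t w)) by exact: measurableT_comp.
pose q i j := \int[P]_w (h (X (s i) w) * h (X (s j) w)).
have bnd i j w : `|h (X (s i) w) * h (X (s j) w)| <= B ^+ 2.
  by rewrite normrM expr2 ler_pM.
have ihh i j : P.-integrable setT (EFin \o (fun w => h (X (s i) w) * h (X (s j) w))).
  apply: (@integrable_fun_le _ _ _ _ _ _ _ (fun=> B ^+ 2)) => //.
    exact: measurable_funM.
  exact: integrable_cst_prob.
have -> : \int[P]_w riemann_sum (fun s => h (X s w)) a b n.+1 ^+ 2 =
    D ^+ 2 * \sum_(i < n.+1) \sum_(j < n.+1) q i j.
  transitivity (\int[P]_w (D ^+ 2 * \sum_(i < n.+1) \sum_(j < n.+1)
      (h (X (s i) w) * h (X (s j) w)))).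
    apply: eq_Rintegral => w _; rewrite /riemann_sum exprMn; congr (_ * _).
    by rewrite expr2 big_distrlr.
  have ihs i := integrable_fun_sum measurableT (index_enum 'I_n.+1)
    (F := fun j w => h (X (s i) w) * h (X (s (val j)) w)) (fun j => ihh i (val j)).
  rewrite RintegralZl//; last by apply: integrable_fun_sum => // i; exact: ihs.
  congr (_ * _); rewrite Rintegral_fun_sum//.
  apply: eq_bigr => i _; rewrite Rintegral_fun_sum//.
pose f (i j : nat) := if i == j then B ^+ 2 else
  if (i < j)%N then K * (s i `^ (- tau) * (D `^ (- beta) * (j - i.+1).+1%:R `^ (- beta)))
  else 0.
have f0 i j : 0 <= f i j.
  rewrite /f; case: ifP => _; first exact: sqr_ge0.
  by case: ifP => // _; rewrite !mulr_ge0 ?powR_ge0.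
have qlt i j : (i < j)%N -> `|q i j| <= f i j.
  move=> ij; rewrite /f ltn_eqF// ij.
  have sij : s i < s j by rewrite ltrD2l ltr_pM2r// ltr_nat.
  apply: le_trans (kernel (s0 i) sij) _.
  have -> : s j - s i = D * (j - i.+1).+1%:R.
    rewrite /s -subSn// subSS natrB ?(ltnW ij)// -[j.+1%:R]natr1 -[i.+1%:R]natr1; ring.
  by rewrite (powRM _ (ltW D0) (ler0n _ _)).
have qf i j : `|q i j| <= f i j + f j i.
  have [ij|ji|->] := ltngtP i j.
  - by rewrite (le_trans (qlt _ _ ij))// lerDl.
  - rewrite (_ : q i j = q j i) ?(le_trans (qlt _ _ ji)) ?lerDr//.
    by apply: eq_Rintegral => w _; rewrite mulrC.
  - rewrite {1}/f eqxx (@le_trans _ _ (B ^+ 2))//; last by rewrite lerDl.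
    apply: le_trans (le_normr_Rintegral _ _) _ => //.
    rewrite -[leRHS](Rintegral_prob_cst P); apply: le_Rintegral => //.
    + exact: (integrable_fun_abs (ihh j j)).
    + exact: integrable_cst_prob.
have S1 : \sum_(i < n.+1) \sum_(j < n.+1) q i j <=
    2 * \sum_(i < n.+1) \sum_(j < n.+1) f i j.
  apply: (@le_trans _ _ (\sum_(i < n.+1) \sum_(j < n.+1) (f i j + f j i))).
    by apply: ler_sum => i _; apply: ler_sum => j _; exact: le_trans (ler_norm _) _.
  rewrite mulr_natl mulr2n [X in _ <= _ + X]exchange_big -big_split/=.
  by rewrite le_eqVlt; apply/orP; left; apply/eqP; apply: eq_bigr => i _; exact: big_split.
have S2 (i : 'I_n.+1) : \sum_(j < n.+1) f i j <= B ^+ 2 +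
    K * (s i `^ (- tau) * (D `^ (- beta) * (2 / (1 - beta) * n.+1%:R `^ (1 - beta)))).
  rewrite (bigD1 i)//= {1}/f eqxx lerD2l.
  rewrite (bigID (fun j : 'I_n.+1 => (i < j)%N))/= [X in _ + X]big1 ?addr0; last first.
    by move=> j /andP[ji /negbTE ij]; rewrite /f eq_sym (negbTE (ji : val j != val i)) ij.
  rewrite (eq_bigr (fun j : 'I_n.+1 => K * (s i `^ (- tau) * (D `^ (- beta) *
     (j - i.+1).+1%:R `^ (- beta))))); last first.
    by move=> j /andP[ji ij]; rewrite /f eq_sym (negbTE (ji : val j != val i)) ij.
  rewrite -!mulr_sumr; do 3 (rewrite ler_wpM2l ?powR_ge0//).
  apply: le_trans (sum_powRN_le _ (ltW beta0) beta1).
  rewrite (eq_bigl (fun j : 'I_n.+1 => (i < j)%N)); last first.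
    move=> j; case: ltnP => ij; rewrite ?andbF// andbT.
    by apply/eqP => /(congr1 val)/= e; rewrite e ltnn in ij.
  exact: (@sum_ord_gt_le _ (fun m => m.+1%:R `^ (- beta)) n.+1 i (fun=> powR_ge0 _ _)).
have S3 := ler_sum (index_enum 'I_n.+1) (fun i (_ : predT i) => S2 i).
apply: (@le_trans _ _ (D ^+ 2 * (2 * \sum_(i < n.+1) (B ^+ 2 +
    K * (s i `^ (- tau) * (D `^ (- beta) * (2 / (1 - beta) * n.+1%:R `^ (1 - beta)))))))).
  rewrite ler_wpM2l ?sqr_ge0//; apply: (le_trans S1); rewrite ler_wpM2l//.
rewrite big_split/= sumr_const card_ord -mulr_sumr -mulr_suml /riemann_sum -/D.
have -> : \sum_(i < n.+1) (a + i.+1%:R * D) `^ (- tau) =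
   \sum_(i < n.+1) s i `^ (- tau) by [].
move: (\sum_(i < n.+1) _) => S.
have -> : (b - a) `^ (1 - beta) = D * D `^ (- beta) * n.+1%:R `^ (1 - beta).
  rewrite -[X in X * _ * _](@powRr1 _ D) ?(ltW D0)// -powRD; last first.
    by rewrite [D == 0]gt_eqF ?implybT.
  by rewrite -(powRM _ (ltW D0) (ltW n0)) divfK// gt_eqF.
have -> : b - a = D * n.+1%:R by rewrite /D divfK// gt_eqF.
rewrite -mulr_natl le_eqVlt; apply/orP; left; apply/eqP; field.
by rewrite !gt_eqF ?subr_gt0.
Qed.

End second_moment.

(** * Convergence of Riemann sums and of mollifications *)

Section riemann_convergence.
Context (R : realType).
Local Notation mu := (@lebesgue_measure R).

(** The Riemann sum is the integral of a step function converging pointwise to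
    [g]; dominated convergence concludes. *)
Lemma riemann_sum_cvg (g : R -> R) (a b B : R) : a < b ->
  {within `[a, b], continuous g} -> (forall s, `|g s| <= B) ->
  riemann_sum g a b n.+1 @[n --> \oo] --> \int[mu]_(s in `[a, b]) g s.
Proof.
move=> ab cg gB.
have mg : measurable_fun `[a, b] g by exact: subspace_continuous_measurable_fun.
have mg' : measurable_fun `]a, b] g.
  by apply: measurable_funS mg => //; exact: subset_itv_oc_cc.
pose D n := (b - a) / n.+1%:R.
have D0 n : 0 < D n by rewrite divr_gt0 ?subr_gt0// ltr0n.
pose s n (i : nat) := a + i%:R * D n.
have s0 n : s n 0%N = a by rewrite /s mul0r addr0.
have sn n : s n n.+1 = b by rewrite /s /D mulrC divfK ?gt_eqF ?ltr0n// addrC subrK.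
have sS n i : s n i.+1 = s n i + D n by rewrite /s -natr1; ring.
have s_le n i j : (i <= j)%N -> s n i <= s n j.
  by move=> ij; rewrite lerD2l ler_pM2r// ler_nat.
pose I n i : set R := `]s n i, s n i.+1]%classic.
pose phi n (x : R) := \sum_(i < n.+1) g (s n i.+1) * \1_(I n i) x.
have sumI n x : `]a, b]%classic x -> \sum_(i < n.+1) \1_(I n i) x = 1 :> R.
  rewrite /= in_itv/= => /andP[ax xb].
  have E i : \1_(I n i) x = \1_(`]a, s n i.+1]) x - \1_(`]a, s n i]) x :> R.
    rewrite !indicE !mem_setE !in_itv/= ax/=.
    have := s_le n i i.+1 (leqnSn i).
    by case: (leP x (s n i)) => h1; case: (leP x (s n i.+1)) => h2 //= h3;
      rewrite ?subrr ?subr0//; lra.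
  under eq_bigr do rewrite E.
  rewrite -(big_mkord predT (fun i => \1_(`]a, s n i.+1]) x - \1_(`]a, s n i]) x : R)).
  rewrite telescope_sumr// sn s0 !indicE !mem_setE !in_itv/= ax xb/=.
  by rewrite leNgt ax subr0.
have intI n (i : 'I_n.+1) : (\int[mu]_(x in `]a, b]) (\1_(I n i) x)%:E = (D n)%:E)%E.
  rewrite integral_indic//; last exact: measurable_itv.
  rewrite setIidl; last first.
    apply: subset_itv; rewrite bnd_simp.
      by rewrite -(s0 n) s_le.
    by rewrite -(sn n) s_le.
  rewrite [LHS]lebesgue_measure_itv/= lte_fin sS ltrDl D0 -EFinD addrC addKr//.
have iI n (i : 'I_n.+1) : mu.-integrable `]a, b] (EFin \o (fun x => g (s n i.+1) * \1_(I n i) x)).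
  apply: integrable_funZ => //; apply/integrableP; split.
    by apply/measurable_EFinP; apply: measurable_indic; exact: measurable_itv.
  by under eq_integral do rewrite /= ger0_norm//; rewrite intI ltry.
have phiE n : riemann_sum g a b n.+1 = \int[mu]_(x in `]a, b]) phi n x.
  rewrite /phi Rintegral_fun_sum// /riemann_sum mulr_sumr.
  apply: eq_bigr => i _; rewrite RintegralZl//.
    by rewrite /Rintegral intI mulrC.
  apply/integrableP; split.
    by apply/measurable_EFinP; apply: measurable_indic; exact: measurable_itv.
  by under eq_integral do rewrite /= ger0_norm//; rewrite intI ltry.
under eq_fun do rewrite phiE.
have iB : mu.-integrable `]a, b] (EFin \o (fun _ : R => B)).
  apply/integrableP; split; first exact/measurable_EFinP.
  by rewrite /= integral_cst//= lebesgue_measure_itv/= lte_fin ab -EFinD -EFinM ltry.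
have ig : mu.-integrable `]a, b] (EFin \o g).
  by apply: (integrable_fun_le _ _ iB).
rewrite -Rintegral_itv_obnd_cbnd//.
rewrite /Rintegral; apply: fine_cvg; rewrite fineK ?integrable_fin_num//.
have phiB n x : `]a, b]%classic x -> `|phi n x| <= B.
  move=> xI; rewrite /phi (le_trans (ler_norm_sum _ _ _))//.
  rewrite -[B]mulr1 -(sumI n x xI) mulr_sumr; apply: ler_sum => i _.
  by rewrite normrM ler_pM// ger0_norm.
apply: (@dominated_cvg _ _ _ mu _ _ _ _ (EFin \o (fun _ : R => B))) => //.
- move=> n; apply: (measurable_int mu).
  have mab : measurable (`]a, b]%classic : set (measurableTypeR R)) by [].
  by have := integrable_fun_sum mab (index_enum 'I_n.+1) (iI n); apply.
- move=> x xI; apply: cvg_EFin; first exact: nearW.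
  apply/cvgrPdist_le => e e0.
  have xab : x \in `[a, b] by apply: subset_itv_oc_cc.
  have /cvgrPdist_le/(_ e e0) : g y @[y --> within `[a, b]%classic (nbhs x)] --> g x.
    by have := (subspace_continuousP _ _).1 cg x xab.
  rewrite near_withinE => /nbhs_ballP[r /= r0 xr].
  near=> n.
  have Dr : D n < r.
    rewrite /D ltr_pdivrMr ?ltr0n// mulrC -ltr_pdivrMr//.
    apply: (@lt_le_trans _ _ n%:R); last by rewrite ler_nat.
    near: n; exact: nbhs_infty_gtr.
  have -> : g x - phi n x = \sum_(i < n.+1) (g x - g (s n i.+1)) * \1_(I n i) x.
    under [RHS]eq_bigr do rewrite mulrBl.
    by rewrite sumrB -mulr_sumr sumI// mulr1.
  rewrite (le_trans (ler_norm_sum _ _ _))// -[e]mulr1 -(sumI n x xI) mulr_sumr.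
  apply: ler_sum => i _; rewrite normrM [X in _ * X <= _]ger0_norm//.
  rewrite indicE; case: (boolP (x \in I n i)) => [|_]; last by rewrite !mulr0.
  rewrite /I mem_setE in_itv/= => /andP[sx xs]; rewrite !mulr1.
  apply: xr => /=.
    rewrite /ball/= distrC ger0_norm ?subr_ge0//.
    apply: lt_trans Dr; rewrite sS; lra.
  rewrite in_itv/= -{1}(s0 n) s_le//= -(sn n) s_le//.
Unshelve. all: end_near. Qed.

End riemann_convergence.

Section approximate_identity.
Context (R : realType).
Local Notation mu := (@lebesgue_measure R).

Lemma normal_peak_leV (r : R) : 0 < r -> normal_peak r <= r^-1.
Proof.
move=> r0; rewrite /normal_peak lef_pV2 ?posrE//; last first.
  by rewrite sqrtr_gt0 mulrn_wgt0// mulr_gt0 ?pi_gt0// exprn_gt0.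
rewrite -[leLHS](ger0_norm (ltW r0)) -sqrtr_sqr ler_sqrt//; last first.
  by rewrite mulrn_wge0// mulr_ge0 ?pi_ge0// sqr_ge0.
rewrite -mulrnAr ler_peMr ?sqr_ge0// -mulr_natr.
by have := @pi_ge2 R; lra.
Qed.

Lemma normal_pdf_tail_bound (y r z : R) : 0 < r -> 0 < `|z - y| ->
  normal_pdf y r z <= 2 * r / (z - y) ^+ 2.
Proof.
move=> r0 zy; have zy2 : 0 < (z - y) ^+ 2 by rewrite exprn_even_gt0//= -normr_gt0.
rewrite normal_pdfE ?gt_eqF//.
have pr := normal_peak_leV r0.
pose u := (z - y) ^+ 2 / (r ^+ 2 *+ 2).
have u0 : 0 < u by rewrite divr_gt0// mulrn_wgt0// exprn_gt0.
have eu : normal_fun y r z <= u^-1.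
  rewrite /normal_fun mulNr -/u expRN lef_pV2 ?posrE ?expR_gt0//.
  by apply: le_trans (expR_ge1Dx u); rewrite lerDr.
apply: (@le_trans _ _ (r^-1 * u^-1)).
  by rewrite ler_pM ?normal_peak_ge0 ?normal_fun_ge0.
rewrite le_eqVlt; apply/orP; left; apply/eqP; rewrite /u -mulr_natr; field.
by rewrite -normr_gt0 zy gt_eqF.
Qed.

(** Far from [y] the density is at most of order [r], so the mass of [l] suffices
    there, whereas the constant [l y] is controlled by the variance [r ^+ 2]. *)
Lemma approximate_identity (l : R -> R) (y : R) :
  continuous l -> (forall z, 0 <= l z) -> mu.-integrable setT (EFin \o l) ->
  \int[mu]_z (normal_pdf y n.+1%:R^-1 z * l z) @[n --> \oo] --> l y.
Proof.
move=> cl l0 il.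
have ml : measurable_fun setT l by exact: continuous_measurable_fun.
have bound (e : R) : 0 < e -> exists2 K : R, 0 <= K &
    forall r, 0 < r -> r <= 1 ->
    `|l y - \int[mu]_z (normal_pdf y r z * l z)| <= e + K * r.
  move=> e0.
  have /cvgrPdist_le/(_ e e0)/nbhs_ballP[dl /= dl0 hd] := cl y.
  pose S := \int[mu]_z l z.
  have S0 : 0 <= S by exact: Rintegral_ge0.
  exists (2 / dl ^+ 2 * S + l y / dl ^+ 2).
    by rewrite addr_ge0 ?mulr_ge0// ?invr_ge0 sqr_ge0.
  move=> r r0 r1; have rn : r != 0 by rewrite gt_eqF.
  have ip : mu.-integrable setT (EFin \o normal_pdf y r) := integrable_normal_pdf y r.
  have mp := measurable_normal_pdf y r.
  have ipl : mu.-integrable setT (EFin \o (fun z => normal_pdf y r z * l z)).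
    apply: (@integrable_funM_bounded _ _ _ _ _ _ _ _ (normal_peak r)) => //.
    by move=> z _; rewrite ger0_norm ?normal_pdf_ge0// normal_pdf_ub.
  have -> : l y - \int[mu]_z (normal_pdf y r z * l z) =
      \int[mu]_z (l y * normal_pdf y r z - normal_pdf y r z * l z).
    rewrite RintegralB//; last exact: integrable_funZ.
    by rewrite RintegralZl// Rintegral_normal_pdf mulr1.
  have i1 : mu.-integrable setT
      (EFin \o (fun z => l y * normal_pdf y r z - normal_pdf y r z * l z)).
    by apply: integrable_funB => //; exact: integrable_funZ.
  have iv : mu.-integrable setT (EFin \o (fun z => (z - y) ^+ 2 * normal_pdf y r z)).
    apply: (@integrable_normal_moment _ y r rn _ 1) => [|z].
      by apply: measurable_funX; apply: measurable_funB => //; exact: measurable_id.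
    by rewrite mul1r ger0_norm ?sqr_ge0// lerDr.
  have j1 := integrable_funZ measurableT e ip.
  have j2 := integrable_funZ measurableT (2 * r / dl ^+ 2) il.
  have j3 := integrable_funZ measurableT (l y / dl ^+ 2) iv.
  apply: (@le_trans _ _ (\int[mu]_z (e * normal_pdf y r z + 2 * r / dl ^+ 2 * l z +
     l y / dl ^+ 2 * ((z - y) ^+ 2 * normal_pdf y r z)))).
    apply: le_trans (le_normr_Rintegral _ i1) _ => //.
    apply: le_Rintegral => //.
    - exact: (integrable_fun_abs i1).
    - by apply: integrable_funD => //; exact: integrable_funD.
    move=> z _; have p0 := normal_pdf_ge0 y r z.
    have -> : l y * normal_pdf y r z - normal_pdf y r z * l z =
      normal_pdf y r z * (l y - l z) by ring.
    rewrite normrM (ger0_norm p0).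
    have dl2 : 0 < dl ^+ 2 by rewrite exprn_gt0.
    have a1 : 0 <= 2 * r / dl ^+ 2 * l z.
      by rewrite mulr_ge0// divr_ge0 ?(ltW dl2)// mulr_ge0// ltW.
    have a2 : 0 <= l y / dl ^+ 2 * ((z - y) ^+ 2 * normal_pdf y r z).
      exact: mulr_ge0 (divr_ge0 (l0 y) (sqr_ge0 dl)) (mulr_ge0 (sqr_ge0 _) p0).
    have a3 : 0 <= e * normal_pdf y r z by rewrite mulr_ge0// ltW.
    have [zd|zd] := ltP `|y - z| dl.
      apply: (@le_trans _ _ (e * normal_pdf y r z)).
        by rewrite mulrC ler_wpM2r//; exact: hd.
      by rewrite -addrA lerDl addr_ge0.
    have zy0 : 0 < `|z - y| by rewrite distrC (lt_le_trans dl0).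
    have d2 : dl ^+ 2 <= (z - y) ^+ 2.
      by rewrite -[leRHS]real_normK ?num_real// distrC lerXn2r// nnegrE ltW.
    apply: (@le_trans _ _ (normal_pdf y r z * l z + l y * normal_pdf y r z)).
      rewrite (mulrC (l y)) -mulrDr ler_wpM2l//.
      by rewrite (le_trans (ler_normB _ _))// !ger0_norm// addrC.
    apply: lerD.
      apply: (@le_trans _ _ (2 * r / dl ^+ 2 * l z)); last first.
        by rewrite lerDr.
      rewrite ler_wpM2r//; apply: le_trans (normal_pdf_tail_bound r0 zy0) _.
      rewrite ler_wpM2l//; first by rewrite mulr_ge0// ltW.
      by rewrite lef_pV2 ?posrE// (lt_le_trans dl2).
    rewrite -mulrA ler_wpM2l// mulrA ler_peMl//.
    by rewrite mulrC ler_pdivlMr// mul1r.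
  rewrite RintegralD//; last exact: integrable_funD.
  rewrite RintegralD// !RintegralZl// Rintegral_normal_pdf.
  rewrite Rintegral_normal_square_deviation// mulr1 -/S.
  have h : l y / dl ^+ 2 * r ^+ 2 <= l y / dl ^+ 2 * r.
    rewrite ler_wpM2l//; first by rewrite divr_ge0 ?sqr_ge0.
    by rewrite expr2 ler_piMl// ltW.
  have -> : 2 * r / dl ^+ 2 * S = 2 / dl ^+ 2 * S * r by field; rewrite gt_eqF.
  by rewrite [(_ + _) * r]mulrDl -addrA !lerD2l.
apply/cvgrPdist_le => e e0.
have [K K0 hK] := bound (e / 2) (divr_gt0 e0 (ltr0n _ 2)).
near=> n.
have r0 : 0 < n.+1%:R^-1 :> R by rewrite invr_gt0.
have r1 : n.+1%:R^-1 <= 1 :> R by rewrite invf_le1// ler1n.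
apply: (le_trans (hK _ r0 r1)); rewrite [leRHS](splitr e) lerD2l.
rewrite ler_pdivrMr ?ltr0n// mulrC -ler_pdivrMr ?divr_gt0//.
apply: (@le_trans _ _ n%:R); last by rewrite ler_nat.
near: n; exact: nbhs_infty_ger.
Unshelve. all: end_near. Qed.

End approximate_identity.

(** * Occupation densities of a path *)

Section paths.
Context (R : realType).
Local Notation mu := (@lebesgue_measure R).
Variables (x : R -> R) (l : R -> R -> R).

(** What almost every path satisfies: [x] is continuous and [l] is a jointly
    continuous density of its occupation measure.  The three deterministic
    requirements are stated for one path so that null sets are discarded once
    and for all. *)
Definition occupied_path : Prop :=
  [/\ {within `[0, +oo[, continuous x},
   (forall t, 0 <= t -> (forall y, 0 <= l y t) /\
     forall A : set R, measurable A ->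
      (\int[mu]_(s in `[0%R, t]) (\1_A (x s))%:E = \int[mu]_(y in A) (l y t)%:E)%E) &
   {within [set p : R * R | 0 <= p.2], continuous (fun p : R * R => l p.1 p.2)}].

Hypothesis xl : occupied_path.

Lemma occupied_path_ge0 t y : 0 <= t -> 0 <= l y t.
Proof. by case: xl => _ h _ /h[]. Qed.

Lemma occupied_path_continuous t : 0 <= t -> continuous (l ^~ t).
Proof.
case: xl => _ _ cl t0 y.
have /cvgrPdist_le cy := (subspace_continuousP _ _).1 cl (y, t) t0.
apply/cvgrPdist_le => e /cy; rewrite near_withinE => -[[U V] /= [Uy Vt] h].
by apply: filterS Uy => z Uz; apply: (h (z, t)) => //; split => //; exact: nbhs_singleton.
Qed.

Lemma measurable_occupied_path (t : R) : measurable_fun `[0, t] x.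
Proof.
case: xl => cx _ _; apply: subspace_continuous_measurable_fun => //.
by apply: continuous_subspaceW cx; apply: subset_itvl.
Qed.

Lemma measurable_density t : 0 <= t -> measurable_fun setT (l ^~ t).
Proof. move=> t0; apply: continuous_measurable_fun; exact: occupied_path_continuous. Qed.

Lemma occupation_formula (g : R -> R) t : 0 <= t -> measurable_fun setT g ->
  (forall y, 0 <= g y) ->
  (\int[mu]_(s in `[0%R, t]) (g (x s))%:E = \int[mu]_y (g y * l y t)%:E)%E.
Proof.
move=> t0 mg g0; case: xl => _ h _; have [l0 hl] := h t t0.
exact: (@ge0_integral_density _ _ _ (measurableTypeR R) R mu mu `[0, t]%classic
   (measurable_itv _) x (@measurable_occupied_path t) (l ^~ t)
   (measurable_density t0) l0 hl g mg g0).
Qed.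

Lemma integrable_density t : 0 <= t -> mu.-integrable setT (EFin \o (l ^~ t)).
Proof.
move=> t0; apply/integrableP; split.
  by apply/measurable_EFinP; exact: measurable_density.
under eq_integral do rewrite /= ger0_norm ?occupied_path_ge0// -[l _ _]mul1r.
rewrite -(occupation_formula t0 (measurable_cst (1 : R)))//.
by rewrite /= integral_cst//= mul1e lebesgue_measure_itv/=; case: ifP; rewrite ?ltry// -EFinD ltry.
Qed.

Lemma continuous_path_comp (g : R -> R) (a b : R) : 0 <= a -> continuous g ->
  {within `[a, b], continuous (fun s => g (x s))}.
Proof.
case: xl => cx _ _ a0 cg.
have cx' : {within `[a, b], continuous x}.
  apply: continuous_subspaceW cx => s /=.
  by rewrite !in_itv/= andbT => /andP[/(le_trans a0)].
by move=> s; apply: continuous_comp; [exact: cx'|exact: cg].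
Qed.

Section mollified.
Variables (y r : R).
Hypothesis r0 : r != 0.

Lemma Rintegral_mollified t : 0 <= t ->
  \int[mu]_(s in `[0, t]) normal_pdf y r (x s) =
  \int[mu]_z (normal_pdf y r z * l z t).
Proof.
move=> t0; rewrite /Rintegral occupation_formula//.
- exact: measurable_normal_pdf.
- by move=> z; exact: normal_pdf_ge0.
Qed.

Lemma integrable_mollified (a b : R) : 0 <= a ->
  mu.-integrable `[a, b] (EFin \o (fun s => normal_pdf y r (x s))).
Proof.
move=> a0; apply: continuous_compact_integrable; first exact: segment_compact.
by apply: continuous_path_comp => //; exact: continuous_normal_pdf.
Qed.

Lemma riemann_sum_mollified_cvg (a b : R) : 0 <= a -> a < b ->
  riemann_sum (fun s => normal_pdf y r (x s)) a b n.+1 @[n --> \oo] -->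
  \int[mu]_z (normal_pdf y r z * l z b) - \int[mu]_z (normal_pdf y r z * l z a).
Proof.
move=> a0 ab; have b0 : 0 <= b by rewrite (le_trans a0)// ltW.
have -> : \int[mu]_z (normal_pdf y r z * l z b) -
    \int[mu]_z (normal_pdf y r z * l z a) =
    \int[mu]_(s in `[a, b]) normal_pdf y r (x s).
  rewrite -!Rintegral_mollified// Rintegral_itvB.
  - rewrite Rintegral_itv_obnd_cbnd//.
    apply: integrableS (integrable_mollified b a0) => //.
    exact: subset_itv_oc_cc.
  - exact: integrable_mollified.
  - by rewrite bnd_simp.
  - by rewrite bnd_simp ltW.
apply: (@riemann_sum_cvg _ _ _ _ (normal_peak r)) => //.
  by apply: continuous_path_comp => //; exact: continuous_normal_pdf.
by move=> s; rewrite ger0_norm ?normal_pdf_ge0// normal_pdf_ub.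
Qed.

End mollified.

(** Occupation measures grow with time; mollifying at [y] carries this over to the
    continuous version of their densities, at every point [y]. *)
Lemma density_nondecreasing y a b : 0 <= a -> a <= b -> l y a <= l y b.
Proof.
move=> a0 ab; have b0 : 0 <= b by exact: le_trans ab.
have Ha := @approximate_identity _ _ y (occupied_path_continuous a0)
  (fun z => occupied_path_ge0 z a0) (integrable_density a0).
have Hb := @approximate_identity _ _ y (occupied_path_continuous b0)
  (fun z => occupied_path_ge0 z b0) (integrable_density b0).
apply: (ler_cvg_to Ha Hb); apply: nearW => n.
have rn : n.+1%:R^-1 != 0 :> R by rewrite invr_eq0 pnatr_eq0.
rewrite -!Rintegral_mollified// /Rintegral fine_le//.
- by apply: integrable_fin_num => //; exact: integrable_mollified.
- by apply: integrable_fin_num => //; exact: integrable_mollified.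
apply: ge0_subset_integral => //.
- have /integrableP[] := @integrable_mollified y _ rn 0 b (lexx _).
  by [].
- by move=> s _; rewrite lee_fin normal_pdf_ge0.
- by apply: subset_itvl; rewrite bnd_simp.
Qed.

End paths.

(** * Spectral representation of the mollifiers *)

Section mollifier_fourier.
Context (R : realType) (r : R).
Hypothesis r0 : 0 < r.
Local Notation mu := (@lebesgue_measure R).

(** The Fourier transform of the normal density of standard deviation [r] is
    [expR (- (r * xi) ^+ 2 / 2)], written here, up to the factor [(2 * pi)^-1], as
    a normal density in [xi] so that the moment formulas for normal laws apply. *)
Definition mollifier_transform (xi : R) : R := normal_peak r * normal_pdf 0 r^-1 xi.
Local Notation w := mollifier_transform.

Lemma mollifier_transform_ge0 xi : 0 <= w xi.
Proof. by rewrite mulr_ge0 ?normal_peak_ge0 ?normal_pdf_ge0. Qed.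

Lemma mollifier_transform_le1 xi : w xi <= 1.
Proof.
have rV : 0 < r^-1 by rewrite invr_gt0.
apply: (@le_trans _ _ (r^-1 * r)); last by rewrite mulVf ?gt_eqF.
rewrite ler_pM ?normal_peak_ge0 ?normal_pdf_ge0 ?normal_peak_leV//.
apply: le_trans (normal_pdf_ub _ _ _) _; first by rewrite gt_eqF.
by rewrite -[leRHS]invrK normal_peak_leV.
Qed.

Lemma integrable_mollifier_transform : mu.-integrable setT (EFin \o w).
Proof. by apply: integrable_funZ => //; exact: integrable_normal_pdf. Qed.

Lemma normal_pdf_cos_transform x z :
  normal_pdf x r z = cos_transform w (fun xi => - (xi * x)) z.
Proof.
have rV : r^-1 != 0 by rewrite invr_eq0 gt_eqF.
have H := Rintegral_normal_cos 0 rV (z - x) 0.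
rewrite mulr0 add0r cos0 mul1r in H.
rewrite normal_pdfE ?gt_eqF// /normal_fun.
have -> : - (z - x) ^+ 2 / (r ^+ 2 *+ 2) = - (r^-1 ^+ 2 * (z - x) ^+ 2 / 2).
  by rewrite -mulr_natr; field; rewrite gt_eqF.
rewrite -H /cos_transform -RintegralZl//.
  apply: eq_Rintegral => xi _; rewrite /w addr0 -mulrA; congr (_ * _).
  by rewrite mulrC; congr (_ * cos _); ring.
apply: (@integrable_funM_bounded _ _ _ _ _ _ _ _ 1) => //.
- apply: measurableT_comp; last by apply: measurable_funD => //; exact: measurable_funM.
  by apply: continuous_measurable_fun; exact: continuous_cos.
- by move=> xi _; exact: cos_max.
- exact: integrable_normal_pdf.
Qed.

(** [cos p - cos q] is [- 2 * sin ((p + q) / 2) * sin ((p - q) / 2)]: the spectral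
    weight acquires the factor [sin (xi * x / 2)], small when [x] is, and the other
    sine is turned into a cosine by the phase [- pi / 2]. *)
Lemma normal_pdf_diff_cos_transform x z :
  normal_pdf x r z - normal_pdf 0 r z =
  cos_transform (fun xi => 2 * w xi * sin (xi * x / 2))
    (fun xi => - (xi * x / 2) - pi / 2) z.
Proof.
have mth (c : R) : measurable_fun setT (fun xi : R => - (xi * c)).
  by apply: measurableT_comp => //; exact: measurable_funM.
rewrite !normal_pdf_cos_transform /cos_transform -RintegralB//; last 2 first.
- exact: (integrable_cos_transform integrable_mollifier_transform (mth x)).
- exact: (integrable_cos_transform integrable_mollifier_transform (mth 0)).
apply: eq_Rintegral => xi _.
rewrite -mulrBr (mulrC 2) -!mulrA; congr (_ * _).
have -> : xi * z + (- (xi * (x / 2)) - pi / 2) = (xi * z - xi * (x / 2)) - pi / 2.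
  by ring.
have cq q : cos (q - pi / 2) = sin q.
  by rewrite cosB cos_pihalf sin_pihalf mulr0 mulr1 add0r.
rewrite cq.
have -> : xi * z - xi * x = (xi * z - xi * (x / 2)) - xi * (x / 2) by field.
have -> : xi * z - xi * 0 = (xi * z - xi * (x / 2)) + xi * (x / 2) by ring.
set p := xi * z - xi * (x / 2); set q := xi * (x / 2).
by clearbody p q; rewrite cosB cosD; ring.
Qed.

Lemma sin_le_powR (y g : R) : 0 <= g -> g <= 1 -> `|sin y| <= `|y| `^ g.
Proof.
move=> g0 g1; have [y1|y1] := leP `|y| 1; last first.
  rewrite (le_trans (sin_max _))//.
  have : 1 `^ g <= `|y| `^ g by rewrite ge0_ler_powR ?nnegrE// ltW.
  by rewrite powR1.
have [->|y0] := eqVneq y 0; first by rewrite sin0 normr0 powR_ge0.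
apply: (@le_trans _ _ `|y|); last first.
  by rewrite ger1_powR// y1 normr_gt0 y0.
have := cos_lipschitz (y - pi / 2) (- (pi / 2)).
rewrite cosB cosN cos_pihalf sin_pihalf mulr0 mulr1 add0r subr0.
by rewrite opprK subrK.
Qed.

End mollifier_fourier.

Section moments.
Context d (T : measurableType d) (R : realType) (P : probability T R).
Variables (tau : R) (X : R -> {RV P >-> R}).
Hypotheses (tau0 : 0 < tau) (tau1 : tau < 1) (lnd : locally_nondeterministic tau X).
Local Notation mu := (@lebesgue_measure R).

(** The spectral weight of the difference of the two mollifiers is at most
    [2 * `|x| `^ g * `|xi| `^ g] by [sin_le_powR]; the correlation kernel is then
    integrable in time because [tau * (1 + g) < 1].  The bound is uniform in the
    width [r] up to a term that vanishes with the mesh. *)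
Lemma mollified_difference_moment (g : R) : 0 <= g -> g <= 1 -> tau * (1 + g) < 1 ->
  exists2 C : R, 0 <= C & forall x r t n, 0 < r -> 0 < t ->
    \int[P]_w riemann_sum (fun s => normal_pdf x r (X s w) - normal_pdf 0 r (X s w))
      0 t n.+1 ^+ 2 <=
    2 * t ^+ 2 * (2 * normal_peak r) ^+ 2 / n.+1%:R +
    C * `|x| `^ g * t `^ (2 - 2 * tau - tau * g).
Proof.
move=> g0 g1 tg; have [C C0 HC] := cos_transform_kernel lnd g0 g1.
pose beta := tau * (1 + g).
have beta0 : 0 < beta by rewrite mulr_gt0// ltr_pwDl.
exists (4 / (1 - beta) * (C * 2) * (2 / (1 - tau))).
  by rewrite !mulr_ge0 ?invr_ge0 ?subr_ge0 ?(ltW C0) ?(ltW tau1) ?(ltW tg).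
move=> x r t n r0 t0.
pose h z := normal_pdf x r z - normal_pdf 0 r z.
have rn : r != 0 by rewrite gt_eqF.
have mh : measurable_fun setT h by apply: measurable_funB; exact: measurable_normal_pdf.
have hB y : `|h y| <= 2 * normal_peak r.
  rewrite (le_trans (ler_normB _ _))// !ger0_norm ?normal_pdf_ge0// mulr_natl mulr2n.
  by rewrite lerD// normal_pdf_ub.
have K0 : 0 <= C * (2 * `|x| `^ g) by rewrite !mulr_ge0 ?powR_ge0// ltW.
have M0 : 0 <= 2 * `|x| `^ g by rewrite mulr_ge0// powR_ge0.
pose a xi := 2 * mollifier_transform r xi * sin (xi * x / 2).
pose th xi : R := - (xi * x / 2) - pi / 2.
have hE z : h z = cos_transform a th z by exact: normal_pdf_diff_cos_transform.
have msin : measurable_fun setT (fun xi : R => sin (xi * x / 2)).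
  apply: measurableT_comp; last by do 2 apply: measurable_funM => //.
  by apply: continuous_measurable_fun; exact: continuous_sin.
have ia : mu.-integrable setT (EFin \o a).
  have h1 : mu.-integrable setT
      (EFin \o (fun xi => 2 * sin (xi * x / 2) * mollifier_transform r xi)).
    apply: (@integrable_funM_bounded _ _ _ _ _ _ _ _ 2) => //.
    - exact: measurable_funM.
    - by move=> xi _; rewrite normrM ger0_norm// -[leRHS]mulr1 ler_wpM2l// sin_max.
    - exact: integrable_mollifier_transform.
  by move: h1; apply: eq_integrable => // xi _ /=; rewrite /a mulrAC.
have mth : measurable_fun setT th.
  apply: measurable_funB => //; apply: measurableT_comp => //.
  by do 2 apply: measurable_funM => //.
have w1 xi : `|mollifier_transform r xi| <= 1.
  by rewrite ger0_norm ?mollifier_transform_ge0// mollifier_transform_le1.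
have a2 xi : `|a xi| <= 2.
  rewrite /a -mulrA normrM (normrM (mollifier_transform r xi)) ger0_norm//.
  by rewrite -[leRHS]mulr1 ler_wpM2l// mulr_ile1// sin_max.
have aM xi : `|a xi| <= 2 * `|x| `^ g * `|xi| `^ g.
  rewrite /a -mulrA normrM (normrM (mollifier_transform r xi)).
  rewrite (ger0_norm (ler0n _ 2)) -[leRHS]mulrA ler_wpM2l//.
  rewrite -[leRHS]mul1r ler_pM//.
  apply: le_trans (sin_le_powR _ g0 g1) _.
  rewrite -powRM// ge0_ler_powR ?nnegrE ?mulr_ge0//.
  rewrite !normrM [leRHS]mulrC ler_piMr ?mulr_ge0// normfV ger0_norm//.
  by rewrite invf_le1// ler1n.
have kernel s u : 0 < s -> s < u -> `|\int[P]_w (h (X s w) * h (X u w))| <=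
    C * (2 * `|x| `^ g) * (s `^ (- tau) * (u - s) `^ (- beta)).
  move=> s0 su; under eq_Rintegral do rewrite !hE.
  exact: HC.
have := riemann_sum_second_moment beta0 tg K0 mh hB kernel n (lexx _) t0.
rewrite subr0 => /le_trans; apply; rewrite lerD2l.
have Q0 : 0 <= 4 / (1 - beta) * (C * (2 * `|x| `^ g)) * t `^ (1 - beta).
  by rewrite !mulr_ge0 ?powR_ge0// ?invr_ge0 ?subr_ge0 ?(ltW tg) ?(ltW C0).
apply: le_trans (ler_wpM2l Q0 (riemann_sum_powRN_from0 n tau0 tau1 t0)) _.
have -> : t `^ (2 - 2 * tau - tau * g) = t `^ (1 - beta) * t `^ (1 - tau).
  rewrite -powRD; last by rewrite [t == 0]gt_eqF ?implybT.
  by congr (_ `^ _); rewrite /beta; ring.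
by rewrite le_eqVlt; apply/orP; left; apply/eqP; ring.
Qed.

(** The same estimate with [g = 0], over an interval bounded away from 0, where
    [s `^ (- tau)] is at most [a `^ (- tau)]. *)
Lemma mollified_increment_moment :
  exists2 C : R, 0 <= C & forall r a b n, 0 < r -> 0 < a -> a < b ->
    \int[P]_w riemann_sum (fun s => normal_pdf 0 r (X s w)) a b n.+1 ^+ 2 <=
    2 * (b - a) ^+ 2 * normal_peak r ^+ 2 / n.+1%:R +
    C * ((b - a) `^ (2 - tau) * a `^ (- tau)).
Proof.
have [C C0 HC] := cos_transform_kernel lnd (lexx 0) ler01.
exists (4 / (1 - tau) * C).
  by rewrite !mulr_ge0 ?invr_ge0 ?subr_ge0 ?(ltW C0) ?(ltW tau1).
move=> r a b n r0 a0 ab.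
have rn : r != 0 by rewrite gt_eqF.
pose h z := normal_pdf 0 r z.
have mh : measurable_fun setT h by exact: measurable_normal_pdf.
have hB y : `|h y| <= normal_peak r by rewrite ger0_norm ?normal_pdf_ge0// normal_pdf_ub.
pose w := mollifier_transform r; pose th xi : R := - (xi * 0).
have hE z : h z = cos_transform w th z by exact: normal_pdf_cos_transform.
have mth : measurable_fun setT th.
  by apply: measurableT_comp => //; exact: measurable_funM.
have w1 xi : `|w xi| <= 1.
  by rewrite ger0_norm ?mollifier_transform_ge0// mollifier_transform_le1.
have w2 xi : `|w xi| <= 2 by rewrite (le_trans (w1 xi))// ler1n.
have wM xi : `|w xi| <= 1 * `|xi| `^ 0 by rewrite powRr0 mulr1.
have kernel s u : 0 < s -> s < u -> `|\int[P]_w (h (X s w) * h (X u w))| <=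
    C * (s `^ (- tau) * (u - s) `^ (- tau)).
  move=> s0 su; under eq_Rintegral do rewrite !hE.
  have := HC _ _ _ ler01 (integrable_mollifier_transform r) mth w2 wM s u s0 su.
  by rewrite addr0 !mulr1.
have := riemann_sum_second_moment tau0 tau1 (ltW C0) mh hB kernel n (ltW a0) ab.
move=> /le_trans; apply; rewrite lerD2l.
have ab0 : 0 < b - a by rewrite subr_gt0.
have Q0 : 0 <= 4 / (1 - tau) * C * (b - a) `^ (1 - tau).
  by rewrite !mulr_ge0 ?powR_ge0 ?invr_ge0 ?subr_ge0 ?(ltW C0) ?(ltW tau1).
apply: le_trans (ler_wpM2l Q0 (riemann_sum_powRN_away n tau0 a0 ab)) _.
have -> : (b - a) `^ (2 - tau) = (b - a) `^ (1 - tau) * (b - a).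
  rewrite -[X in _ = _ * X](powRr1 (ltW ab0)) -powRD; last first.
    by rewrite [b - a == 0]gt_eqF ?implybT.
  by congr (_ `^ _); ring.
by rewrite le_eqVlt; apply/orP; left; apply/eqP; ring.
Qed.

End moments.

(** * Passing second moments to the limit *)

Section limn_einf_lemmas.
Local Open Scope ereal_scope.
Context (R : realType).
Implicit Types u v : nat -> \bar R.

Lemma le_limn_einf u v : (forall n, u n <= v n) -> limn_einf u <= limn_einf v.
Proof.
move=> uv; rewrite !limn_einf_lim; apply: lee_lim; [exact: is_cvg_einfs..|].
apply: nearW => n; apply: le_ereal_inf_tmp => _ [k /= nk <-].
by apply: le_trans (uv k); apply: ereal_inf_lbound; exists k.
Qed.

Lemma limn_einf_ge0 u : (forall n, 0 <= u n) -> 0 <= limn_einf u.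
Proof.
move=> u0; apply: le_trans (le_limn_einf u0).
by rewrite (cvg_limn_einf_sup (cvg_cst (0 : \bar R))).1.
Qed.

Lemma measurable_limn_einf d (T : measurableType d) (f : nat -> T -> \bar R) :
  (forall n, measurable_fun setT (f n)) ->
  measurable_fun setT (fun x => limn_einf (f ^~ x)).
Proof.
move=> mf; rewrite /limn_einf.
apply: measurableT_comp => //.
apply: (measurable_fun_limn_esup (f := fun n x => - f n x)) => n.
exact: measurableT_comp.
Qed.

End limn_einf_lemmas.

Section double_fatou.
Context d (T : measurableType d) d' (S : measurableType d') (R : realType).
Variables (P : probability T R) (nu : {sigma_finite_measure set S -> \bar R}).
Variables (v : nat -> nat -> S -> T -> R) (f : S -> R).
Variables (c Bd : nat -> R) (b : S -> R).
Hypotheses (mv : forall m n, measurable_fun setT (fun z : S * T => v m n z.1 z.2))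
  (vB : forall m n x w, `|v m n x w| <= Bd m)
  (f0 : forall x, 0 <= f x)
  (fi : nu.-integrable setT (EFin \o f))
  (fbi : nu.-integrable setT (EFin \o (fun x => f x * b x)))
  (moment : forall m n x, \int[P]_w v m n x w ^+ 2 <= c m / n.+1%:R + b x).

Let mf : measurable_fun setT f.
Proof. by case/integrableP : fi => /measurable_EFinP. Qed.

Let q m n (w : T) : \bar R := (\int[nu]_x (f x * v m n x w ^+ 2)%:E)%E.

Let mfv m n : measurable_fun setT (fun z : S * T => (f z.1 * v m n z.1 z.2 ^+ 2)%:E).
Proof.
apply/measurable_EFinP; apply: measurable_funM; first exact: measurableT_comp.
exact: measurable_funX.
Qed.

Let mq m n : measurable_fun setT (q m n).
Proof.
apply: (measurable_fun_fubini_tonelli_G (m1 := nu)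
  (fun z : S * T => (f z.1 * v m n z.1 z.2 ^+ 2)%:E)) => // z.
by rewrite lee_fin mulr_ge0// sqr_ge0.
Qed.

Let q0 m n w : (0 <= q m n w)%E.
Proof. by apply: integral_ge0 => x _; rewrite lee_fin mulr_ge0// sqr_ge0. Qed.

(** The index [n] stands for the mesh of a Riemann sum and [m] for the width of a
    mollifier.  The order of the two limits matters, since the error term
    [c m / n.+1%:R] vanishes only for fixed [m].  Being built from measurable
    functions, this iterated lower limit is a random variable by construction,
    whereas nothing is known about the measurability of the energy of the limit
    [V] that it dominates. *)
Definition liminf_energy (w : T) : \bar R :=
  limn_einf (fun m => limn_einf (fun n => \int[nu]_x (f x * v m n x w ^+ 2)%:E))%E.

Lemma measurable_liminf_energy : measurable_fun setT liminf_energy.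
Proof.
apply: (@measurable_limn_einf _ _ _ (fun m w => limn_einf (fun n => q m n w))) => m.
exact: (@measurable_limn_einf _ _ _ (fun n w => q m n w)).
Qed.

Lemma liminf_energy_ge0 w : (0 <= liminf_energy w)%E.
Proof. by apply: limn_einf_ge0 => m; apply: limn_einf_ge0 => n; exact: q0. Qed.

Let Eq m n : (\int[P]_w q m n w <=
  (c m * (\int[nu]_x f x) / n.+1%:R + \int[nu]_x (f x * b x))%:E)%E.
Proof.
have mvx x : measurable_fun setT (v m n x).
  exact: (measurableT_comp (mv m n) (measurable_pair1 x)).
have iv2 x : P.-integrable setT (EFin \o (fun w => v m n x w ^+ 2)).
  apply: (@integrable_fun_le _ _ _ _ _ _ _ (fun=> Bd m ^+ 2)) => //.
  - exact: measurable_funX.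
  - exact: integrable_cst_prob.
  - move=> w _; rewrite ger0_norm ?sqr_ge0// -(real_normK (num_real (v m n x w))).
    by rewrite lerXn2r// nnegrE// (le_trans (normr_ge0 _) (vB m n x w)).
rewrite -(fubini_tonelli (m1 := nu) (m2 := P)
  (fun z : S * T => (f z.1 * v m n z.1 z.2 ^+ 2)%:E))//; last first.
  by move=> z; rewrite lee_fin mulr_ge0// sqr_ge0.
have i1 : nu.-integrable setT (EFin \o (fun x => c m / n.+1%:R * f x + f x * b x)).
  by apply: integrable_funD => //; exact: integrable_funZ.
have -> : (c m * (\int[nu]_x f x) / n.+1%:R + \int[nu]_x (f x * b x))%:E =
    (\int[nu]_x (c m / n.+1%:R * f x + f x * b x)%:E)%E.
  rewrite -EFin_Rintegral// RintegralD//; last exact: integrable_funZ.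
  by rewrite RintegralZl//; congr EFin; congr (_ + _); ring.
apply: ge0_le_integral => //.
- move=> x _; apply: integral_ge0 => w _.
  by rewrite lee_fin mulr_ge0// sqr_ge0.
- apply: (measurable_fun_fubini_tonelli_F (m2 := P)
    (fun z : S * T => (f z.1 * v m n z.1 z.2 ^+ 2)%:E)) => // z.
  by rewrite lee_fin mulr_ge0// sqr_ge0.
- exact: (measurable_int nu).
move=> x _ /=.
under eq_integral do rewrite EFinM.
rewrite ge0_integralZl//=; last 3 first.
- by apply/measurable_EFinP; exact: measurable_funX.
- by move=> w _; rewrite lee_fin sqr_ge0.
- by rewrite lee_fin.
rewrite -EFin_Rintegral// -EFinM lee_fin.
apply: le_trans (ler_wpM2l (f0 x) (moment m n x)) _.
by rewrite mulrDr mulrC.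
Qed.

Lemma integral_liminf_energy_le :
  (\int[P]_w liminf_energy w <= (\int[nu]_x (f x * b x))%:E)%E.
Proof.
apply: le_trans (@fatou _ _ _ P setT measurableT
  (fun m w => limn_einf (fun n => q m n w)) _ _) _.
- by move=> m; exact: (@measurable_limn_einf _ _ _ (fun n w => q m n w)).
- by move=> m w _; apply: limn_einf_ge0 => n; exact: q0.
rewrite -[leRHS](cvg_limn_einf_sup (cvg_cst (\int[nu]_x (f x * b x))%:E)).1.
apply: le_limn_einf => m.
apply: le_trans (@fatou _ _ _ P setT measurableT (q m) _ _) _.
- by move=> n; exact: mq.
- by move=> n w _; exact: q0.
apply: le_trans (le_limn_einf (Eq m)) _.
suff h : (c m * (\int[nu]_x f x) / n.+1%:R + \int[nu]_x (f x * b x))%:E @[n --> \oo]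
    --> (\int[nu]_x (f x * b x))%:E.
  by rewrite (cvg_limn_einf_sup h).1.
apply: cvg_EFin; first exact: nearW.
rewrite -[X in _ --> X]add0r; apply: (@cvgD _ R^o); last exact: cvg_cst.
rewrite -(mulr0 (c m * \int[nu]_x f x)).
by apply: cvgMr => //; exact: cvg_harmonic.
Qed.

Lemma energy_le_liminf_energy (w : T) (V : S -> R) (vm : nat -> S -> R) :
  (forall m x, v m n x w @[n --> \oo] --> vm m x) ->
  (forall x, vm m x @[m --> \oo] --> V x) ->
  (\int[nu]_x (f x * V x ^+ 2)%:E <= liminf_energy w)%E.
Proof.
move=> hv hV.
have sq (u : nat -> R) (l : R) : u n @[n --> \oo] --> l -> forall k : R,
    (k * u n ^+ 2)%:E @[n --> \oo] --> (k * l ^+ 2)%:E.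
  move=> ul k; apply: cvg_EFin; first exact: nearW.
  apply: cvgMr; apply: (cvg_comp u (fun x : R => x ^+ 2) ul).
  exact: sqr_continuous.
have mvw m n : measurable_fun setT (fun x => v m n x w).
  exact: (measurableT_comp (mv m n) (measurable_pair2 w)).
have mvm m : measurable_fun setT (vm m).
  by apply: (measurable_fun_cvg (fun n => mvw m n)) => x _; exact: hv.
have e1 x : (f x * V x ^+ 2)%:E = limn_einf (fun m => (f x * vm m x ^+ 2)%:E).
  by rewrite (cvg_limn_einf_sup (sq _ _ (hV x) (f x))).1.
have e2 m x : (f x * vm m x ^+ 2)%:E = limn_einf (fun n => (f x * v m n x w ^+ 2)%:E).
  by rewrite (cvg_limn_einf_sup (sq _ _ (hv m x) (f x))).1.
under eq_integral do rewrite e1.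
apply: le_trans (fatou nu measurableT _ _) _.
- move=> m; apply/measurable_EFinP; apply: measurable_funM => //.
  exact: measurable_funX.
- by move=> m x _; rewrite lee_fin mulr_ge0// sqr_ge0.
apply: le_limn_einf => m.
under eq_integral do rewrite e2.
apply: (fatou nu measurableT).
- move=> n; apply/measurable_EFinP; apply: measurable_funM => //.
  exact: measurable_funX.
- by move=> n x _; rewrite lee_fin mulr_ge0// sqr_ge0.
Qed.

End double_fatou.

(** * From almost sure convergence along powers to all times *)

(** A series of nonnegative variables with summable expectations is integrable,
    hence almost surely finite, and its terms tend to 0. *)
Lemma summable_expectation_ae_cvg0 d (T : measurableType d) (R : realType)
    (P : {measure set T -> \bar R}) (u : nat -> T -> \bar R) (a : nat -> R) (K : R) :
  (forall n, measurable_fun setT (u n)) -> (forall n w, 0 <= u n w)%E ->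
  (forall n, \int[P]_w u n w <= (a n)%:E)%E ->
  (forall n, \sum_(i < n) a i <= K) ->
  {ae P, forall w, u n w @[n --> \oo] --> 0%E}.
Proof.
move=> mu u0 ua aK.
pose S w := (\sum_(0 <= n <oo) u n w)%E.
have S0 w : (0 <= S w)%E by exact: nneseries_ge0.
have ES : (\int[P]_w S w <= K%:E)%E.
  rewrite integral_nneseries//; apply: lime_le.
    by apply: is_cvg_nneseries => n _ _; exact: integral_ge0.
  apply: nearW => n; apply: (@le_trans _ _ (\sum_(0 <= i < n) (a i)%:E)%E).
    by apply: lee_sum => i _.
  by rewrite big_mkord sumEFin lee_fin.
have iS : P.-integrable setT S.
  apply/integrableP; split; first exact: ge0_emeasurable_sum.
  under eq_integral do rewrite gee0_abs//.
  by apply: le_lt_trans ES _; rewrite ltry.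
apply: filterS (integrable_ae measurableT iS) => w /(_ I) Sw.
have /(nneseries_tail_cvg)/(_ (fun k _ => u0 k w)) h : (S w < +oo)%E by rewrite ltey_eq Sw.
apply: (squeeze_cvge _ (cvg_cst _) h); apply: nearW => n; rewrite u0/=.
have := @nneseries_lim_ge _ (u ^~ w) xpredT n n.+1 (fun k _ _ => u0 k w).
by rewrite big_nat1.
Qed.

(** Purely algebraic form of the monotonicity argument: [a] and [u] stand for the
    functional and the local time at a time lying between two reference times,
    at which they carry the indices 1 and 2. *)
Lemma interpolation_bound (R : realType) (F D h a a1 a2 u u1 u2 : R) :
  0 <= F -> 0 <= D -> 0 <= h -> a1 <= a -> a <= a2 -> u1 <= u -> u <= u2 ->
  u2 - u1 <= h -> `|a1 - F * u1| <= h * (F + 1) / 2 ->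
  `|a2 - F * u2| <= h * D * (F + 1) / 2 ->
  `|a - F * u| <= h * ((F + 1) * (D + 2)).
Proof.
move=> F0 D0 h0 a1a aa2 u1u uu2 uh.
have M1 := ler_wpM2l F0 uh; have M3 := ler_wpM2l F0 u1u; have M4 := ler_wpM2l F0 uu2.
have M5 := mulr_ge0 h0 F0; have M6 := mulr_ge0 h0 D0; have M7 := mulr_ge0 M5 D0.
by rewrite !ler_norml => /andP[z1 z2] /andP[z3 z4]; apply/andP; split; lra.
Qed.

Section path_asymptotics.
Context (R : realType) (x : R -> R) (l : R -> R -> R) (f : R -> R).
Hypotheses (xl : occupied_path x l) (mf : measurable_fun setT f) (f0 : forall y, 0 <= f y)
  (fi : (@lebesgue_measure R).-integrable setT (EFin \o f)).
Local Notation mu := (@lebesgue_measure R).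
Local Notation F0 := (\int[mu]_y f y).

Definition path_functional (t : R) : \bar R := (\int[mu]_(s in `[0%R, t]) (f (x s))%:E)%E.

Lemma path_functional_ge0 t : (0 <= path_functional t)%E.
Proof. by apply: integral_ge0 => s _; rewrite lee_fin. Qed.

Lemma path_functional_nondecreasing (a b : R) : a <= b ->
  (path_functional a <= path_functional b)%E.
Proof.
move=> ab; apply: ge0_subset_integral => //.
- apply/measurable_EFinP; apply: measurableT_comp => //.
  exact: measurable_occupied_path xl b.
- by move=> s _; rewrite lee_fin.
- by apply: subset_itvl; rewrite bnd_simp.
Qed.

(** With [V y = l y t - l 0 t], the deviation is the integral of [f * V], and
    [`|V| <= e * s / 2 + V ^+ 2 / (2 * e * s)] is chosen so that both terms
    contribute at the scale [e * s].  Here [s] will be [t `^ (1 - tau - eps)]. *)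
Lemma path_functional_deviation (t e s : R) : 0 <= t -> 0 < e -> 0 < s ->
  (\int[mu]_y (f y * (l y t - l 0 t) ^+ 2)%:E <= (e ^+ 2 * s ^+ 2)%:E)%E ->
  path_functional t \is a fin_num /\
  `|fine (path_functional t) - F0 * l 0 t| <= e * s * (F0 + 1) / 2.
Proof.
move=> t0 e0 s0 hE.
have es0 : 0 < e * s by rewrite mulr_gt0.
pose V y := l y t - l 0 t.
have mV : measurable_fun setT V.
  by apply: measurable_funB => //; exact: (measurable_density xl t0).
have iV2 : mu.-integrable setT (EFin \o (fun y => f y * V y ^+ 2)).
  apply/integrableP; split.
    apply/measurable_EFinP; apply: measurable_funM => //.
    exact: measurable_funX.
  apply: le_lt_trans (le_lt_trans hE (ltry _)).
  rewrite le_eqVlt; apply/orP; left; apply/eqP; apply: eq_integral => y _.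
  by rewrite gee0_abs//= lee_fin mulr_ge0// sqr_ge0.
have iB : mu.-integrable setT
    (EFin \o (fun y => e * s / 2 * f y + (2 * (e * s))^-1 * (f y * V y ^+ 2))).
  by apply: integrable_funD => //; exact: integrable_funZ.
have hB y : `|f y * V y| <= e * s / 2 * f y + (2 * (e * s))^-1 * (f y * V y ^+ 2).
  rewrite normrM (ger0_norm (f0 y)) -subr_ge0.
  have -> : e * s / 2 * f y + (2 * (e * s))^-1 * (f y * V y ^+ 2) - f y * `|V y| =
      f y * (2 * (e * s))^-1 * (e * s - `|V y|) ^+ 2.
    rewrite -(real_normK (num_real (V y))); field.
    by rewrite (gt_eqF e0) (gt_eqF s0).
  by apply: mulr_ge0; [apply: divr_ge0 => //; apply: mulr_ge0 => //; exact: ltW|exact: sqr_ge0].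
have iV : mu.-integrable setT (EFin \o (fun y => f y * V y)).
  apply: (integrable_fun_le _ _ iB) => //.
  exact: measurable_funM.
have EF : path_functional t = (\int[mu]_y (f y * V y) + F0 * l 0 t)%:E.
  rewrite /path_functional (occupation_formula xl)//.
  have i2 : mu.-integrable setT (EFin \o (fun y => l 0 t * f y)) by exact: integrable_funZ.
  have -> : (\int[mu]_y (f y * V y) + F0 * l 0 t) = \int[mu]_y (f y * V y + l 0 t * f y).
    by rewrite RintegralD// RintegralZl// (mulrC F0).
  rewrite EFin_Rintegral//; last exact: integrable_funD.
  by apply: eq_integral => y _; congr EFin; rewrite /V; ring.
rewrite EF; split => //=.
rewrite addrK; apply: le_trans (le_normr_Rintegral _ iV) _ => //.
apply: (@le_trans _ _ (\int[mu]_y (e * s / 2 * f y + (2 * (e * s))^-1 * (f y * V y ^+ 2)))).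
  by apply: le_Rintegral => //; exact: integrable_fun_abs.
rewrite RintegralD//; try exact: integrable_funZ.
rewrite !RintegralZl//.
have hR : \int[mu]_y (f y * V y ^+ 2) <= e ^+ 2 * s ^+ 2.
  by rewrite -lee_fin EFin_Rintegral.
apply: le_trans (lerD (lexx _) (ler_wpM2l _ hR)) _.
  by rewrite invr_ge0 mulr_ge0 ?ltW.
rewrite le_eqVlt; apply/orP; left; apply/eqP; field.
by rewrite (gt_eqF e0) (gt_eqF s0).
Qed.

(** Polynomial times satisfy [t n.+1 <= 2 ^+ p * t n], so that the scale
    [t `^ kappa] changes by a bounded factor from one time to the next. *)
Lemma path_functional_asymptotics (p : nat) (kappa : R) : (0 < p)%N -> 0 < kappa ->
  (forall e, 0 < e -> \forall n \near \oo,
    (\int[mu]_y (f y * (l y (n.+1%:R ^+ p) - l 0 (n.+1%:R ^+ p)) ^+ 2)%:E <=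
     (e * ((n.+1%:R ^+ p) `^ kappa) ^+ 2)%:E)%E) ->
  (forall e, 0 < e -> \forall n \near \oo,
    (l 0 (n.+2%:R ^+ p) - l 0 (n.+1%:R ^+ p)) ^+ 2 <=
     e * ((n.+1%:R ^+ p) `^ kappa) ^+ 2) ->
  forall e, 0 < e -> \forall t \near +oo,
    path_functional t \is a fin_num /\
    `|fine (path_functional t) - F0 * l 0 t| <= e * t `^ kappa.
Proof.
move=> p0 k0 hE hI e e0.
pose t n : R := n.+1%:R ^+ p; pose s n := t n `^ kappa.
have F00 : 0 <= F0 by exact: Rintegral_ge0.
pose D : R := (2 ^+ p) `^ kappa.
have D0 : 0 <= D by exact: powR_ge0.
have t0 n : 0 < t n by rewrite exprn_gt0// ltr0n.
have s0 n : 0 < s n by rewrite powR_gt0.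
have tS n : t n.+1 <= 2 ^+ p * t n.
  by rewrite -exprMn lerXn2r ?nnegrE// -natrM ler_nat; lia.
have tle m n : (m <= n)%N -> t m <= t n.
  by move=> mn; rewrite lerXn2r ?nnegrE// ler_nat.
have sS n : s n.+1 <= D * s n.
  rewrite /s /D -powRM ?(ltW (t0 _)) ?exprn_ge0//.
  by apply: ge0_ler_powR; rewrite ?nnegrE ?(ltW k0) ?(ltW (t0 _)) ?mulr_ge0 ?exprn_ge0 ?(ltW (t0 _)).
(* The constant of [interpolation_bound], which also absorbs the growth [D] of
   the scale from [t n] to [t n.+1]. *)
pose dl := e / ((F0 + 1) * (D + 2)).
have dl0 : 0 < dl by rewrite divr_gt0// mulr_gt0// ltr_wpDl.
have dE : dl * ((F0 + 1) * (D + 2)) = e.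
  by rewrite /dl mulfVK// gt_eqF// mulr_gt0// ltr_wpDl.
have d20 : 0 < dl ^+ 2 by rewrite exprn_gt0.
have [N _ hN] := filterI (hE _ d20) (hI _ d20).
exists (t N); split; first exact: num_real.
move=> T /ltW NT.
have T0 : 0 < T by exact: lt_le_trans NT.
have exm : exists m, T < t m.
  exists (Num.trunc T).+1; apply: lt_le_trans (truncnS_gt _) _.
  apply: (@le_trans _ _ (Num.trunc T).+2%:R); first by rewrite ler_nat.
  by rewrite -[leLHS]expr1 ler_weXn2l// ler1n.
case: (ex_minnP exm) => m Tm mmin.
have Nm : (N < m)%N by rewrite ltnNge; apply/negP => /tle /(lt_le_trans Tm); rewrite ltNge NT.
case: m Nm Tm mmin => [//|n] Nn Tn mmin.
have nT : t n <= T by rewrite leNgt; apply/negP => /mmin; rewrite ltnn.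
have [hEn hIn] := hN n Nn.
have [hES _] := hN n.+1 (leqW Nn).
have [An Zn] := path_functional_deviation (ltW (t0 n)) dl0 (s0 n) hEn.
have [AS ZS] := path_functional_deviation (ltW (t0 n.+1)) dl0 (s0 n.+1) hES.
have A1 := path_functional_nondecreasing nT.
have A2 := path_functional_nondecreasing (ltW Tn).
have AT : path_functional T \is a fin_num.
  rewrite ge0_fin_numE ?path_functional_ge0//; apply: le_lt_trans A2 _.
  by rewrite ltey_eq AS.
split => //.
have B1 : fine (path_functional (t n)) <= fine (path_functional T) by exact: fine_le.
have B2 : fine (path_functional T) <= fine (path_functional (t n.+1)) by exact: fine_le.
have L1 := density_nondecreasing xl 0 (ltW (t0 n)) nT.
have L2 := density_nondecreasing xl 0 (ltW T0) (ltW Tn).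
have dlt : l 0 (t n.+1) - l 0 (t n) <= dl * s n.
  rewrite -(@ler_pXn2r _ 2)//; last 2 first.
  - by rewrite nnegrE subr_ge0 (le_trans L1).
  - by rewrite nnegrE; apply: mulr_ge0; exact: ltW.
  by rewrite exprMn.
have sT : s n <= T `^ kappa.
  by apply: ge0_ler_powR; rewrite ?nnegrE ?(ltW k0) ?(ltW T0) ?(ltW (t0 n)).
apply: (@le_trans _ _ (e * s n)); last by apply: ler_wpM2l; first exact: ltW.
have ds0 : 0 < dl * s n by rewrite mulr_gt0.
rewrite -dE mulrAC.
apply: (interpolation_bound F00 D0 (ltW ds0) B1 B2 L1 L2 dlt Zn).
apply: le_trans ZS _; rewrite ler_wpM2r ?invr_ge0// ler_wpM2r ?addr_ge0//.
by have := ler_wpM2l (ltW dl0) (sS n); rewrite [D * _]mulrC [dl * (_ * _)]mulrA.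
Qed.

End path_asymptotics.

(** * Mean-square regularity of the local time *)

Section riemann_sum_more.
Context (R : realType).
Implicit Types g h : R -> R.

Lemma riemann_sumB g h a b n :
  riemann_sum (fun s => g s - h s) a b n = riemann_sum g a b n - riemann_sum h a b n.
Proof. by rewrite /riemann_sum -mulrBr -sumrB. Qed.

Lemma riemann_sum_bound g (a b M : R) n : a <= b -> (forall s, `|g s| <= M) ->
  `|riemann_sum g a b n.+1| <= (b - a) * M.
Proof.
move=> ab gM; have ba : 0 <= (b - a) / n.+1%:R by rewrite divr_ge0// subr_ge0.
rewrite /riemann_sum normrM ger0_norm//.
apply: (@le_trans _ _ ((b - a) / n.+1%:R * \sum_(i < n.+1) M)).
  by rewrite ler_wpM2l// (le_trans (ler_norm_sum _ _ _))// ler_sum.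
by rewrite sumr_const card_ord -[M *+ _]mulr_natl mulrA mulfVK// pnatr_eq0.
Qed.

Lemma measurable_riemann_sum d (T : measurableType d) (g : R -> T -> R) (a b : R) n :
  (forall s, measurable_fun setT (g s)) ->
  measurable_fun setT (fun w => riemann_sum (g ^~ w) a b n).
Proof.
move=> mg; rewrite /riemann_sum; apply: measurable_funM => //.
by apply: measurable_sum => i; exact: mg.
Qed.

Lemma normal_pdf_center (y r z : R) : r != 0 -> normal_pdf y r z = normal_pdf 0 r (z - y).
Proof. by move=> r0; rewrite !normal_pdfE// /normal_fun subr0. Qed.

End riemann_sum_more.

Section density_energy.
Context d (T : measurableType d) (R : realType) (P : probability T R).
Variables (tau : R) (X : R -> {RV P >-> R}) (L : R -> R -> {RV P >-> R}).
Hypotheses (tau0 : 0 < tau) (tau1 : tau < 1) (lnd : locally_nondeterministic tau X).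
Local Notation mu := (@lebesgue_measure R).
Local Notation r_ m := ((m.+1%:R : R)^-1).

Let occ w := occupied_path (fun t => X t w) (fun y t => L y t w).

Let r0 m : 0 < r_ m. Proof. by rewrite invr_gt0 ltr0n. Qed.
Let rn0 m : r_ m != 0. Proof. by rewrite gt_eqF. Qed.

Let measurable_mollified m s :
  measurable_fun setT (fun z : measurableTypeR R * T => normal_pdf z.1 (r_ m) (X s z.2)).
Proof.
under eq_fun do rewrite normal_pdf_center//.
apply: measurableT_comp; first exact: measurable_normal_pdf.
by apply: measurable_funB => //; exact: measurableT_comp.
Qed.

Let mollified_limit w y : occ w -> forall t, 0 <= t ->
  \int[mu]_z (normal_pdf y (r_ m) z * L z t w) @[m --> \oo] --> L y t w.
Proof.
move=> ow t t0; apply: (@approximate_identity _ (fun z => L z t w)).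
- exact: occupied_path_continuous ow _ t0.
- by move=> z; exact: occupied_path_ge0 ow _ _ t0.
- exact: integrable_density ow _ t0.
Qed.

(** The variable [G] replaces the energy itself, whose measurability in [w] is not
    assumed; it does not depend on the null set outside of which the local time
    is well behaved. *)
Lemma difference_energy (f : R -> R) (g : R) :
  0 <= g -> g <= 1 -> tau * (1 + g) < 1 ->
  (forall y, 0 <= f y) -> mu.-integrable setT (EFin \o f) ->
  mu.-integrable setT (EFin \o (fun y => f y * `|y| `^ g)) ->
  exists2 K : R, 0 <= K & forall t, 0 < t -> exists G : T -> \bar R,
    [/\ measurable_fun setT G, (forall w, 0 <= G w)%E,
        (\int[P]_w G w <= (K * t `^ (2 - 2 * tau - tau * g))%:E)%E &
        forall w, occ w ->
          (\int[mu]_y (f y * (L y t w - L 0 t w) ^+ 2)%:E <= G w)%E].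
Proof.
move=> g0 g1 tg f0 fi fgi.
have [C C0 HC] := mollified_difference_moment tau0 tau1 lnd g0 g1 tg.
exists (C * \int[mu]_y (f y * `|y| `^ g)).
  apply: mulr_ge0 => //; apply: Rintegral_ge0 => y _.
  by rewrite mulr_ge0 ?powR_ge0.
move=> t t0.
pose v m n (y : measurableTypeR R) (w : T) : R := riemann_sum
  (fun s => normal_pdf y (r_ m) (X s w) - normal_pdf 0 (r_ m) (X s w)) 0 t n.+1.
pose b (y : measurableTypeR R) := C * `|y| `^ g * t `^ (2 - 2 * tau - tau * g).
have mv m n : measurable_fun setT (fun z : measurableTypeR R * T => v m n z.1 z.2).
  apply: (measurable_riemann_sum (g := fun s (z : measurableTypeR R * T) =>
    normal_pdf z.1 (r_ m) (X s z.2) - normal_pdf 0 (r_ m) (X s z.2))) => s.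
  apply: measurable_funB; first exact: measurable_mollified.
  apply: measurableT_comp; first exact: measurable_normal_pdf.
  exact: measurableT_comp.
have vB m n y w : `|v m n y w| <= t * (2 * normal_peak (r_ m)).
  rewrite -[X in X * _]subr0; apply: riemann_sum_bound; first exact: ltW.
  move=> s; rewrite (le_trans (ler_normB _ _))// !ger0_norm ?normal_pdf_ge0//.
  by rewrite mulr_natl mulr2n lerD// normal_pdf_ub.
pose c m : R := 2 * t ^+ 2 * (2 * normal_peak (r_ m)) ^+ 2.
have fbi : mu.-integrable setT (EFin \o (fun y => f y * b y)).
  have := integrable_funZ measurableT (C * t `^ (2 - 2 * tau - tau * g)) fgi.
  by apply: eq_integrable => // y _ /=; congr EFin; rewrite /b; ring.
have moment m n y : \int[P]_w v m n y w ^+ 2 <= c m / n.+1%:R + b y by exact: HC.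
exists (liminf_energy mu v f); split.
- exact: measurable_liminf_energy.
- exact: liminf_energy_ge0.
- apply: le_trans (integral_liminf_energy_le mv vB f0 fi fbi moment) _.
  rewrite lee_fin le_eqVlt; apply/orP; left; apply/eqP.
  rewrite mulrAC; have <- := RintegralZl (C * t `^ (2 - 2 * tau - tau * g)) measurableT fgi.
  by apply: eq_Rintegral => y _; rewrite /b; ring.
move=> w ow.
apply: (energy_le_liminf_energy mv f0 fi (V := fun y => L y t w - L 0 t w)
  (vm := fun m y => \int[mu]_z (normal_pdf y (r_ m) z * L z t w) -
                    \int[mu]_z (normal_pdf 0 (r_ m) z * L z t w))).
- move=> m y; rewrite /v; under eq_cvg do rewrite riemann_sumB.
  (* At time 0 the occupation measure is null. *)
  have E z : \int[mu]_u (normal_pdf z (r_ m) u * L u 0 w) = 0.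
    by rewrite -(Rintegral_mollified ow z (r_ m) (lexx 0)) set_itv1 /Rintegral integral_set1.
  have H z : riemann_sum (fun s => normal_pdf z (r_ m) (X s w)) 0 t n.+1 @[n --> \oo] -->
      \int[mu]_u (normal_pdf z (r_ m) u * L u t w).
    have := @riemann_sum_mollified_cvg _ _ _ ow z _ (rn0 m) _ _ (lexx 0) t0.
    by rewrite E subr0.
  by apply: (@cvgB _ R^o); exact: H.
- by move=> y; apply: (@cvgB _ R^o); exact: mollified_limit ow _ (ltW t0).
Qed.

(** The spatial point is fixed, so the general passage to the limit is used with
    the Dirac measure at 0 in place of [f * mu]. *)
Lemma increment_energy : exists2 K : R, 0 <= K & forall a b, 0 < a -> a < b ->
  exists H : T -> \bar R,
    [/\ measurable_fun setT H, (forall w, 0 <= H w)%E,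
        (\int[P]_w H w <= (K * ((b - a) `^ (2 - tau) * a `^ (- tau)))%:E)%E &
        forall w, occ w -> (((L 0 b w - L 0 a w) ^+ 2)%:E <= H w)%E].
Proof.
have [C C0 HC] := mollified_increment_moment tau0 tau1 lnd.
exists C => // a b a0 ab.
pose v m n (y : measurableTypeR R) (w : T) : R := riemann_sum
  (fun s => normal_pdf 0 (r_ m) (X s w)) a b n.+1.
pose B (y : measurableTypeR R) := C * ((b - a) `^ (2 - tau) * a `^ (- tau)).
pose f (y : measurableTypeR R) : R := 1.
have mv m n : measurable_fun setT (fun z : measurableTypeR R * T => v m n z.1 z.2).
  apply: (measurable_riemann_sum (g := fun s (z : measurableTypeR R * T) =>
    normal_pdf 0 (r_ m) (X s z.2))) => s.
  apply: measurableT_comp; first exact: measurable_normal_pdf.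
  exact: measurableT_comp.
have vB m n y w : `|v m n y w| <= (b - a) * normal_peak (r_ m).
  apply: riemann_sum_bound; first exact: ltW.
  by move=> s; rewrite ger0_norm ?normal_pdf_ge0// normal_pdf_ub.
pose nu : {sigma_finite_measure set (measurableTypeR R) -> \bar R} :=
  dirac (0 : measurableTypeR R).
have icst (k : R) : nu.-integrable setT (EFin \o (fun=> k)) by exact: finite_measure_integrable_cst.
have nuC (k : R) : (\int[nu]_x k%:E = k%:E)%E.
  by rewrite integral_cst// /nu/= diracE in_setT mule1.
have f0 y : 0 <= f y by exact: ler01.
have fi : nu.-integrable setT (EFin \o f) by exact: icst.
have moment m n y : \int[P]_w v m n y w ^+ 2 <=
  2 * (b - a) ^+ 2 * normal_peak (r_ m) ^+ 2 / n.+1%:R + B y by exact: HC.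
exists (liminf_energy nu v f); split.
- exact: measurable_liminf_energy.
- exact: liminf_energy_ge0.
- apply: le_trans (integral_liminf_energy_le mv vB f0 fi _ moment) _.
    exact: (icst (1 * B 0)).
  rewrite EFin_Rintegral//; last exact: (icst (1 * B 0)).
  by rewrite (nuC (1 * B 0)) mul1r.
move=> w ow.
have := @energy_le_liminf_energy _ _ _ _ _ nu v f mv f0 fi w (fun=> L 0 b w - L 0 a w)
  (fun m y => \int[mu]_z (normal_pdf 0 (r_ m) z * L z b w) -
              \int[mu]_z (normal_pdf 0 (r_ m) z * L z a w)).
rewrite (nuC (1 * _)) mul1r; apply => //.
- by move=> m y; exact: (@riemann_sum_mollified_cvg _ _ _ ow 0 _ (rn0 m) _ _ (ltW a0) ab).
- move=> y; apply: (@cvgB _ R^o); apply: mollified_limit => //; last exact: ltW.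
  by rewrite ltW// (lt_trans a0).
Qed.

End density_energy.

(** * Almost sure asymptotics for nonnegative functions *)

Section power_times.
Context (R : realType).

(** The gaps between the times [n ^ q.+1] are of order [n ^ q], the quantity that
    makes the increments of the local time over them negligible. *)
Lemma expr_increment_bound (q : nat) : exists2 c : R, 0 <= c &
  forall n, n.+2%:R ^+ q.+1 - n.+1%:R ^+ q.+1 <= c * n.+1%:R ^+ q.
Proof.
elim: q => [|q [c c0 IH]].
  by exists 1 => // n; rewrite !expr1 expr0 mulr1 -natrB// subSnn.
exists (1 + 2 * c) => [|n]; first by rewrite addr_ge0// mulr_ge0.
set m : R := n.+1%:R.
have m1 : 1 <= m by rewrite /m ler1n.
have -> : n.+2%:R = m + 1 :> R by rewrite /m -[in LHS]addn1 natrD.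
have := IH n; rewrite -/m.
have -> : n.+2%:R = m + 1 :> R by rewrite /m -[in LHS]addn1 natrD.
move=> h.
have m0 : 0 <= m by exact: le_trans m1.
have := ler_wpM2l (addr_ge0 m0 ler01) h.
have mq : 0 <= m ^+ q by exact: exprn_ge0.
have : c * m ^+ q <= c * m ^+ q.+1 by rewrite ler_wpM2l// exprS ler_peMl.
rewrite !(exprS _ q.+1) (exprS m q).
by set z := (m + 1) ^+ q.+1; set x := m ^+ q => h1 h2; lra.
Qed.

End power_times.

Section ae_asymptotics.
Context d (T : measurableType d) (R : realType) (P : probability T R).
Variables (tau : R) (X : R -> {RV P >-> R}) (L : R -> R -> {RV P >-> R}).
Hypotheses (tau0 : 0 < tau) (tau1 : tau < 1) (lnd : locally_nondeterministic tau X).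
Hypothesis occ : {ae P, forall w,
  occupied_path (fun t => X t w) (fun y t => L y t w)}.
Local Notation mu := (@lebesgue_measure R).

Let cvg0_le (u : nat -> \bar R) (e : R) : u n @[n --> \oo] --> 0%E -> 0 < e ->
  \forall n \near \oo, (u n <= e%:E)%E.
Proof.
move=> /fine_cvgP[fu /cvgr0_norm_le cu] e0.
near=> n.
have fn : u n \is a fin_num by near: n.
rewrite -(fineK fn) lee_fin (le_trans (ler_norm _))//.
by near: n; exact: cu.
Unshelve. all: by end_near. Qed.

(** The conditions on [p] and [eps] are those that make two series converge.  With
    [kappa = 1 - tau - eps] and [t n] of order [n `^ p], the normalized expected
    energies are of order [n `^ (- p * (tau * g - 2 * eps))], with an exponent at
    most [- 2]; the normalized squared increments are of order
    [n `^ (- (2 - tau) + 2 * p * eps)], with an exponent at most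
    [- (1 + (1 - tau) / 2)]. *)
Lemma ae_path_functional_asymptotics (f : R -> R) (g eps : R) (p : nat) :
  0 < g -> g <= 1 -> tau * (1 + g) < 1 ->
  (forall y, 0 <= f y) -> measurable_fun setT f -> mu.-integrable setT (EFin \o f) ->
  mu.-integrable setT (EFin \o (fun y => f y * `|y| `^ g)) ->
  0 < eps -> eps < 1 - tau -> 4 <= p%:R * (tau * g) -> 4 * eps <= tau * g ->
  4 * (p%:R * eps) <= 1 - tau ->
  {ae P, forall w, forall e, 0 < e -> \forall t \near +oo,
    path_functional (fun t => X t w) f t \is a fin_num /\
    `|fine (path_functional (fun t => X t w) f t) - (\int[mu]_y f y) * L 0 t w| <=
      e * t `^ (1 - tau - eps)}.
Proof.
move=> g0 g1 tg f0 mf fi fgi eps0 eps1 pg eg pe.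
have [K K0 HG] := difference_energy L tau0 tau1 lnd (ltW g0) g1 tg f0 fi fgi.
have [K' K'0 HH] := increment_energy L tau0 tau1 lnd.
case: p pg pe => [|q]; first by rewrite mul0r; lra.
move=> pg pe; have [c c0 Hc] := expr_increment_bound R q.
set p := q.+1 in pg pe *.
have peg : p%:R * (4 * eps) <= p%:R * (tau * g) by rewrite ler_wpM2l.
set kappa := 1 - tau - eps.
have k0 : 0 < kappa by rewrite /kappa; lra.
pose b n : R := n.+1%:R.
have b1 n : 1 <= b n by rewrite ler1n.
have b0 n : 0 < b n by rewrite ltr0n.
pose t n : R := b n ^+ p.
have t0 n : 0 < t n by rewrite exprn_gt0.
have tE n a : t n `^ a = b n `^ (p%:R * a) by rewrite powRrM powR_mulrn// ltW.
have tS n : t n < t n.+1 by rewrite ltrXn2r// ?(ltW (b0 _))// ltr_nat.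
have [G HGn] := choice (fun n => HG (t n) (t0 n)).
have [H HHn] := choice (fun n => HH (t n) (t n.+1) (t0 n) (tS n)).
pose s n := (t n `^ kappa) ^- 2.
have s0 n : 0 < s n by rewrite invr_gt0 exprn_gt0// powR_gt0.
have sE n : s n = b n `^ (- (2 * (p%:R * kappa))).
  by rewrite /s tE -powR_mulrn ?powR_ge0// -powRN -powRrM; congr (_ `^ _); ring.
have bD n x y : b n `^ (x + y) = b n `^ x * b n `^ y.
  by rewrite powRD// [b n == 0]gt_eqF ?implybT.
have aG : {ae P, forall w, (s n)%:E * G n w @[n --> \oo] --> 0}%E.
  apply: (@summable_expectation_ae_cvg0 _ _ _ _ _
     (fun n => K * b n `^ (- 2)) (K * (1 + (2 - 1)^-1))).
  - by move=> n; apply: emeasurable_funM => //; have [] := HGn n.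
  - by move=> n w; rewrite mule_ge0// ?lee_fin ?(ltW (s0 n))//; have [_] := HGn n.
  - move=> n; have [mG G0 GE _] := HGn n.
    rewrite ge0_integralZl//; last by rewrite lee_fin ltW.
    apply: (@le_trans _ _ ((s n)%:E * (K * t n `^ (2 - 2 * tau - tau * g))%:E)%E).
      by apply: lee_wpmul2l => //; rewrite lee_fin ltW.
    rewrite -EFinM lee_fin mulrCA ler_wpM2l// sE tE -bD.
    by apply: ler_powR => //; rewrite /kappa; lra.
  - move=> n; rewrite -mulr_sumr ler_wpM2l//.
    by apply: sum_powRN_bounded; rewrite ltr1n.
pose z : R := 1 + (1 - tau) / 2.
have aH : {ae P, forall w, (s n)%:E * H n w @[n --> \oo] --> 0}%E.
  apply: (@summable_expectation_ae_cvg0 _ _ _ _ _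
     (fun n => K' * (c `^ (2 - tau)) * b n `^ (- z)) (K' * (c `^ (2 - tau)) * (1 + (z - 1)^-1))).
  - by move=> n; apply: emeasurable_funM => //; have [] := HHn n.
  - by move=> n w; rewrite mule_ge0// ?lee_fin ?(ltW (s0 n))//; have [_] := HHn n.
  - move=> n; have [mH H0 HE _] := HHn n.
    rewrite ge0_integralZl//; last by rewrite lee_fin ltW.
    apply: (@le_trans _ _ ((s n)%:E *
        (K' * ((t n.+1 - t n) `^ (2 - tau) * t n `^ (- tau)))%:E)%E).
      by apply: lee_wpmul2l => //; rewrite lee_fin ltW.
    rewrite -EFinM lee_fin mulrCA -mulrA ler_wpM2l//.
    have dE : (t n.+1 - t n) `^ (2 - tau) <= c `^ (2 - tau) * b n `^ (q%:R * (2 - tau)).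
      rewrite powRrM powR_mulrn ?(ltW (b0 _))// -powRM ?exprn_ge0 ?(ltW (b0 _))//.
      apply: ge0_ler_powR; rewrite ?nnegrE ?subr_ge0 ?(ltW (tS n)) ?mulr_ge0 ?exprn_ge0 ?(ltW (b0 _))//; [lra|exact: Hc].
    rewrite mulrCA.
    apply: (@le_trans _ _ ((c `^ (2 - tau) * b n `^ (q%:R * (2 - tau))) * (s n * t n `^ (- tau)))).
      by rewrite ler_wpM2r// mulr_ge0 ?(ltW (s0 n)) ?powR_ge0.
    rewrite -mulrA ler_wpM2l ?powR_ge0// sE tE -!bD.
    apply: ler_powR => //; rewrite /kappa /z /p -[q.+1]addn1 natrD.
    move: pe; rewrite /p -[q.+1]addn1 natrD; lra.
  - move=> n; rewrite -mulr_sumr ler_wpM2l ?mulr_ge0 ?powR_ge0//.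
    by apply: sum_powRN_bounded; rewrite /z; lra.
have unscale n (e : R) (u : \bar R) : ((s n)%:E * u <= e%:E)%E ->
    (u <= (e * (t n `^ kappa) ^+ 2)%:E)%E.
  move=> h; rewrite EFinM -lee_pdivrMr ?exprn_gt0 ?powR_gt0// muleC.
  exact: h.
move: occ aG aH; apply: filterS3 => w ow hG hH.
apply: (path_functional_asymptotics ow mf f0 fi (p := p)) => // e e0.
- apply: filterS (cvg0_le hG e0) => n /unscale; apply: le_trans.
  by have [_ _ _] := HGn n; exact.
- apply: filterS (cvg0_le hH e0) => n /unscale h; rewrite -lee_fin; apply: le_trans h.
  by have [_ _ _] := HHn n; exact.
Qed.

End ae_asymptotics.

(** * Signed functions *)

Section signed.
Context (R : realType).
Local Notation mu := (@lebesgue_measure R).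

Lemma ereal_quotient_cvg0 (A : R -> \bar R) (c s : R -> R) :
  (forall t, 0 < t -> 0 < s t) ->
  (forall e, 0 < e -> \forall t \near +oo,
     A t \is a fin_num /\ `|fine (A t) - c t| <= e * s t) ->
  ((A t - (c t)%:E) / (s t)%:E)%E @[t --> +oo] --> 0%E.
Proof.
move=> s0 hA.
have E t : 0 < t -> A t \is a fin_num ->
    ((A t - (c t)%:E) / (s t)%:E)%E = ((fine (A t) - c t) / s t)%:E.
  move=> t0 At; rewrite -[in LHS](fineK At) inver gt_eqF ?s0//.
apply/fine_cvgP; split.
  apply: filterS2 (nbhs_pinfty_gt (num_real 0)) (hA 1 ltr01) => t t0 [At _].
  by rewrite E.
apply/cvgrPdist_le => e e0; near=> t.
have t0 : 0 < t by near: t; exact: nbhs_pinfty_gt.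
have [At h] : A t \is a fin_num /\ `|fine (A t) - c t| <= e * s t.
  by near: t; exact: hA.
rewrite /= E//= sub0r normrN normrM normfV (gtr0_norm (s0 _ t0)).
by rewrite ler_pdivrMr// s0.
Unshelve. all: by end_near. Qed.

(** [`|y| `^ g <= 1 + `|y| `^ k] when [g <= k], so the moment exponent may be
    lowered at the price of the integral of [f] itself. *)
Lemma integrable_smaller_moment (f h : R -> R) (g k : R) :
  0 < g -> g <= k -> measurable_fun setT f -> measurable_fun setT h ->
  (forall y, 0 <= h y) -> (forall y, h y <= `|f y|) ->
  mu.-integrable setT (EFin \o f) ->
  (\int[mu]_x (`|x| `^ k * `|f x|)%:E < +oo)%E ->
  mu.-integrable setT (EFin \o (fun y => h y * `|y| `^ g)).
Proof.
move=> g0 gk mf mh h0 hf fi fk.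
have mp (a : R) : measurable_fun setT (fun y : R => `|y| `^ a).
  by apply: (measurableT_comp (measurable_powR a)) => //; exact: measurable_normr.
have mfk : measurable_fun setT (fun x : R => `|x| `^ k * `|f x|).
  by apply: measurable_funM => //; exact: measurableT_comp.
have ik : mu.-integrable setT (EFin \o (fun x : R => `|x| `^ k * `|f x|)).
  apply/integrableP; split; first exact/measurable_EFinP.
  apply: le_lt_trans fk; rewrite le_eqVlt; apply/orP; left; apply/eqP.
  by apply: eq_integral => y _; rewrite gee0_abs//= lee_fin mulr_ge0// powR_ge0.
have ib := integrable_funD measurableT (integrable_fun_abs fi) ik.
have mhg : measurable_fun setT (fun y : R => h y * `|y| `^ g) by exact: measurable_funM.
apply: (integrable_fun_le _ _ ib) => //.
move=> y _; rewrite ger0_norm ?mulr_ge0 ?powR_ge0//.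
rewrite -[X in X + _]mul1r -mulrDl mulrC ler_pM ?powR_ge0//.
have [y1|y1] := leP `|y| 1.
  apply: (@le_trans _ _ 1); last by rewrite lerDl powR_ge0.
  have : `|y| `^ g <= 1 `^ g by rewrite ge0_ler_powR ?nnegrE// ltW.
  by rewrite powR1.
apply: (@le_trans _ _ (`|y| `^ k)); last by rewrite lerDr.
by rewrite ler_powR// ltW.
Qed.

End signed.

Theorem theorem3p11 (d : measure_display) (T : measurableType d)
    (R : realType) (P : probability T R)
    (tau : R) (X : R -> {RV P >-> R}) (L : R -> R -> {RV P >-> R})
    (f : R -> R) (k : R) :
  0 < tau -> tau < 1 ->
  fractional_brownian_motion tau X \/ riemann_liouville_process tau X ->
  is_local_time X L -> as_jointly_continuous L ->
  measurable_fun [set: R] f ->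
  (@lebesgue_measure R).-integrable [set: R] (EFin \o f) ->
  Rintegral (@lebesgue_measure R) [set: R] f != 0 ->
  0 < k ->
  (\int[@lebesgue_measure R]_x (`|x| `^ k * `|f x|)%:E < +oo)%E ->
  \forall eps \near (0 : R)^'+,
    {ae P, forall w,
      ((\int[@lebesgue_measure R]_(s in `[0%R, t]) (f (X s w))%:E
        - (Rintegral (@lebesgue_measure R) [set: R] f * L 0%R t w)%:E)
       / (t `^ (1 - tau - eps))%:E)%E @[t --> +oo%R] --> 0%E}.
Proof.
move=> tau0 tau1 hX hL cL mf fi _ k0 fk.
pose mu := @lebesgue_measure R.
have lnd : locally_nondeterministic tau X.
  case: hX => [hB|[[W [bW hW]] _]].
    exact: fractional_brownian_motion_nondeterministic hB.
  exact: (riemann_liouville_nondeterministic bW tau0 tau1 hW).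
have cX : as_continuous X by case: hX => [[]|[]].
have occ : {ae P, forall w, occupied_path (fun t => X t w) (fun y t => L y t w)}.
  by move: cX hL cL; apply: filterS3 => w cw lw jw; split.
(* A Hoelder exponent for which [f] has a moment and the correlation kernel is
   integrable in time. *)
pose g := Num.min (Num.min k 1) ((1 - tau) / (2 * tau)).
have g0 : 0 < g by rewrite !lt_min k0 ltr01 divr_gt0 ?subr_gt0// mulr_gt0.
have gk : g <= k by rewrite /g !ge_min lexx.
have g1 : g <= 1 by rewrite /g !ge_min lexx orbT.
have gtau : g <= (1 - tau) / (2 * tau) by rewrite /g !ge_min lexx orbT.
have tg : tau * (1 + g) < 1.
  move: gtau; rewrite ler_pdivlMr ?mulr_gt0// => h; lra.
have taug0 : 0 < tau * g by rewrite mulr_gt0.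
pose p := (Num.trunc (4 / (tau * g))).+1.
have pg : 4 <= p%:R * (tau * g).
  by rewrite -ler_pdivrMr// ltW// truncnS_gt.
have p1 : 1 <= p%:R :> R by rewrite ler1n.
pose fp y := Num.max (f y) 0; pose fm y := Num.max (- f y) 0.
have mfp : measurable_fun setT fp by exact: measurable_maxr.
have mfm : measurable_fun setT fm.
  by apply: measurable_maxr => //; exact: measurableT_comp.
have fp0 y : 0 <= fp y by rewrite le_max lexx orbT.
have fm0 y : 0 <= fm y by rewrite le_max lexx orbT.
have fpf y : fp y <= `|f y| by rewrite ge_max ler_norm normr_ge0.
have fmf y : fm y <= `|f y| by rewrite ge_max -normrN ler_norm normr_ge0.
have fE y : f y = fp y - fm y.
  rewrite /fp /fm; have [h|/ltW h] := leP 0 (f y).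
    by rewrite max_r ?oppr_le0// subr0.
  by rewrite max_l ?oppr_ge0// sub0r opprK.
have ifp : mu.-integrable setT (EFin \o fp).
  apply: (integrable_fun_le _ _ (integrable_fun_abs fi)) => // y _.
  by rewrite ger0_norm.
have ifm : mu.-integrable setT (EFin \o fm).
  apply: (integrable_fun_le _ _ (integrable_fun_abs fi)) => // y _.
  by rewrite ger0_norm.
have FE : Rintegral mu setT f = \int[mu]_y fp y - \int[mu]_y fm y.
  by rewrite -RintegralB//; apply: eq_Rintegral => y _.
have ipg := integrable_smaller_moment g0 gk mf mfp fp0 fpf fi fk.
have img := integrable_smaller_moment g0 gk mf mfm fm0 fmf fi fk.
near=> eps.
have eps0 : 0 < eps by near: eps; exact: nbhs_right_gt.
have eg : 4 * eps <= tau * g.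
  rewrite mulrC -ler_pdivlMr//; near: eps; apply: nbhs_right_le.
  by rewrite divr_gt0.
have pe : 4 * (p%:R * eps) <= 1 - tau.
  rewrite mulrA mulrC -ler_pdivlMr ?mulr_gt0 ?ltr0n//; near: eps; apply: nbhs_right_le.
  by rewrite divr_gt0 ?subr_gt0 ?mulr_gt0 ?ltr0n.
have eps1 : eps < 1 - tau.
  have : 1 * eps <= p%:R * eps by rewrite ler_wpM2r// ltW.
  lra.
have Hp := ae_path_functional_asymptotics tau0 tau1 lnd occ g0 g1 tg fp0 mfp ifp ipg
  eps0 eps1 pg eg pe.
have Hm := ae_path_functional_asymptotics tau0 tau1 lnd occ g0 g1 tg fm0 mfm ifm img
  eps0 eps1 pg eg pe.
move: Hp Hm; apply: filterS2 => w hp hm.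
pose A t : \bar R := (\int[mu]_(s in `[0%R, t]) (f (X s w))%:E)%E.
have AE t : A t = (path_functional (fun t => X t w) fp t -
                   path_functional (fun t => X t w) fm t)%E.
  by rewrite /A integralE; congr (_ - _)%E; apply: eq_integral => s _;
    rewrite ?funeposE ?funenegE /= -?EFinN -EFin_max.
apply: (@ereal_quotient_cvg0 _ A (fun t => Rintegral mu setT f * L 0 t w)).
  by move=> t t0; rewrite powR_gt0.
move=> e e0; have e20 : 0 < e / 2 by rewrite divr_gt0.
apply: filterS2 (hp _ e20) (hm _ e20) => t [pA pB] [qA qB].
split; first by rewrite AE fin_numB pA.
rewrite AE fineB// FE.
have -> : fine (path_functional (fun t => X t w) fp t) -
    fine (path_functional (fun t => X t w) fm t) -
    (\int[mu]_y fp y - \int[mu]_y fm y) * L 0 t w =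
  (fine (path_functional (fun t => X t w) fp t) - \int[mu]_y fp y * L 0 t w) -
  (fine (path_functional (fun t => X t w) fm t) - \int[mu]_y fm y * L 0 t w) by ring.
apply: le_trans (ler_normB _ _) _; apply: le_trans (lerD pB qB) _.
by rewrite -mulrDl -splitr.
Unshelve. all: by end_near. Qed.
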